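(* Let $\varepsilon>0$. Then: (i) $v^\varepsilon$ is differentiable at every point of $\mathcal{M}^\varepsilon_\alpha(c)$. (ii) If $\gamma^\varepsilon$ is a minimizing curve of $v^\varepsilon$ and $(x^\varepsilon,\xi^\varepsilon)$ is an $\alpha$-limit point of $s\mapsto(\gamma^\varepsilon(s),\gamma^{\varepsilon\prime}(s))$ (a limit of $(\gamma^\varepsilon(\tau_j),\gamma^{\varepsilon\prime}(\tau_j))$ for some $\tau_j\to-\infty$), then $\xi^\varepsilon=H_p(x^\varepsilon,c+v^\varepsilon_x(x^\varepsilon))$. (iii) If $x^\varepsilon\in\mathcal{M}^\varepsilon_\alpha(c)$ and $x(s)$ is the solution of the discount Euler–Lagrange equation $\frac{d}{ds}L_\xi(x,x')=L_x(x,x')-\varepsilon L_\xi(x,x')+\varepsilon c$ with $x(0)=x^\varepsilon$, $x'(0)=H_p(x^\varepsilon,c+v^\varepsilon_x(x^\varepsilon))$, then for all $s\in\mathbb{R}$: $x(s)\in\mathcal{M}^\varepsilon_\alpha(c)$, $v^\varepsilon$ is differentiable at $x(s)$, and $v^\varepsilon_x(x(s))=L_\xi(x(s),x'(s))-c$.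
   Context: $H:\mathbb{T}^n\times\mathbb{R}^n\to\mathbb{R}$ is $C^2$, $H_{pp}$ is positive definite, $H(x,p)/|p|\to+\infty$ as $|p|\to\infty$ uniformly in $x$; $L(x,\xi)=\sup_p\{\xi\cdot p-H(x,p)\}$. $c\in\mathbb{R}^n$ is fixed and $h(c)$ is the unique constant for which $H(x,c+v_x)=h(c)$ has a viscosity solution on $\mathbb{T}^n$. For $\varepsilon>0$, $v^\varepsilon$ is the unique viscosity solution of $\varepsilon v^\varepsilon+H(x,c+v^\varepsilon_x)=h(c)$ on $\mathbb{T}^n$; for every $x$ and $T>0$, $v^\varepsilon(x)=\inf\{\int_{-T}^0e^{\varepsilon s}(L(\gamma,\gamma')-c\cdot\gamma'+h(c))ds+e^{-\varepsilon T}v^\varepsilon(\gamma(-T))\}$ over absolutely continuous $\gamma:[-T,0]\to\mathbb{T}^n$ with $\gamma(0)=x$. A (one-sided global) minimizing curve for $v^\varepsilon(x)$ is $\gamma^\varepsilon:(-\infty,0]\to\mathbb{T}^n$ with $\gamma^\varepsilon(0)=x$ whose restriction to every $[-T,0]$ attains this infimum; a minimizing curve of $v^\varepsilon$ is one for some $x$. $\mathcal{M}^\varepsilon_\alpha(c)$ is the closure of the set of all $\alpha$-limit points (limits of $\gamma^\varepsilon(\tau_j)$ with $\tau_j\to-\infty$) of all minimizing curves for $v^\varepsilon(x)$, $x\in\mathbb{T}^n$. *)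

(* Defs.v *)
(* The torus T^n is handled through Z^n-periodic
   objects on R^n = 'rV[R]_n. *)
From mathcomp Require Import all_boot all_order all_algebra.
From mathcomp Require Import all_classical all_reals all_analysis.
Set Implicit Arguments. Unset Strict Implicit. Unset Printing Implicit Defensive.
Import Order.TTheory GRing.Theory Num.Theory.
Import numFieldNormedType.Exports.
Local Open Scope classical_set_scope.
Local Open Scope ring_scope.

Definition dotv {R : realType} {n : nat} (u w : 'rV[R]_n) : R :=
  \sum_(i < n) u 0 i * w 0 i.

Definition evec {R : realType} {n : nat} (i : 'I_n) : 'rV[R]_n := delta_mx 0 i.

Definition grad {R : realType} {n : nat} (f : 'rV[R]_n -> R) (x : 'rV[R]_n)
  : 'rV[R]_n := \row_(i < n) ('D_(evec i) f) x.

Definition is_int_vec {R : realType} {n : nat} (k : 'rV[R]_n) : Prop :=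
  forall i, k 0 i \is a Num.int.

(* functions on T^n = Z^n-periodic functions on R^n *)
Definition Zperiodic {R : realType} {n : nat} {T : Type} (f : 'rV[R]_n -> T) :=
  forall x k, is_int_vec k -> f (x + k) = f x.

Definition C1 {R : realType} {E : normedModType R} (f : E -> R) : Prop :=
  forall u : E, (forall z, derivable f z u) /\ continuous ('D_u f).

Definition C2 {R : realType} {E : normedModType R} (f : E -> R) : Prop :=
  C1 f /\ forall u : E, C1 ('D_u f).

Definition uncurryH {R : realType} {n : nat} (H : 'rV[R]_n -> 'rV[R]_n -> R)
  : 'rV[R]_n * 'rV[R]_n -> R := fun z => H z.1 z.2.

Definition Hamiltonian_hyp {R : realType} {n : nat}
  (H : 'rV[R]_n -> 'rV[R]_n -> R) : Prop :=
  (forall x k p, is_int_vec k -> H (x + k) p = H x p) /\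
  C2 (uncurryH H) /\
  (forall x p (w : 'rV[R]_n), w != 0 ->
     0 < 'D_((0 : 'rV[R]_n), w) ('D_((0 : 'rV[R]_n), w) (uncurryH H)) (x, p)) /\
  (forall M : R, exists K : R, forall x p, K <= `|p| -> M * `|p| <= H x p).

Definition Lag {R : realType} {n : nat} (H : 'rV[R]_n -> 'rV[R]_n -> R)
  (x xi : 'rV[R]_n) : R :=
  sup (range (fun p : 'rV[R]_n => dotv xi p - H x p)).

Definition Lxi {R : realType} {n : nat} (H : 'rV[R]_n -> 'rV[R]_n -> R)
  (x xi : 'rV[R]_n) : 'rV[R]_n := grad (Lag H x) xi.
Definition Lx {R : realType} {n : nat} (H : 'rV[R]_n -> 'rV[R]_n -> R)
  (x xi : 'rV[R]_n) : 'rV[R]_n := grad (fun z => Lag H z xi) x.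
Definition Hp {R : realType} {n : nat} (H : 'rV[R]_n -> 'rV[R]_n -> R)
  (x p : 'rV[R]_n) : 'rV[R]_n := grad (H x) p.

Definition visc_sol {R : realType} {n : nat} (eps : R)
  (H : 'rV[R]_n -> 'rV[R]_n -> R) (c : 'rV[R]_n) (h : R)
  (u : 'rV[R]_n -> R) : Prop :=
  continuous u /\ Zperiodic u /\
  (forall (phi : 'rV[R]_n -> R) y, C1 phi ->
     (\forall z \near y, u z - phi z <= u y - phi y) ->
     eps * u y + H y (c + grad phi y) <= h) /\
  (forall (phi : 'rV[R]_n -> R) y, C1 phi ->
     (\forall z \near y, u y - phi y <= u z - phi z) ->
     h <= eps * u y + H y (c + grad phi y)).

Definition critical_value {R : realType} {n : nat}
  (H : 'rV[R]_n -> 'rV[R]_n -> R) (c : 'rV[R]_n) (h : R) : Prop :=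
  (exists u, visc_sol 0 H c h u) /\
  (forall h', (exists u, visc_sol 0 H c h' u) -> h' = h).

Definition abs_cont_on {R : realType} {n : nat} (g : R -> 'rV[R]_n) (a b : R)
  : Prop :=
  forall e : R, 0 < e -> exists d : R, 0 < d /\
    forall (m : nat) (s t : nat -> R),
      (forall k, (k < m)%N -> a <= s k /\ s k <= t k /\ t k <= b) ->
      (forall k, (k.+1 < m)%N -> t k <= s k.+1) ->
      \sum_(k < m) (t k - s k) < d ->
      \sum_(k < m) `|g (t k) - g (s k)| < e.

Definition segm {R : realType} (T : R) : set R := `[- T, 0].

Definition action {R : realType} {n : nat} (eps : R)
  (H : 'rV[R]_n -> 'rV[R]_n -> R) (c : 'rV[R]_n) (h : R)
  (v : 'rV[R]_n -> R) (g : R -> 'rV[R]_n) (T : R) : \bar R :=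
  (\int[@lebesgue_measure R]_(s in segm T)
     (expR (eps * s) * (Lag H (g s) ('D_1 g s) - dotv c ('D_1 g s) + h))%:E
   + (expR (- (eps * T)) * v (g (- T)))%:E)%E.

Definition admissible {R : realType} {n : nat} (x : 'rV[R]_n) (T : R)
  (g : R -> 'rV[R]_n) : Prop := abs_cont_on g (- T) 0 /\ g 0 = x.

Definition minimizing {R : realType} {n : nat} (eps : R)
  (H : 'rV[R]_n -> 'rV[R]_n -> R) (c : 'rV[R]_n) (h : R)
  (v : 'rV[R]_n -> R) (x : 'rV[R]_n) (g : R -> 'rV[R]_n) : Prop :=
  g 0 = x /\ forall T : R, 0 < T ->
    abs_cont_on g (- T) 0 /\
    action eps H c h v g T =
      ereal_inf [set action eps H c h v g' T | g' in admissible x T].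

Definition alpha_limit {R : realType} {n : nat} (g : R -> 'rV[R]_n)
  (y : 'rV[R]_n) : Prop :=
  exists (tau : nat -> R) (k : nat -> 'rV[R]_n),
    tau @ \oo --> -oo /\ (forall j, is_int_vec (k j)) /\
    (fun j => g (tau j) + k j) @ \oo --> y.

(* M^eps_alpha(c), as a Z^n-invariant closed subset of R^n *)
Definition Malpha {R : realType} {n : nat} (eps : R)
  (H : 'rV[R]_n -> 'rV[R]_n -> R) (c : 'rV[R]_n) (h : R)
  (v : 'rV[R]_n -> R) : set 'rV[R]_n :=
  closure [set y | exists x g, minimizing eps H c h v x g /\ alpha_limit g y].

(* Main.v *)
(* Straight segments are the only competitors needed. Let [g] be a minimizer, [y = g t] and
   [|w| <= mu^3]. Joining [g (t - mu^2)] to [y + w] by a segment bounds [v (y + w)] from above,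
   and joining [y + w] to [g (t + mu^2)] bounds it from below; together they show that [v] is
   affine on the ball of radius [mu^3] around [y] up to [O(mu^4)], uniformly in [t], with a
   slope [q t] independent of [mu]. This flatness is a closed condition on [y] and implies
   differentiability, so it holds on the whole limit set, where [q] is the gradient. The same
   estimates give [g' = Hp(g, c + q)], and following [w |-> v (g t + w) - v (g t)] along [g]
   gives [q' = - Hx(g, c + q) - eps q]: near -oo, the pair [(g, c + q)] solves the discounted
   Hamiltonian system, to which the Euler-Lagrange equation is equivalent by Legendre duality.
   A solution [x] starting in the limit set is then, by Gronwall, a limit of translates
   [g (tau_j + .) + k_j] of minimizers, and flatness and the limit set are closed. *)

(* The exponents come from a balance. Displacing by [w] the endpoint of a segment of duration [d]
   changes its velocity by [w / d], which costs [|w|^2 / d] in the action, while freezing position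
   and discount over the time [d] costs [d^2]. Both are [mu^4] when [d = mu^2] and [|w| = mu^3], and
   [mu^4] is small compared with [mu^3], which is what determines a slope. A minimizer is a priori
   only absolutely continuous, with no bound on its velocity, so no Euler-Lagrange equation is
   available for it at the start. Lower bounds on its action come instead from Fenchel's inequality
   with a constant covector: this integrates to an increment of the curve and sees the velocity only
   almost everywhere, hence the fundamental theorem of calculus for absolutely continuous functions.
   Upper bounds rest on a second-order expansion of the Lagrangian near [Hp x p], obtained from the
   uniform convexity of [H] in [p] on balls. All constants are uniform over minimizers and late
   times; otherwise nothing would pass to the closure that defines the limit set. *)
Require Import Defs.
From HB Require Import structures.
From mathcomp Require Import all_boot all_order all_algebra.
From mathcomp Require Import all_classical all_reals all_analysis.
From mathcomp Require Import measurable_realfun.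
From mathcomp Require Import ring lra.
Set Implicit Arguments. Unset Strict Implicit. Unset Printing Implicit Defensive.
Import Order.TTheory GRing.Theory Num.Theory.
Import numFieldNormedType.Exports.
Local Open Scope classical_set_scope.
Local Open Scope ring_scope.

(** * Integrals of possibly non-measurable functions *)

(* The integrand of the action is not known to be measurable; the library's integral is then a
   difference of suprema over simple functions, for which monotonicity and additivity in the
   domain remain true. *)
Section lower_integral.
Context d (T : measurableType d) (R : realType) (mu : {measure set T -> \bar R}).
Local Open Scope ereal_scope.
Import HBNNSimple.

Lemma ge0_le_lint (D : set T) (f g : T -> \bar R) :
  (forall x, D x -> 0 <= f x) -> (forall x, D x -> f x <= g x) ->
  \int[mu]_(x in D) f x <= \int[mu]_(x in D) g x.
Proof.
move=> f0 fg; rewrite !ge0_integralE//; last by move=> x Dx; rewrite (le_trans (f0 _ Dx))// fg.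
apply: le_ereal_sup => _ [h /= hf <-]; exists h => //= x.
by apply: le_trans (hf x) _; apply: lee_restrict.
Qed.

Lemma le_lint (D : set T) (f g : T -> \bar R) :
  (forall x, D x -> f x <= g x) ->
  \int[mu]_(x in D) f x <= \int[mu]_(x in D) g x.
Proof.
move=> fg; rewrite integralE [leRHS]integralE leeB//; apply: ge0_le_lint => // x Dx.
  by rewrite !funeposE; apply: le_max2 => //; exact: fg.
by rewrite !funenegE; apply: le_max2 => //; rewrite leeN2; exact: fg.
Qed.

(** Superadditivity adds a simple function below [f] on each piece; subadditivity cuts a simple
    function below [f] on the union. Passing to the two suprema one after the other requires
    subtraction, hence the separate case of an infinite integral over the union. *)
Lemma ge0_lint_setU (A B : set T) (f : T -> \bar R) :
  measurable A -> measurable B -> [disjoint A & B] -> (forall x, 0 <= f x) ->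
  \int[mu]_(x in A `|` B) f x = \int[mu]_(x in A) f x + \int[mu]_(x in B) f x.
Proof.
move=> mA mB AB f0.
have AB0 x : A x -> B x -> False.
  by move=> Ax Bx; move/disj_setPS: AB => /(_ x (conj Ax Bx)).
apply/eqP; rewrite eq_le; apply/andP; split.
  rewrite [leLHS]ge0_integralE//; apply: ge_ereal_sup => _ [h /= hf <-].
  have -> : sintegral mu h = \int[mu]_(x in A) (h x)%:E + \int[mu]_(x in B) (h x)%:E.
    rewrite -integralT_nnsfun -ge0_integral_setU//; last 2 first.
    - by apply/measurable_EFinP; exact: measurable_funTS.
    - by move=> x _; rewrite lee_fin.
    rewrite [RHS]integral_mkcond; apply: eq_integral => x _ /=.
    rewrite /patch; case: ifPn => // xAB; apply/eqP; rewrite eq_le; apply/andP; split; last by rewrite lee_fin.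
    by apply: le_trans (hf x) _; rewrite /patch (negbTE xAB).
  apply: leeD; apply: ge0_le_lint => // x Dx; (try by rewrite lee_fin);
    apply: le_trans (hf x) _; rewrite /patch ifT// inE; [by left|by right].
rewrite !(ge0_integralE mu (D := A))// !(ge0_integralE mu (D := B))//.
set SA := [set _ | _ in _]; set SB := [set _ | _ in _].
have SA0 : SA (0) by exists (nnsfun0) => /=; [move=> x; exact: erestrict_ge0|exact: sintegral0].
have SB0 : SB (0) by exists (nnsfun0) => /=; [move=> x; exact: erestrict_ge0|exact: sintegral0].
have key (h1 h2 : {nnsfun T >-> R}) : (forall x, (h1 x)%:E <= (f \_ A) x) -> (forall x, (h2 x)%:E <= (f \_ B) x) ->
   sintegral mu h1 + sintegral mu h2
   <= \int[mu]_(x in A `|` B) f x.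
  move=> H1 H2; rewrite ge0_integralE//; apply: ereal_sup_ubound.
  exists (add_nnsfun h1 h2) => /=; last by rewrite sintegralD.
  move=> x; rewrite EFinD; move: (H1 x) (H2 x); rewrite /patch.
  have [xA|xA] := pselect (A x); have [xB|xB] := pselect (B x).
  - by have := AB0 _ xA xB.
  - rewrite (mem_set xA) (memNset xB) mem_set; last by left.
    by move=> h1x h2x; rewrite -[leRHS]adde0; exact: leeD.
  - rewrite (memNset xA) (mem_set xB) mem_set; last by right.
    by move=> h1x h2x; rewrite -[leRHS]add0e; exact: leeD.
  - rewrite (memNset xA) (memNset xB) memNset; last by case.
    by move=> h1x h2x; rewrite -[leRHS]add0e; exact: leeD.
have I0 : 0 <= \int[mu]_(x in A `|` B) f x by apply: integral_ge0.
have [->|Ifin] := eqVneq (\int[mu]_(x in A `|` B) f x) +oo; first by rewrite leey.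
have If : \int[mu]_(x in A `|` B) f x \is a fin_num by rewrite ge0_fin_numE// ltey.
have SBle (h1 : {nnsfun T >-> R}) : (forall x, (h1 x)%:E <= (f \_ A) x) ->
   ereal_sup SB <= \int[mu]_(x in A `|` B) f x - sintegral mu h1.
  move=> H1; apply: ge_ereal_sup => _ [h2 /= H2 <-].
  have := key _ _ H1 H2 => k.
  rewrite leeBrDl//; rewrite ge0_fin_numE; last exact: sintegral_ge0.
  apply: le_lt_trans (_ : _ <= \int[mu]_(x in A `|` B) f x) _; last by rewrite ltey.
  by apply: le_trans k; rewrite leeDl// sintegral_ge0.
have SBf : ereal_sup SB \is a fin_num.
  rewrite ge0_fin_numE; last exact: ereal_sup_ubound.
  have := SBle (nnsfun0) (erestrict_ge0 (fun x _ => f0 x)).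
  rewrite (eq_sintegral (cst 0%R))// sintegral0 sube0 => /le_lt_trans; apply; by rewrite ltey.
rewrite -leeBrDr//; apply: ge_ereal_sup => _ [h1 /= H1 <-].
rewrite leeBrDr// addeC -leeBrDr; first exact: SBle.
rewrite ge0_fin_numE; last exact: sintegral_ge0.
apply: le_lt_trans (_ : _ <= \int[mu]_(x in A `|` B) f x) _; last by rewrite ltey.
have := key h1 (nnsfun0) H1 (erestrict_ge0 (fun x _ => f0 x)).
by rewrite [in X in _ + X](eq_sintegral (cst 0%R))// sintegral0 adde0.
Qed.

(** Finite negative parts exclude the form [+oo - oo] when the positive and negative parts are
    regrouped. *)
Lemma lint_setU (A B : set T) (f : T -> \bar R) :
  measurable A -> measurable B -> [disjoint A & B] ->
  \int[mu]_(x in A) f^\- x \is a fin_num ->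
  \int[mu]_(x in B) f^\- x \is a fin_num ->
  \int[mu]_(x in A `|` B) f x = \int[mu]_(x in A) f x + \int[mu]_(x in B) f x.
Proof.
move=> mA mB AB fA fB; rewrite integralE (integralE _ A) (integralE _ B).
rewrite !ge0_lint_setU// fin_num_oppeD// addeACA//.
Qed.

Lemma lint_neg_fin_num (D : set T) (f : T -> R) (K : R) : measurable D ->
  mu D < +oo -> (forall x, D x -> (- K <= f x)%R) ->
  \int[mu]_(x in D) (EFin \o f)^\- x \is a fin_num.
Proof.
move=> mD Dfin Kf; rewrite ge0_fin_numE; last by apply: integral_ge0.
apply: le_lt_trans (_ : _ <= \int[mu]_(x in D) cst (Num.max K 0)%:E x) _.
  apply: ge0_le_lint => // x Dx; rewrite funenegE /= EFin_max; apply: le_max2 => //.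
  by rewrite lee_fin lerNl Kf.
by rewrite integral_cst// lte_mul_pinfty// ?lee_fin ?le_max ?lexx ?orbT.
Qed.

(** Monotonicity of the integral of a non-measurable function needs an inequality at every point. On
    the exceptional null set [k] is therefore replaced by the lower bound [- K], which changes
    neither its integral nor its measurability. *)
Lemma lint_ge_ae (D : set T) (k f : T -> R) (K : R) : measurable D ->
  mu.-integrable D (EFin \o k) ->
  {ae mu, forall x, D x -> (k x <= f x)%R} ->
  (forall x, D x -> (- K <= f x)%R) ->
  \int[mu]_(x in D) (k x)%:E <= \int[mu]_(x in D) (f x)%:E.
Proof.
move=> mD ki [N [mN N0 kfN]] Kf.
pose k' x := if x \in N then (- K)%R else k x.
have mk' : measurable_fun D k'.
  apply: measurable_fun_if => //.
  - by apply: (measurable_fun_bool true) => //; rewrite preimage_mem_true; exact: measurableI.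
  - apply: measurable_funS (_ : measurable_fun D _) => //.
    by apply/measurable_EFinP; case/integrableP : ki.
have -> : \int[mu]_(x in D) (k x)%:E = \int[mu]_(x in D) (k' x)%:E.
  apply: ae_eq_integral => //; first by case/integrableP : ki.
    exact/measurable_EFinP.
  exists N; split => // x /= /not_implyP[Dx]; rewrite /k'.
  by have [xN _|//] := boolP (x \in N); exact: set_mem.
apply: le_lint => x Dx; rewrite lee_fin /k'; case: ifPn => [_|xN]; first exact: Kf.
apply: contrapT => kfx; move/negP : xN; apply; apply/mem_set/kfN => /= H.
exact/kfx/H.
Qed.

End lower_integral.

(** * The fundamental theorem of calculus for absolutely continuous functions *)

(** Coordinates of a curve and scalar functions built from it need this notion too, hence the
    general normed space; on row vectors it unfolds to [abs_cont_on]. *)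
Definition abs_cont {R : realType} {V : normedModType R} (F : R -> V) (a b : R)
  : Prop :=
  forall e : R, 0 < e -> exists d : R, 0 < d /\
    forall (m : nat) (s t : nat -> R),
      (forall k, (k < m)%N -> a <= s k /\ s k <= t k /\ t k <= b) ->
      (forall k, (k.+1 < m)%N -> t k <= s k.+1) ->
      \sum_(k < m) (t k - s k) < d ->
      \sum_(k < m) `|F (t k) - F (s k)| < e.

Lemma abs_cont_le {R : realType} {V W : normedModType R} (F : R -> V)
    (G : R -> W) (a b C : R) : abs_cont F a b ->
  (forall s t, a <= s -> s <= t -> t <= b ->
     `|G t - G s| <= C * (`|F t - F s| + (t - s))) ->
  abs_cont G a b.
Proof.
move=> Fac GF e e0.
pose D := `|C| + 1.
have D0 : 0 < D by rewrite /D ltr_wpDl.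
have De : 0 < e / (2 * D) by rewrite divr_gt0// mulr_gt0.
have [d [d0 Fd]] := Fac _ De.
exists (Num.min d (e / (2 * D))); split; first by rewrite lt_min d0.
move=> m s t st ts; rewrite lt_min => /andP[std stD].
have := Fd m s t st ts std => H.
apply: (@le_lt_trans _ _ (\sum_(k < m) D * (`|F (t k) - F (s k)| + (t k - s k)))).
  apply: ler_sum => k _; have [h1 [h2 h3]] := st k (ltn_ord k).
  apply: le_trans (GF _ _ h1 h2 h3) _; apply: ler_wpM2r.
    by rewrite addr_ge0// subr_ge0.
  by rewrite /D (le_trans (ler_norm C))// lerDl.
rewrite -mulr_sumr big_split/=.
rewrite mulrC -ltr_pdivlMr// (_ : e / D = e / (2 * D) + e / (2 * D)); last first.
  by field; rewrite ?gt_eqF.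
exact: ltrD.
Qed.

Section chains.
Context {R : realType}.
Implicit Types (a b c : R) (l : seq (R * R)).

(** Finite families of non-overlapping intervals are kept as lists, so that families found in
    successive cells can be concatenated. *)
Fixpoint chain a b l : bool :=
  if l is p :: l' then [&& a <= p.1, p.1 <= p.2 & chain p.2 b l'] else a <= b.

Lemma chain_le a b l : chain a b l -> a <= b.
Proof.
elim: l a => //= I l IH a /and3P[aI I12 /IH Ib].
exact: le_trans aI (le_trans I12 Ib).
Qed.

Lemma chain_cat a b c l l' : chain a b l -> chain b c l' -> chain a c (l ++ l').
Proof.
elim: l a => [|I l IH] a /=.
  by case: l' => [|J l']/=; [exact: le_trans|move=> ab /andP[bJ ->]; rewrite (le_trans ab)].
by move=> /and3P[-> -> lb] bl'; exact: IH.
Qed.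

Lemma chain_nth a b l k : chain a b l -> (k < size l)%N ->
  let s j := (nth (0, 0) l j).1 in let t j := (nth (0, 0) l j).2 in
  a <= s k /\ s k <= t k /\ t k <= b.
Proof.
elim: l a k => // I l IH a [|k] /= /and3P[aI I12 ch].
  by move=> _; rewrite aI I12 (chain_le ch).
rewrite ltnS => kl; have [h1 [h2 h3]] := IH _ _ ch kl; split => //.
exact: le_trans aI (le_trans I12 h1).
Qed.

Lemma chain_nthS a b l k : chain a b l -> (k.+1 < size l)%N ->
  (nth (0, 0) l k).2 <= (nth (0, 0) l k.+1).1.
Proof.
elim: l a k => // I l IH a [|k] /= /and3P[aI I12 ch].
  by rewrite ltnS => l0; have [] := chain_nth ch l0.
by rewrite ltnS; exact: (IH _ _ ch).
Qed.

Lemma chain_partition a b s : itv_partition a b s -> chain a b (zip (a :: s) s).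
Proof.
elim: s a => [a [_ /eqP /= ->]//|x s IH a ab].
rewrite /= lexx (IH _ (itv_partition_cons ab)) andbT.
by case: ab => /= /andP[/ltW].
Qed.

Lemma sumlen_partition a b s : itv_partition a b s ->
  \sum_(I <- zip (a :: s) s) (I.2 - I.1) = b - a.
Proof.
elim: s a => [a [_ /eqP /= ->]|x s IH a ab]; first by rewrite big_nil subrr.
rewrite /= big_cons (IH _ (itv_partition_cons ab))/=; ring.
Qed.

Lemma variation_partition a b (F : R -> R) s : itv_partition a b s ->
  \sum_(I <- zip (a :: s) s) `|F I.2 - F I.1| = variation a b F s.
Proof.
move=> ab; rewrite (variation_zip F ab).
elim: s a ab => [a _|x s IH a ab]; first by rewrite !big_nil.
by rewrite /= !big_cons (IH _ (itv_partition_cons ab)).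
Qed.

Lemma abs_cont_chain {V : normedModType R} (F : R -> V) a b e : abs_cont F a b ->
  0 < e -> exists2 d, 0 < d & forall l, chain a b l ->
    \sum_(I <- l) (I.2 - I.1) < d -> \sum_(I <- l) `|F I.2 - F I.1| < e.
Proof.
move=> Fac e0; have [d [d0 H]] := Fac e e0; exists d => // l ch.
rewrite !(big_nth (0, 0)) !big_mkord.
apply: (H _ (fun j => (nth (0, 0) l j).1) (fun j => (nth (0, 0) l j).2)) => k kl.
  exact: chain_nth ch kl.
exact: chain_nthS ch kl.
Qed.

Lemma chain_sub a b c c' l : a <= c -> c' <= b -> chain c c' l -> chain a b l.
Proof.
move=> ac cb ch; rewrite -(cats0 l); apply: (@chain_cat _ c'); last by [].
by rewrite -(cat0s l); apply: (@chain_cat _ c).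
Qed.

End chains.

Section total_variation_abs_cont.
Context {R : realType} (F : R -> R) (a b : R).
Hypothesis Fac : abs_cont F a b.
Notation TV := total_variation.

(** Every partition of [[x, y]] is a chain of total length [y - x], so absolute continuity bounds
    all its variations at once. *)
Lemma abs_cont_TV_small e : 0 < e -> exists2 d, 0 < d &
  forall x y, a <= x -> x <= y -> y <= b -> y - x < d -> (TV x y F <= e%:E)%E.
Proof.
move=> e0; have [d d0 H] := abs_cont_chain Fac e0; exists d => // x y ax xy yb xyd.
apply: ge_ereal_sup => _ [_ [s xys <-] <-]; rewrite lee_fin -(variation_partition F xys).
apply/ltW/H; last by rewrite (sumlen_partition xys).
exact: chain_sub (chain_partition xys).
Qed.

(** [[a, z]] is cut into finitely many intervals shorter than [d], each of variation at most 1. *)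
Lemma abs_cont_TV_fin x y : a <= x -> x <= y -> y <= b -> TV x y F \is a fin_num.
Proof.
move=> ax xy yb; have [d d0 H] := abs_cont_TV_small ltr01.
suff : forall n z, a <= z -> z <= b -> z - a <= d / 2 *+ n -> TV a z F \is a fin_num.
  move=> HH; have yf : TV a y F \is a fin_num.
    have d20 : 0 < d / 2 by rewrite divr_gt0.
    apply: (HH (Num.bound ((y - a) / (d / 2)))) => //; first exact: le_trans ax xy.
    have : 0 <= (y - a) / (d / 2) by rewrite divr_ge0 ?(ltW d20)// subr_ge0 (le_trans ax).
    by move=> /archi_boundP; rewrite ltr_pdivrMr// mulrC mulr_natr => /ltW.
  by move: yf; rewrite (total_variationD F ax xy) fin_numD => /andP[].
elim=> [|n IH] z az zb; first by rewrite mulr0n => za; rewrite (_ : z = a) ?total_variationxx//; lra.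
rewrite mulrS => zad.
have [zd|dz] := ltP (z - a) d.
  rewrite ge0_fin_numE ?total_variation_ge0//.
  by apply: le_lt_trans (H _ _ _ _ _ zd) _; rewrite ?ltry.
have h1 : a <= z - d / 2 by lra.
have h2 : z - d / 2 <= z by lra.
rewrite (total_variationD F h1 h2) fin_numD IH//=; [|lra|lra].
rewrite ge0_fin_numE ?total_variation_ge0//.
by apply: (@le_lt_trans _ _ 1%:E); [apply: H => //; lra|rewrite ltry].
Qed.

Definition tv x := fine (TV a x F).

Lemma tvB x y : a <= x -> x <= y -> y <= b -> tv y - tv x = fine (TV x y F).
Proof.
move=> ax xy yb; rewrite /tv (total_variationD F ax xy) fineD ?abs_cont_TV_fin//.
  by rewrite addrAC subrr add0r.
exact: le_trans yb.
Qed.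

Lemma tv_ge x y : a <= x -> x <= y -> y <= b -> `|F y - F x| <= tv y - tv x.
Proof.
move=> ax xy yb; rewrite tvB// -lee_fin fineK ?abs_cont_TV_fin//.
exact: total_variation_ge.
Qed.

Lemma tv_small e : 0 < e -> exists2 d, 0 < d &
  forall x y, a <= x -> x <= y -> y <= b -> y - x < d -> tv y - tv x <= e.
Proof.
move=> e0; have [d d0 H] := abs_cont_TV_small e0; exists d => // x y ax xy yb xyd.
by rewrite tvB// -lee_fin fineK ?abs_cont_TV_fin// H.
Qed.

Lemma tv_approx x y e : 0 < e -> a <= x -> x <= y -> y <= b ->
  exists l, [/\ chain x y l, \sum_(I <- l) (I.2 - I.1) = y - x &
    tv y - tv x <= \sum_(I <- l) `|F I.2 - F I.1| + e].
Proof.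
move=> e0 ax xy yb; rewrite tvB//.
have fn : ereal_sup [set x%:E | x in variations x y F] \is a fin_num.
  exact: abs_cont_TV_fin.
have [_ [_ [s xys <-] <-]] := ub_ereal_sup_adherent e0 fn => H.
exists (zip (x :: s) s); split; first exact: chain_partition.
  exact: sumlen_partition.
rewrite (variation_partition F xys) -lerBlDr ltW// -lte_fin EFinB fineK//.
Qed.

End total_variation_abs_cont.

Lemma stieltjes_itv {R : realType} (G : cumulative R R) (x y : R) : x <= y ->
  lebesgue_stieltjes_measure G `]x, y]%classic = (G y - G x)%:E.
Proof.
move=> xy; rewrite /lebesgue_stieltjes_measure /measure_extension.
rewrite measurable_mu_extE/=; last exact: is_ocitv.
by rewrite wlength_itv_bnd.
Qed.

(** * Absolute continuity of a Stieltjes measure controlled by the total variation *)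

Section stieltjes_dominated.
Context {R : realType} (F : R -> R) (a b : R).
Hypothesis (ab : a < b) (Fac : abs_cont F a b).
Variable G : cumulative R R.
Hypothesis GF : forall x y, a <= x -> x <= y -> y <= b ->
  G y - G x <= 2 * (tv F a y - tv F a x).
Notation nu := (lebesgue_stieltjes_measure G).
Notation mu := (@lebesgue_measure R).

(* The cells of a uniform partition contained in [U] have both a Lebesgue measure and a total
   variation computed by a single chain, to which absolute continuity applies. *)
Let cells_cover (U : set R) (h e : R) (N : nat) : open U -> 0 < e -> 0 < h ->
  a + h *+ N <= b ->
  exists C l, [/\ measurable C /\ C `<=` U `&` `]-oo, a + h *+ N]%classic,
    mu C = (\sum_(I <- l) (I.2 - I.1))%:E,
    (nu C <= (2 * (\sum_(I <- l) `|F I.2 - F I.1| + e *+ N))%:E)%E,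
    chain a (a + h *+ N) l &
    forall j, (j < N)%N -> `]a + h *+ j, a + h *+ j.+1]%classic `<=` U ->
       `]a + h *+ j, a + h *+ j.+1]%classic `<=` C].
Proof.
move=> oU e0 h0; elim: N => [_|N IH Nb].
  exists set0, [::]; rewrite !mulr0n addr0 !big_nil !measure0 add0r mulr0 /= lexx.
  by split => //; split.
have hN : a + h *+ N <= a + h *+ N.+1 by rewrite lerD2l mulrS lerDr ltW.
have hN' : h *+ N.+1 - h *+ N = h by rewrite mulrS; ring.
have ahN : a <= a + h *+ N by rewrite lerDl mulrn_wge0// ltW.
have [C [l [[mC CU] muC nuC ch cov]]] := IH (le_trans hN Nb).
have [sel|nsel] := pselect (`]a + h *+ N, a + h *+ N.+1]%classic `<=` U); last first.
  exists C, l; split => //.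
  - split => //; by move=> x /CU[Ux]; rewrite /= !in_itv/= => xN; split => //=; rewrite (le_trans xN).
  - apply: le_trans nuC _; rewrite lee_fin ler_pM2l// lerD2l mulrS lerDr; exact: ltW.
  - by apply: chain_sub ch.
  - by move=> j; rewrite ltnS leq_eqVlt => /predU1P[->//|jN]; exact: cov.
have [l' [ch' len' tv']] := tv_approx Fac e0 ahN hN Nb.
pose I : set R := `]a + h *+ N, a + h *+ N.+1]%classic.
have mI : measurable I by exact: measurable_itv.
have disj : [disjoint C & I].
  apply/disj_setPS => x [/CU[_]]; rewrite /I /= !in_itv/= => xN /andP[]; lra.
exists (C `|` I), (l ++ l'); rewrite !big_cat/=; split => //.
- split; first exact: measurableU.
  move=> x [/CU[Ux]|xI]; rewrite /= !in_itv/=.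
    by move=> xN; split => //=; rewrite (le_trans xN).
  by split; [exact: sel|move: xI; rewrite /I/= !in_itv/= => /andP[]].
- rewrite measureU//; last by apply/eqP; rewrite -disj_set2E.
  rewrite [X in (X + _)%E]muC EFinD; congr (_ + _)%E.
  rewrite [LHS]lebesgue_measure_itv/= lte_fin len'.
  case: ltP => // hh; rewrite -?EFinB//.
  by congr (_%:E); lra.
- apply: le_trans (measureU2 _ _ _) _ => //.
  rewrite -[in leRHS]addrA mulrDr EFinD.
  have := leeD nuC (lexx (nu I)); move=> /le_trans; apply.
  rewrite stieltjes_itv// -!EFinD lee_fin.
  rewrite (mulrS e); have := GF ahN hN Nb; move: tv'.
  move: (G _) (G _) (tv F a _) (tv F a _) (e *+ N) => *; lra.
- exact: chain_cat ch ch'.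
- move=> j; rewrite ltnS leq_eqVlt => /predU1P[-> _|jN jU]; first by right.
  by apply: subset_trans (cov _ jN jU) _; left.
Qed.

Let find_cell (x h : R) (N : nat) : a < x -> 0 < h -> x <= a + h *+ N ->
  exists2 j, (j < N)%N & a + h *+ j < x <= a + h *+ j.+1.
Proof.
move=> ax h0; elim: N => [|N IH]; first by rewrite mulr0n; lra.
have [xN|Nx] := leP x (a + h *+ N).
  by move=> _; have [j jN] := IH xN; exists j => //; rewrite ltnS ltnW.
by move=> xN; exists N => //; rewrite Nx.
Qed.

(** At each scale the cells contained in [U] have [nu]-measure at most [e], but these sets are not
    nested as the scale is refined. The tail intersections [B k] are, and they exhaust [U] because a
    point of an open set lies in a selected cell at every sufficiently fine scale. *)
Lemma stieltjes_open_small e : 0 < e -> exists2 d, 0 < d &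
  forall U, open U -> (mu U < d%:E)%E -> (nu (U `&` `]a, b]%classic) <= e%:E)%E.
Proof.
(* The cells weigh at most [2 * (e / 4 + e / 4)]; the second quarter is the error of [tv_approx],
   shared among the [N.+1] cells. *)
move=> e0; have e4 : 0 < e / 4 by rewrite divr_gt0.
have [d d0 H] := abs_cont_chain Fac e4; exists d => // U oU Ud.
pose h N : R := (b - a) / N.+1%:R.
have h0 N : 0 < h N by rewrite divr_gt0// subr_gt0.
have hN N : a + h N *+ N.+1 = b.
  by rewrite -mulr_natr /h divfK ?pnatr_eq0// addrC subrK.
pose P N C := [/\ measurable C, C `<=` U, (nu C <= e%:E)%E &
   forall j, (j < N.+1)%N -> `]a + h N *+ j, a + h N *+ j.+1]%classic `<=` U ->
       `]a + h N *+ j, a + h N *+ j.+1]%classic `<=` C].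
have /choice[C HC] : forall N, exists C, P N C.
  move=> N; have eN : 0 < e / 4 / N.+1%:R by rewrite divr_gt0.
  have hNb : a + h N *+ N.+1 <= b by rewrite hN.
  have [C [l [[mC CU] muC nuC ch cov]]] := cells_cover oU eN (h0 N) hNb.
  exists C; split => //; first by move=> x /CU[].
  apply: le_trans nuC _; rewrite lee_fin -[_ *+ N.+1]mulr_natr divfK ?pnatr_eq0//.
  rewrite hN in ch; have := H _ ch.
  have -> : \sum_(I <- l) (I.2 - I.1) < d.
    rewrite -lte_fin -muC; apply: le_lt_trans Ud; apply: le_measure; rewrite ?inE//.
      exact: open_measurable.
    by move=> x /CU[].
  by move=> /(_ isT); lra.
pose B k := \bigcap_(m in [set m | (k <= m)%N]) C m.
have mB k : measurable (B k).
  by apply: bigcap_measurable => [|m _]; [exists k => /=|case: (HC m)].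
have ndB : nondecreasing_seq B.
  move=> k k' kk'; apply/subsetPset => x Bx m /= k'm; apply: Bx => /=.
  exact: leq_trans k'm.
have cvB := nondecreasing_cvg_mu (mu := nu) mB (bigcupT_measurable _ mB) ndB.
have UB : U `&` `]a, b]%classic `<=` \bigcup_k B k.
  move=> x [Ux]; rewrite /= in_itv/= => /andP[ax xb].
  have /nbhs_ballP[r /= r0 xr] : nbhs x U by exact: open_nbhs_nbhs.
  have [k Hk] : exists k, forall m, (k <= m)%N -> h m < r.
    exists (Num.bound ((b - a) / r)) => m km.
    have : (b - a) / r < (Num.bound ((b - a) / r))%:R.
      by apply: archi_boundP; rewrite divr_ge0 ?(ltW r0)// subr_ge0 ltW.
    rewrite ltr_pdivrMr// => h1; rewrite /h ltr_pdivrMr//.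
    apply: lt_le_trans h1 _; rewrite mulrC ler_pM2l// ler_nat; exact: leq_trans km _.
  exists k => // m /= km; have [mC CU _ cov] := HC m.
  have xN : x <= a + h m *+ m.+1 by rewrite hN.
  have [j jN /andP[jx xj]] := find_cell ax (h0 m) xN.
  apply: (cov j jN); last by rewrite /= in_itv/= jx.
  move=> y; rewrite /= in_itv/= => /andP[jy yj]; apply: xr.
  rewrite /ball/= ltr_norml; have := Hk _ km; rewrite mulrS in xj yj.
  move: (h m *+ j) jx jy xj yj => z; lra.
apply: le_trans (_ : _ <= nu (\bigcup_k B k))%E _.
  apply: le_measure; rewrite ?inE//; last exact: bigcupT_measurable.
  by apply: measurableI => //; exact: open_measurable.
rewrite -(cvg_lim _ cvB)//; apply: lime_le; first by apply/cvg_ex; eexists; exact: cvB.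
apply: nearW => k /=; have [mC _ Ck _] := HC k; apply: le_trans Ck.
by apply: le_measure; rewrite ?inE; [exact: mB|exact: mC|move=> x; apply => /=].
Qed.

(** Outer regularity encloses the null set in an open set of small Lebesgue measure. *)
Lemma stieltjes_dominated (A : set R) : measurable A -> mu A = 0%E ->
  nu (A `&` `]a, b]%classic) = 0%E.
Proof.
move=> mA A0; apply/eqP; rewrite eq_le measure_ge0 andbT.
apply/lee_addgt0Pr => e e0; rewrite add0e.
have [d d0 H] := stieltjes_open_small e0.
have Afin : (mu A < +oo)%E by rewrite A0 ltry.
have [U [oU AU UA]] := lebesgue_regularity_outer mA Afin d0.
have Ud : (mu U < d%:E)%E.
  rewrite -(setDUK AU) measureU//; first by rewrite [X in (X + _)%E]A0 add0e.
    by apply: measurableD => //; exact: open_measurable.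
  by rewrite setDIK.
apply: le_trans (H U oU Ud); apply: le_measure; rewrite ?inE//.
- by apply: measurableI => //.
- by apply: measurableI => //; exact: open_measurable.
- by apply: setSI.
Qed.

End stieltjes_dominated.

Section abs_cont_density.
Context {R : realType} (F : R -> R) (a b : R).
Hypothesis (ab : a < b) (Fac : abs_cont F a b).
Notation mu := (@lebesgue_measure R).

(** Radon-Nikodym for the Stieltjes measure of [K]. The factor 2 admits both terms of the
    decomposition [F = (tv + F) - tv]: their increments are nonnegative and at most twice those of
    [tv]. *)
Lemma tv_dominated_density (K : R -> R) :
  (forall x y, a <= x -> x <= y -> y <= b ->
     K x <= K y <= K x + 2 * (tv F a y - tv F a x)) ->
  exists2 phi : R -> R, mu.-integrable setT (EFin \o phi) &
    forall x y, a <= x -> x <= y -> y <= b ->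
      (\int[mu]_(t in `]x, y]%classic) (phi t)%:E = (K y - K x)%:E)%E.
Proof.
(* A cumulative function must be monotone on the whole line, so [K] is extended by constants outside
   [[a, b]]. *)
move=> HK; pose cl x := Num.max a (Num.min x b); pose f x := K (cl x).
have cl_ge x : a <= cl x by rewrite le_max lexx.
have cl_le x : cl x <= b by rewrite ge_max (ltW ab) ge_min lexx orbT.
have cl_mono x y : x <= y -> cl x <= cl y.
  by move=> xy; apply: le_max2 => //; apply: le_min2.
have cl_lip x y : x <= y -> cl y - cl x <= y - x.
  move=> xy; rewrite /cl /Num.max /Num.min; do 4 case: ifPn; rewrite -?leNgt => *; lra.
have cl_id x : a <= x -> x <= b -> cl x = x.
  by move=> ax xb; rewrite /cl (min_idPl xb) (max_idPr ax).
have nd : {homo f : x y / x <= y}.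
  by move=> x y xy; have /andP[] := HK _ _ (cl_ge x) (cl_mono _ _ xy) (cl_le y).
have rc : right_continuous f.
  move=> x; apply/cvgrPdist_le => e e0.
  have e2 : 0 < e / 2 by rewrite divr_gt0.
  have [d d0 H] := tv_small Fac e2.
  exists d => //= y; rewrite /ball/= => xyd xy.
  have /andP[h1 h2] := HK _ _ (cl_ge x) (cl_mono _ _ (ltW xy)) (cl_le y).
  have h3 : tv F a (cl y) - tv F a (cl x) <= e / 2.
    apply: H => //; first exact/cl_mono/ltW.
    apply: le_lt_trans (cl_lip _ _ (ltW xy)) _; move: xyd; rewrite ltr_norml; lra.
  rewrite /f distrC ger0_norm; lra.
pose G : cumulative R R := HB.pack f (isCumulative.Build R _ R f nd rc).
have GF x y : a <= x -> x <= y -> y <= b -> G y - G x <= 2 * (tv F a y - tv F a x).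
  move=> ax xy yb; have /andP[h1 h2] := HK _ _ ax xy yb.
  have ay := le_trans ax xy; have xb := le_trans xy yb.
  by rewrite /G /= /f !cl_id//; lra.
have mD : measurable (`]a, b]%classic : set (measurableTypeR R)) by exact: measurable_itv.
have Dfin : (lebesgue_stieltjes_measure G `]a, b]%classic < +oo)%E.
  by rewrite stieltjes_itv ?ltry// ltW.
pose nu := charge_of_finite_measure (mfrestr mD Dfin).
have nudom : nu `<< mu.
  apply/null_content_dominatesP => A mA A0.
  exact: (stieltjes_dominated ab Fac GF mA A0).
exists (fine \o (Radon_Nikodym nu mu)).
  apply: (eq_integrable measurableT (Radon_Nikodym nu mu)).
    by move=> x _ /=; rewrite fineK// Radon_Nikodym_fin_num.
  exact: Radon_Nikodym_integrable.
move=> x y ax xy yb.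
have mI : measurable (`]x, y]%classic : set R) by exact: measurable_itv.
have -> : (\int[mu]_(t in `]x, y]%classic) ((fine \o (Radon_Nikodym nu mu)) t)%:E =
  \int[mu]_(t in `]x, y]%classic) (Radon_Nikodym nu mu) t)%E.
  by apply: eq_integral => t _ /=; rewrite fineK// Radon_Nikodym_fin_num.
rewrite -Radon_Nikodym_integral//.
rewrite /nu /charge_of_finite_measure /mfrestr /mrestr.
have E : `]x, y]%classic `&` `]a, b]%classic = `]x, y]%classic :> set (measurableTypeR R).
  apply/seteqP; split => [t []//|t]; rewrite /= !in_itv/= => /andP[xt ty].
  by rewrite xt ty (le_lt_trans ax xt) (le_trans ty yb).
have ay := le_trans ax xy; have xb := le_trans xy yb.
transitivity (lebesgue_stieltjes_measure G `]x, y]%classic); first exact: (congr1 (lebesgue_stieltjes_measure G) E).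
by rewrite stieltjes_itv// /G /= /f !cl_id.
Qed.

(** The density of [F] is the difference of the densities of [tv + F] and [tv]. Lebesgue
    differentiation of its primitive from [-oo] then identifies it with the derivative almost
    everywhere. *)
Theorem abs_cont_FTC : exists phi : R -> R,
  [/\ mu.-integrable setT (EFin \o phi),
   forall x y, a <= x -> x <= y -> y <= b ->
      (\int[mu]_(t in `]x, y]%classic) (phi t)%:E = (F y - F x)%:E)%E &
   {ae mu, forall x, a < x < b -> is_derive x 1 F (phi x)}].
Proof.
have V0 x y : a <= x -> x <= y -> y <= b -> `|F y - F x| <= tv F a y - tv F a x.
  exact: tv_ge.
have [|p1 ip1 p1E] := tv_dominated_density (K := tv F a).
  by move=> x y ax xy yb; have := V0 x y ax xy yb; have := normr_ge0 (F y - F x); lra.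
have [|p2 ip2 p2E] := tv_dominated_density (K := fun x => tv F a x + F x).
  by move=> x y ax xy yb; have := V0 x y ax xy yb; rewrite ler_norml; lra.
pose phi x := p2 x - p1 x; exists phi.
have iphi : mu.-integrable setT (EFin \o phi).
  rewrite (_ : EFin \o phi = (EFin \o p2) \- (EFin \o p1))%E//.
  exact: integrableB.
have phiE x y : a <= x -> x <= y -> y <= b ->
      (\int[mu]_(t in `]x, y]%classic) (phi t)%:E = (F y - F x)%:E)%E.
  move=> ax xy yb.
  have -> : (\int[mu]_(t in `]x, y]%classic) (phi t)%:E =
     \int[mu]_(t in `]x, y]%classic) ((EFin \o p2) t - (EFin \o p1) t))%E by [].
  rewrite integralB//; try exact: (integrableS measurableT).
  rewrite p1E// p2E// -EFinB; congr (_%:E); ring.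
split => //.
have intNy y : mu.-integrable `]-oo, y] (EFin \o phi) by exact: (integrableS measurableT).
have lphi : locally_integrable [set: R] phi.
  by apply: open_integrable_locally => //; exact: openT.
have := FTC1Ny intNy lphi; apply: filterS; first exact: (ae_filter_ringOfSetsType mu).
move=> x /= [dP dPx] /andP[ax xb].
pose P (x : R) : R := (\int[mu]_(t in [set` `]-oo, x]]) (phi t))%R.
have PF y : a < y -> y <= b -> F y = P y + (F a - P a).
  move=> ay yb; have := phiE a y (lexx a) (ltW ay) yb.
  have := @Rintegral_itvB _ phi -oo%O (BRight y) a (intNy y) isT (ltW ay).
  rewrite -/(P y) -/(P a) [X in _ = X -> _]/Rintegral => + I; rewrite I /= => PE.
  lra.
have near_eq : {near x, P + cst (F a - P a) =1 F}.
  near=> y; rewrite (PF y)//.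
  - by near: y; exact: lt_nbhsr.
  - by apply: ltW; near: y; exact: lt_nbhsl.
apply: (@near_eq_is_derive _ _ _ (P + cst (F a - P a))) => //.
rewrite -[phi x]addr0; apply: is_deriveD.
by rewrite -dPx derive1E; exact: derivableP.
Unshelve. all: by end_near. Qed.

End abs_cont_density.

(** * Vectors and directional derivatives *)

Lemma continuous_of_dist {R : realType} {E F : normedModType R} (f : E -> F) z :
  (forall e, 0 < e -> exists2 d, 0 < d & forall y, `|y| < d -> `|f (z + y) - f z| <= e) ->
  {for z, continuous f}.
Proof.
move=> H; apply/cvgrPdist_le => e e0; have [d d0 Hd] := H _ e0.
apply/nbhs_ballP; exists d => // y; rewrite -ball_normE/= => zy.
by rewrite distrC -[y in f y](subrKC z) Hd// distrC.
Qed.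

Section vectors.
Context {R : realType} {n : nat}.
Implicit Types (u w x y r : 'rV[R]_n).

Lemma coord_le_norm u i : `|u 0 i| <= `|u|.
Proof.
rewrite {2}/Num.Def.normr /= mx_normrE.
by apply: (le_bigmax _ (fun ij : 'I_1 * 'I_n => `|u ij.1 ij.2|) (0, i)).
Qed.

Lemma norm_le_coord u (C : R) : 0 <= C -> (forall i, `|u 0 i| <= C) -> `|u| <= C.
Proof.
move=> C0 uC; rewrite /Num.Def.normr /= mx_normrE; apply: bigmax_le => // -[j i] _.
by rewrite /= ord1.
Qed.

Lemma dotvC u w : dotv u w = dotv w u.
Proof. by apply: eq_bigr => i _; rewrite mulrC. Qed.

Lemma dotvDl u u' w : dotv (u + u') w = dotv u w + dotv u' w.
Proof. by rewrite -big_split; apply: eq_bigr => i _; rewrite mxE mulrDl. Qed.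

Lemma dotvZl (a : R) u w : dotv (a *: u) w = a * dotv u w.
Proof. by rewrite mulr_sumr; apply: eq_bigr => i _; rewrite mxE mulrA. Qed.

Lemma dotvNl u w : dotv (- u) w = - dotv u w.
Proof. by rewrite -scaleN1r dotvZl mulN1r. Qed.

Lemma dotvDr u w w' : dotv u (w + w') = dotv u w + dotv u w'.
Proof. by rewrite dotvC dotvDl !(dotvC u). Qed.

Lemma dotvZr (a : R) u w : dotv u (a *: w) = a * dotv u w.
Proof. by rewrite dotvC dotvZl dotvC. Qed.

Lemma dotvNr u w : dotv u (- w) = - dotv u w.
Proof. by rewrite dotvC dotvNl dotvC. Qed.

Lemma dotv0 u : dotv u 0 = 0.
Proof. by rewrite -(scale0r 0) dotvZr mul0r. Qed.

Lemma dotvBl u u' w : dotv (u - u') w = dotv u w - dotv u' w.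
Proof. by rewrite dotvDl dotvNl. Qed.

Lemma dotvBr u w w' : dotv u (w - w') = dotv u w - dotv u w'.
Proof. by rewrite dotvDr dotvNr. Qed.

Lemma dotv_evec u i : dotv u (evec i) = u 0 i.
Proof.
rewrite /dotv (bigD1 i)//= mxE !eqxx mulr1 big1 ?addr0// => j /negbTE ji.
by rewrite mxE ji andbF mulr0.
Qed.

Lemma norm_evec i : `|evec i : 'rV[R]_n| <= 1.
Proof. by apply: norm_le_coord => // j; rewrite mxE; case: (_ && _); rewrite ?normr0 ?normr1. Qed.

Lemma dotv_le u w : `|dotv u w| <= n%:R * `|u| * `|w|.
Proof.
apply: le_trans (ler_norm_sum _ _ _) _.
apply: (@le_trans _ _ (\sum_(i < n) `|u| * `|w|)).
  by apply: ler_sum => i _; rewrite normrM ler_pM// coord_le_norm.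
by rewrite sumr_const card_ord -[leRHS]mulrA mulr_natl.
Qed.

Lemma dotv_ub u w : dotv u w <= n%:R * `|u| * `|w|.
Proof. exact: le_trans (ler_norm _) (dotv_le u w). Qed.

Lemma dotv_ub_of u w (B C : R) : `|u| <= B -> `|w| <= C -> dotv u w <= n%:R * B * C.
Proof.
move=> uB wC; apply: le_trans (dotv_ub _ _) _.
by apply: ler_pM; rewrite ?mulr_ge0//; apply: ler_wpM2l.
Qed.

Lemma dotv_dist u u' w (B : R) : `|u - u'| <= B ->
  `|dotv u w - dotv u' w| <= n%:R * B * `|w|.
Proof.
move=> uB; rewrite -dotvBl; apply: le_trans (dotv_le _ _) _.
by apply: ler_wpM2r => //; apply: ler_wpM2l.
Qed.

(* Duality between the sup norm and the test vectors [rho *: evec i], [- rho *: evec i]. *)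
Lemma norm_le_dotv u (rho C : R) : 0 < rho -> 0 <= C ->
  (forall w, `|w| <= rho -> dotv u w <= C * rho) -> `|u| <= C.
Proof.
move=> r0 C0 H; apply: norm_le_coord => // i.
have nr w : `|w| <= 1 -> `|rho *: w| <= rho.
  by move=> w1; rewrite normrZ gtr0_norm// ler_piMr// ltW.
have h1 := H _ (nr _ (norm_evec i)).
have h2 : `|rho *: - evec i : 'rV[R]_n| <= rho by apply: nr; rewrite normrN norm_evec.
have {}h2 := H _ h2.
move: h1 h2; rewrite !dotvZr dotvNr dotv_evec mulrC ler_pM2r// => h1.
by rewrite mulrC ler_pM2r// => h2; rewrite ler_norml h1 andbT lerNl.
Qed.

Lemma dotv_ge0 u : 0 <= dotv u u.
Proof. by apply: sumr_ge0 => i _; rewrite -expr2 sqr_ge0. Qed.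

Lemma norm_sqr_le_dotv u : `|u| ^+ 2 <= dotv u u.
Proof.
have H i : u 0 i ^+ 2 <= dotv u u.
  rewrite /dotv (bigD1 i)//= -expr2 lerDl; apply: sumr_ge0 => j _.
  by rewrite -expr2 sqr_ge0.
rewrite -[leRHS]sqr_sqrtr ?dotv_ge0//; apply: lerXn2r; rewrite ?nnegrE ?sqrtr_ge0//.
apply: norm_le_coord => [|i]; first exact: sqrtr_ge0.
by rewrite -sqrtr_sqr ler_wsqrtr.
Qed.

Lemma dotv_self_le u : dotv u u <= n%:R * `|u| ^+ 2.
Proof. by apply: le_trans (dotv_ub _ _) _; rewrite expr2 mulrA. Qed.

Fact dotv_is_linear r : linear (dotv r : 'rV[R]_n -> R).
Proof. by move=> a u w; rewrite dotvDr dotvZr. Qed.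

HB.instance Definition _ r := GRing.isLinear.Build R 'rV[R]_n R _ (dotv r)
  (dotv_is_linear r).

Lemma dotv_continuous r : continuous (dotv r).
Proof.
move=> x; apply: continuous_of_dist => e e0.
have K0 : 0 < n%:R * `|r| + 1 by rewrite ltr_wpDl// mulr_ge0.
exists (e / (n%:R * `|r| + 1)); first by rewrite divr_gt0.
move=> y yd; rewrite dotvDr addrAC subrr add0r; apply: le_trans (dotv_le _ _) _.
apply: (@le_trans _ _ ((n%:R * `|r| + 1) * `|y|)); first by rewrite ler_wpM2r// lerDl.
by rewrite mulrC -ler_pdivlMr// ltW.
Qed.

Lemma differentiable_of_approx (f : 'rV[R]_n -> R) z r :
  (forall e, 0 < e -> exists2 d, 0 < d & forall w, `|w| < d ->
     `|f (z + w) - f z - dotv r w| <= e * `|w|) ->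
  differentiable f z /\ grad f z = r.
Proof.
move=> H.
have E : f \o shift z = (cst (f z) + dotv r)%R +o_ (0 : 'rV[R]_n) id.
  apply/eqaddoP => e e0; have [d d0 {}H] := H e e0.
  near=> w; rewrite /= !fctE opprD addrA [w + z]addrC; apply: H.
  near: w; apply/nbhs_ballP; exists d => //= w.
  by rewrite -ball_normE /= sub0r normrN.
have dE := diff_unique (@dotv_continuous r) E.
have fd : differentiable f z.
  by apply/diff_locallyP; rewrite dE; split => //; exact: dotv_continuous.
split => //; apply/rowP => i; rewrite mxE deriveE// dE; exact: dotv_evec.
Unshelve. all: by end_near. Qed.

Lemma differentiable_of_quad (f : 'rV[R]_n -> R) z r (C : R) :
  (forall w, `|w| <= 1 -> `|f (z + w) - f z - dotv r w| <= C * `|w| ^+ 2) ->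
  differentiable f z /\ grad f z = r.
Proof.
move=> H; apply: differentiable_of_approx => e e0.
have C1 : 0 < `|C| + 1 by rewrite ltr_wpDl.
exists (Num.min 1 (e / (`|C| + 1))); first by rewrite lt_min ltr01 divr_gt0.
move=> w; rewrite lt_min => /andP[w1 we]; apply: le_trans (H _ (ltW w1)) _.
rewrite expr2 mulrA ler_wpM2r//; apply: (@le_trans _ _ ((`|C| + 1) * `|w|)).
  by rewrite ler_wpM2r// (le_trans (ler_norm C))// lerDl.
by rewrite mulrC -ler_pdivlMr// ltW.
Qed.

End vectors.

Section directional.
Context {R : realType} {E : normedModType R}.
Implicit Types (f : E -> R) (z u : E).

Lemma is_derive_line f z u (t : R) : derivable f (z + t *: u) u ->
  is_derive t 1 (fun s : R => f (z + s *: u)) ('D_u f (z + t *: u)).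
Proof.
have E1 : (fun h : R => h^-1 *: (((fun s : R => f (z + s *: u)) \o shift t) (h *: (1 : R)) -
    f (z + t *: u))) =
  (fun h : R => h^-1 *: ((f \o shift (z + t *: u)) (h *: u) - f (z + t *: u))).
  apply/funext => h /=; congr (_ *: (f _ - _)).
  by rewrite [h *: 1]mulr1 scalerDl addrCA addrA.
move=> fd; apply: DeriveDef.
  by rewrite /derivable E1.
by rewrite /derive E1.
Qed.

Lemma directional_MVT f z u (h : R) : (forall z', derivable f z' u) ->
  exists2 c : R, `|c| <= `|h| & f (z + h *: u) - f z = h * 'D_u f (z + c *: u).
Proof.
move=> fd; pose g s := f (z + s *: u).
have gd (s : R) : is_derive s (1 : R) g ('D_u f (z + s *: u)) by apply: is_derive_line.
have gc a b : {within `[a, b], continuous g}.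
  by apply: derivable_within_continuous => s _; have [] := gd s.
have g0 : g 0 = f z by rewrite /g scale0r addr0.
have [h0|h0] := leP 0 h.
  have [c] := @MVT_segment _ g _ 0 h h0 (fun s _ => gd s) (gc _ _).
  rewrite in_itv/= => /andP[c0 ch] gE; exists c; first by rewrite !ger0_norm.
  by rewrite -g0 -/(g h) gE subr0 mulrC.
have [c] := @MVT_segment _ g _ h 0 (ltW h0) (fun s _ => gd s) (gc _ _).
rewrite in_itv/= => /andP[c0 ch] gE; exists c.
  by rewrite (ltr0_norm h0) ler0_norm// lerN2.
by rewrite -g0 -/(g h) -opprB gE sub0r mulrC mulNr opprK.
Qed.

Lemma continuous_dist_lt f z e : {for z, continuous f} -> 0 < e ->
  exists2 d, 0 < d & forall y, `|y| < d -> `|f (z + y) - f z| < e.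
Proof.
move=> fz e0; have /cvgrPdist_lt/(_ e e0)/nbhs_ballP[d /= d0 H] := fz.
exists d => // y yd; rewrite distrC; apply: H; rewrite -ball_normE/=.
by rewrite opprD addrA subrr sub0r normrN.
Qed.

(** [C1] only provides directional derivatives, so their linearity in the direction has to be
    proved: the increment is split into a step along [u'] and a step along [u], each handled by the
    mean value theorem and continuity of the derivative in that direction. *)
Lemma C1_derive_lin f z u u' (a b : R) : C1 f ->
  is_derive z (a *: u + b *: u') f (a * 'D_u f z + b * 'D_u' f z).
Proof.
move=> fC; have [du cu] := fC u; have [du' cu'] := fC u'.
suff L : h^-1 *: (f (h *: (a *: u + b *: u') + z) - f z) @[h --> (0 : R)^'] -->
    a * 'D_u f z + b * 'D_u' f z.
  by apply: DeriveDef; [apply/cvg_ex; eexists; exact: L|exact: (cvg_lim _ L)].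
apply/cvgrPdist_le => e e0.
pose K : R := `|a| + `|b| + 1.
have K0 : 0 < K by rewrite /K ltr_wpDl// addr_ge0.
have eK : 0 < e / K by rewrite divr_gt0.
have [d d0 Hd] := continuous_dist_lt (cu z) eK.
have [d' d'0 Hd'] := continuous_dist_lt (cu' z) eK.
(* [|h| * U] dominates the distance from [z] to both mean value points. *)
pose U : R := 2 * K * (`|u| + `|u'| + 1).
have U0 : 0 < U by rewrite /U mulr_gt0// ?mulr_gt0// ltr_wpDl// addr_ge0.
near=> h.
have h0 : h != 0 by near: h; exact: nbhs_dnbhs_neq.
have hU : `|h| * U < Num.min d d'.
  rewrite -ltr_pdivlMr//; near: h; apply: dnbhs0_lt.
  by rewrite divr_gt0// lt_min d0.
have [c cb Ec] := directional_MVT (z + (h * b) *: u') (h * a) du.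
have [c' c'b Ec'] := directional_MVT z (h * b) du'.
have -> : h^-1 *: (f (h *: (a *: u + b *: u') + z) - f z) =
   a * 'D_u f (z + (h * b) *: u' + c *: u) + b * 'D_u' f (z + c' *: u').
  have -> : h *: (a *: u + b *: u') + z = z + (h * b) *: u' + (h * a) *: u.
    by rewrite scalerDr !scalerA -addrA addrC; congr (_ + _); exact: addrC.
  rewrite -[f (_ + _) - f z](subrKA (f (z + (h * b) *: u'))) Ec Ec'.
  by rewrite [LHS]mulrDr -!mulrA !mulKf.
have hb : `|h * b| <= `|h| * K by rewrite normrM ler_wpM2l// /K; have := normr_ge0 a; lra.
have ha : `|h * a| <= `|h| * K by rewrite normrM ler_wpM2l// /K; have := normr_ge0 b; lra.
move: hU; rewrite lt_min => /andP[hd hd'].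
have S1 : `|(h * b) *: u' + c *: u| < d.
  apply: le_lt_trans hd; apply: le_trans (ler_normD _ _) _.
  rewrite [X in X + _]normrZ [X in _ + X]normrZ.
  apply: (@le_trans _ _ (`|h| * K * `|u'| + `|h| * K * `|u|)).
    by have cbK := le_trans cb ha; apply: lerD; apply: ler_wpM2r.
  have -> : `|h| * U = `|h| * K * `|u'| + `|h| * K * `|u| + `|h| * K * (`|u| + `|u'| + 2).
    by rewrite /U; ring.
  by rewrite lerDl !mulr_ge0// ?(ltW K0)// !addr_ge0.
have S2 : `|c' *: u'| < d'.
  apply: le_lt_trans hd'; rewrite normrZ.
  apply: (@le_trans _ _ (`|h| * K * `|u'|)); first by rewrite ler_wpM2r// (le_trans c'b).
  have -> : `|h| * U = `|h| * K * `|u'| + `|h| * K * (2 * `|u| + `|u'| + 2).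
    by rewrite /U; ring.
  by rewrite lerDl !mulr_ge0// ?(ltW K0)// !addr_ge0// mulr_ge0.
have {}S1 := Hd _ S1; have {}S2 := Hd' _ S2; rewrite addrA in S1.
set A := 'D_u f (_ + _ + _) in S1 *; set B := 'D_u' f (_ + _) in S2 *.
rewrite (_ : _ - _ = a * ('D_u f z - A) + b * ('D_u' f z - B)); last by ring.
apply: le_trans (ler_normD _ _) _; rewrite !normrM.
apply: (@le_trans _ _ (`|a| * (e / K) + `|b| * (e / K))).
  by apply: lerD; rewrite ler_wpM2l// distrC ltW.
rewrite -mulrDl mulrA ler_pdivrMr// mulrC ler_wpM2l// ?(ltW e0)// /K lerDl//.
Unshelve. all: by end_near. Qed.

Lemma C1_deriveD f z u u' : C1 f -> 'D_(u + u') f z = 'D_u f z + 'D_u' f z.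
Proof.
by move=> fC; have [_] := C1_derive_lin z u u' 1 1 fC; rewrite !scale1r !mul1r.
Qed.

Lemma C1_deriveZ f z u a : C1 f -> 'D_(a *: u) f z = a * 'D_u f z.
Proof.
by move=> fC; have [_] := C1_derive_lin z u u a 0 fC; rewrite scale0r addr0 mul0r addr0.
Qed.

Lemma C1_derive_sum f z (I : Type) (s : seq I) (a : I -> R) (u : I -> E) : C1 f ->
  'D_(\sum_(i <- s) a i *: u i) f z = \sum_(i <- s) a i * 'D_(u i) f z.
Proof.
move=> fC; elim: s => [|i s IH]; last by rewrite !big_cons C1_deriveD// C1_deriveZ// IH.
by rewrite !big_nil -(scale0r 0) C1_deriveZ// mul0r.
Qed.

(* One-sided second-order Taylor bound, avoiding the explicit remainder. *)
Lemma C2_taylor_lb f z u m : C2 f ->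
  (forall t : R, 0 <= t <= 1 -> m <= 'D_u ('D_u f) (z + t *: u)) ->
  f z + 'D_u f z + m / 2 <= f (z + u).
Proof.
move=> [fC fCC] Hm; have [du _] := fC u; have [ddu _] := fCC u u.
pose g (t : R) := f (z + t *: u) - t * 'D_u f z - m / 2 * t ^+ 2.
have gd (t : R) : is_derive t (1 : R) g ('D_u f (z + t *: u) - 'D_u f z - m * t).
  have h := is_derive_line (du (z + t *: u)).
  have h2 : is_derive t (1 : R) (fun s : R => s * 'D_u f z) ('D_u f z).
    have := is_deriveM (is_derive_id t (1 : R)) (is_derive_cst ('D_u f z) t (1 : R)).
    by move=> hh; apply: (is_derive_eq hh); rewrite scaler0 add0r [LHS]mulr1.
  have h3 : is_derive t (1 : R) (fun s : R => m / 2 * s ^+ 2) (m * t).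
    have := is_deriveM (is_derive_cst (m / 2) t (1 : R))
      (is_deriveM (is_derive_id t (1 : R)) (is_derive_id t (1 : R))).
    by move=> hh; apply: (is_derive_eq hh); rewrite scaler0 addr0 /GRing.scale /=; field.
  exact: (is_deriveB (is_deriveB h h2) h3).
have g0 : g 0 = f z by rewrite /g scale0r addr0 mul0r subr0 expr0n mulr0 subr0.
have g1 : g 1 = f (z + u) - 'D_u f z - m / 2 by rewrite /g scale1r mul1r expr1n mulr1.
have gc : {within `[0 : R, 1], continuous g}.
  by apply: derivable_within_continuous => s _; have [] := gd s.
have [t] := @MVT_segment _ g _ 0 1 ler01 (fun s _ => gd s) gc.
rewrite in_itv/= subr0 mulr1 => /andP[t0 t1] gE.
have dd (s : R) : is_derive s (1 : R) (fun s : R => 'D_u f (z + s *: u)) ('D_u ('D_u f) (z + s *: u)).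
  by apply: is_derive_line.
have dc : {within `[0 : R, t], continuous (fun s : R => 'D_u f (z + s *: u))}.
  by apply: derivable_within_continuous => s _; have [] := dd s.
have [c] := @MVT_segment _ _ _ 0 t t0 (fun s _ => dd s) dc.
rewrite in_itv/= subr0 => /andP[c0 ct].
rewrite scale0r addr0 => Ec.
have mc : m * t <= 'D_u ('D_u f) (z + c *: u) * t.
  by rewrite ler_wpM2r// Hm// c0 (le_trans ct).
move: gE mc; rewrite -Ec g0 g1; lra.
Qed.

End directional.

(** * Periodic functions: extrema and Lipschitz bounds by compactness *)

Section periodic.
Context {R : realType} {n : nat}.
Implicit Types (x p w m : 'rV[R]_n).

Lemma int_shift x : exists2 k : 'rV[R]_n, is_int_vec k & `|x + k| <= 1.
Proof.
exists (\row_i - (Num.floor (x 0 i))%:~R).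
  by move=> i; rewrite mxE rpredN intr_int.
apply: norm_le_coord => // i; rewrite !mxE.
by have := floor_itv (x 0 i); rewrite intrD ler_norml => /andP[]; lra.
Qed.

Lemma closed_norm_le (P : R) : closed [set p : 'rV[R]_n | `|p| <= P].
Proof.
rewrite (_ : [set p | _] = (fun p : 'rV[R]_n => `|p|) @^-1` [set y | y <= P])//.
apply: closed_comp => [p _|]; [exact: norm_continuous|exact: closed_le].
Qed.

Lemma compact_norm_le (P : R) : compact [set p : 'rV[R]_n | `|p| <= P].
Proof.
apply: bounded_closed_compact; last exact: closed_norm_le.
by exists P; split; [exact: num_real|move=> M PM p /= pP; exact: le_trans pP (ltW PM)].
Qed.

Lemma compact_norm_eq1 : compact [set p : 'rV[R]_n | `|p| = 1].
Proof.
apply: bounded_closed_compact.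
  by exists 1; split; [exact: num_real|move=> M PM p /= ->; exact: ltW].
rewrite (_ : [set p | _] = (fun p : 'rV[R]_n => `|p|) @^-1` [set 1])//.
by apply: closed_comp => [p _|]; [exact: norm_continuous|exact: closed_eq].
Qed.

Definition periodic1 {T T' : Type} (f : 'rV[R]_n * T -> T') :=
  forall x k t, is_int_vec k -> f (x + k, t) = f (x, t).

(** An integer translation brings the first variable into the unit ball, so compactness in the
    second variable is enough. *)
Lemma periodic_min (T : topologicalType) (K : set T) (f : 'rV[R]_n * T -> R) :
  compact K -> K !=set0 -> (forall x t, {for (x, t), continuous f}) ->
  periodic1 f -> exists x0 t0, K t0 /\ forall x t, K t -> f (x0, t0) <= f (x, t).
Proof.
move=> cK [t1 Kt1] fc fper.
have cA := compact_setX (@compact_norm_le 1) cK.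
have A0 : [set p : 'rV[R]_n | `|p| <= 1] `*` K !=set0.
  by exists (0, t1); split => //=; rewrite normr0.
have fc' : {within [set p : 'rV[R]_n | `|p| <= 1] `*` K, continuous f}.
  by apply: continuous_in_subspaceT => -[x t] _; exact: fc.
have [[x0 t0] /set_mem[_ Kt0] Hmin] := compact_EVT_min A0 cA fc'.
exists x0, t0; split => // x t Kt; have [k kint xk] := int_shift x.
by rewrite -(fper x k t kint); apply: Hmin; exact/mem_set.
Qed.

Lemma pair_sum (U V : zmodType) (I : Type) (s : seq I) (f : I -> U) (g : I -> V) :
  \sum_(i <- s) (f i, g i) = (\sum_(i <- s) f i, \sum_(i <- s) g i).
Proof.
elim: s => [|i s IH]; first by rewrite !big_nil.
by rewrite !big_cons IH.
Qed.

Lemma pair_evec1 w : (w, 0 : 'rV[R]_n) = \sum_i w 0 i *: (evec i : 'rV[R]_n, 0 : 'rV[R]_n).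
Proof.
rewrite pair_sum -row_sum_delta; congr pair.
by rewrite big1// => i _; rewrite scaler0.
Qed.

Lemma pair_evec2 w : (0 : 'rV[R]_n, w) = \sum_i w 0 i *: (0 : 'rV[R]_n, evec i : 'rV[R]_n).
Proof.
rewrite pair_sum -row_sum_delta; congr pair.
by rewrite big1// => i _; rewrite scaler0.
Qed.

Lemma C1_derive_pair (f : 'rV[R]_n * 'rV[R]_n -> R) z w m : C1 f ->
  'D_(w, m) f z = \sum_i w 0 i * 'D_(evec i, 0) f z + \sum_i m 0 i * 'D_(0, evec i) f z.
Proof.
move=> fC; have -> : (w, m) = (w, 0) + (0, m) by rewrite -[LHS]/(_, _) -[RHS]/(w + 0, 0 + m) addr0 add0r.
by rewrite C1_deriveD// {1}pair_evec1 C1_derive_sum// pair_evec2 C1_derive_sum.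
Qed.

Lemma periodic_derive (f : 'rV[R]_n * 'rV[R]_n -> R) u : periodic1 f ->
  periodic1 ('D_u f).
Proof.
move=> fper x k p kint.
suff E : (fun h : R => h^-1 *: ((f \o shift (x + k, p)) (h *: u) - f (x + k, p))) =
         (fun h : R => h^-1 *: ((f \o shift (x, p)) (h *: u) - f (x, p))).
  by rewrite /derive E.
have E (h : R) : (f \o shift (x + k, p)) (h *: u) = (f \o shift (x, p)) (h *: u).
  by case: u => w m; rewrite -[LHS]/(f (h *: w + (x + k), h *: m + p)) addrA fper.
by apply/funext => h; rewrite fper// E.
Qed.

Lemma finite_bound (I : finType) (T : Type) (S : set T) (f : I -> T -> R) :
  (forall i, exists C, forall t, S t -> `|f i t| <= C) ->
  exists2 C, 0 <= C & forall i t, S t -> `|f i t| <= C.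
Proof.
move=> /choice[C HC]; exists (\sum_i `|C i|); first exact: sumr_ge0.
move=> i t St; apply: le_trans (HC i t St) _; apply: le_trans (ler_norm _) _.
by rewrite (bigD1 i)//= lerDl sumr_ge0.
Qed.

Lemma periodic_bounded (f : 'rV[R]_n * 'rV[R]_n -> R) (P : R) :
  continuous f -> periodic1 f ->
  exists C, forall z, `|z.2| <= P -> `|f z| <= C.
Proof.
move=> fc fper; have [P0|P0] := ltP P 0.
  by exists 0 => z zP; have := normr_ge0 z.2; lra.
have K0 : [set p : 'rV[R]_n | `|p| <= P] !=set0 by exists 0 => /=; rewrite normr0.
have [||x0 [t0 [_ H0]]] := periodic_min (f := fun z => - `|f z|) (@compact_norm_le P) K0.
- move=> x t; apply: continuousN; apply: continuous_comp; first exact: fc.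
  exact: norm_continuous.
- by move=> x k t kint; rewrite fper.
by exists `|f (x0, t0)| => -[x t] /= tP; have := H0 x t tP; rewrite lerN2.
Qed.

(** Mean value theorem on the segment joining the two points: its second component stays in the ball
    of radius [P], where periodicity bounds all the partial derivatives. *)
Lemma periodic_lipschitz (f : 'rV[R]_n * 'rV[R]_n -> R) (P : R) :
  C1 f -> periodic1 f ->
  exists2 C, 0 <= C & forall x p x' p', `|p| <= P -> `|p'| <= P ->
    `|f (x', p') - f (x, p)| <= C * (`|x' - x| + `|p' - p|).
Proof.
move=> fC fper.
have [|C1 C10 H1] := @finite_bound 'I_n _ [set z | `|z.2| <= P] (fun i => 'D_(evec i, 0) f).
  by move=> i; apply: periodic_bounded; [case: (fC (evec i, 0))|exact: periodic_derive].
have [|C2 C20 H2] := @finite_bound 'I_n _ [set z | `|z.2| <= P] (fun i => 'D_(0, evec i) f).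
  by move=> i; apply: periodic_bounded; [case: (fC (0, evec i))|exact: periodic_derive].
exists (n%:R * (C1 + C2)); first by rewrite mulr_ge0// addr_ge0.
move=> x p x' p' pP p'P.
have [d _] := fC (x' - x, p' - p).
have gd (s : R) : is_derive s (1 : R) (fun s : R => f ((x, p) + s *: (x' - x, p' - p)))
   ('D_(x' - x, p' - p) f ((x, p) + s *: (x' - x, p' - p))).
  exact: is_derive_line.
have gc : {within `[0 : R, 1], continuous (fun s : R => f ((x, p) + s *: (x' - x, p' - p)))}.
  by apply: derivable_within_continuous => s _; have [] := gd s.
have [t] := @MVT_segment _ _ _ 0 1 ler01 (fun s _ => gd s) gc.
rewrite in_itv/= subr0 mulr1 scale1r scale0r addr0 => /andP[t0 t1].
have -> : (x, p) + (x' - x, p' - p) = (x', p').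
  by rewrite /GRing.add/=; congr pair; rewrite addrC subrK.
move=> ->; rewrite C1_derive_pair//.
set z := (x, p) + _.
have zP : `|z.2| <= P.
  have -> : z.2 = (1 - t) *: p + t *: p'.
    by rewrite /z /= scalerBr scalerBl scale1r [RHS]addrAC addrA.
  apply: le_trans (ler_normD _ _) _; rewrite !normrZ (ger0_norm t0) ger0_norm ?subr_ge0//.
  apply: (@le_trans _ _ ((1 - t) * P + t * P)); last by rewrite -mulrDl subrK mul1r.
  by apply: lerD; apply: ler_wpM2l; rewrite ?subr_ge0.
have bnd (C : R) (w : 'rV[R]_n) (g : 'I_n -> R) : (forall i, `|g i| <= C) ->
    `|\sum_i w 0 i * g i| <= n%:R * C * `|w|.
  move=> gC; apply: le_trans (ler_norm_sum _ _ _) _.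
  apply: (@le_trans _ _ (\sum_(i < n) `|w| * C)).
    by apply: ler_sum => i _; rewrite normrM ler_pM// coord_le_norm.
  by rewrite sumr_const card_ord -[_ *+ n]mulr_natl -mulrA [C * _]mulrC.
apply: le_trans (ler_normD _ _) _.
apply: le_trans (lerD (bnd C1 _ _ _) (bnd C2 _ _ _)) _; [by move=> i; exact: H1|by move=> i; exact: H2|].
have := mulr_ge0 (mulr_ge0 (ler0n R n) C20) (normr_ge0 (x' - x)).
have := mulr_ge0 (mulr_ge0 (ler0n R n) C10) (normr_ge0 (p' - p)).
lra.
Qed.

Lemma periodic_C1_bounded (f : 'rV[R]_n * 'rV[R]_n -> R) (P : R) :
  C1 f -> periodic1 f -> 0 <= P ->
  exists2 C, 0 <= C & forall x p, `|p| <= P -> `|f (x, p)| <= C.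
Proof.
move=> fC fper P0; have [C C0 H] := periodic_lipschitz P fC fper.
exists (`|f (0, 0)| + C * (1 + P)); first by rewrite addr_ge0// mulr_ge0// addr_ge0.
move=> x p pP; have [k kint xk] := int_shift x; rewrite -(fper x k p kint).
have := H 0 0 (x + k) p; rewrite normr0 !subr0 => /(_ P0 pP) h.
have := ler_normD (f (0, 0)) (f (x + k, p) - f (0, 0)); rewrite addrC subrK => /le_trans; apply.
by rewrite lerD2l; apply: le_trans h _; apply: ler_wpM2l => //; apply: lerD.
Qed.

End periodic.

(** * Estimates on the Hamiltonian and the Lagrangian *)

(** Defined through the joint function, as in the hypotheses on [H], whereas [Hp] differentiates a
    section of [H]; [Hp_coord] reconciles the two. *)
Definition Hx {R : realType} {n : nat} (H : 'rV[R]_n -> 'rV[R]_n -> R)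
  (x p : 'rV[R]_n) : 'rV[R]_n := \row_i 'D_(evec i, 0) (uncurryH H) (x, p).

Lemma coordB {R : realType} {n : nat} (u w : 'rV[R]_n) i : (u - w) 0 i = u 0 i - w 0 i.
Proof. by rewrite !mxE. Qed.

Lemma continuous_sum_for {R : realType} {T : topologicalType} (I : Type) (s : seq I)
    (f : I -> T -> R) z : (forall i, {for z, continuous (f i)}) ->
  {for z, continuous (fun x => \sum_(i <- s) f i x)}.
Proof.
move=> fc; elim: s => [|i s IH].
  have -> : (fun x => \sum_(i <- [::]) f i x) = cst 0 by apply/funext => x; rewrite big_nil.
  exact: cst_continuous.
have -> : (fun x => \sum_(i <- i :: s) f i x) = f i \+ (fun x => \sum_(i <- s) f i x).
  by apply/funext => x; rewrite big_cons.
exact: (cvgD (fc i) IH).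
Qed.

Section hamiltonian.
Context {R : realType} {n : nat} (H : 'rV[R]_n -> 'rV[R]_n -> R).
Hypothesis HH : Hamiltonian_hyp H.
Implicit Types (x p w m xi eta : 'rV[R]_n).
Notation Hu := (uncurryH H).
Notation Hx := (Hx H).
Notation Hp := (Hp H).
Notation Lag := (Lag H).

Lemma ham_C2 : C2 Hu. Proof. by have [_ []] := HH. Qed.

Lemma ham_C1 : C1 Hu. Proof. by have [] := ham_C2. Qed.

Lemma ham_dC1 u : C1 ('D_u Hu). Proof. by have [_] := ham_C2. Qed.

Lemma ham_periodic x k p : is_int_vec k -> H (x + k) p = H x p.
Proof. by have [] := HH => + _; apply. Qed.

Lemma ham_periodic1 : periodic1 Hu.
Proof. by move=> x k p kint; exact: ham_periodic. Qed.

Lemma Hp_coord x p i : Hp x p 0 i = 'D_(0, evec i) Hu (x, p).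
Proof.
have E (h : R) : (H x \o shift p) (h *: evec i) = (Hu \o shift (x, p)) (h *: (0, evec i)).
  by rewrite -[RHS]/(H (h *: 0 + x) (h *: evec i + p)) scaler0 add0r.
rewrite mxE /derive; suff -> : (fun h : R => h^-1 *: ((H x \o shift p) (h *: evec i) - H x p)) =
  (fun h : R => h^-1 *: ((Hu \o shift (x, p)) (h *: (0, evec i)) - Hu (x, p))) by [].
by apply/funext => h; rewrite E.
Qed.

Lemma Hx_periodic x k p : is_int_vec k -> Hx (x + k) p = Hx x p.
Proof.
by move=> kint; apply/rowP => i; rewrite !mxE (periodic_derive _ ham_periodic1).
Qed.

Lemma Hp_periodic x k p : is_int_vec k -> Hp (x + k) p = Hp x p.
Proof.
by move=> kint; apply/rowP => i; rewrite !Hp_coord (periodic_derive _ ham_periodic1).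
Qed.

Lemma ham_derive x p w m :
  'D_(w, m) Hu (x, p) = dotv (Hx x p) w + dotv (Hp x p) m.
Proof.
rewrite C1_derive_pair; last exact: ham_C1.
congr (_ + _); apply: eq_bigr => i _; rewrite mulrC; congr (_ * _).
  by rewrite mxE.
by rewrite Hp_coord.
Qed.

Lemma ham_bounds P : 0 <= P -> exists2 K, 0 <= K & forall x p, `|p| <= P ->
  [/\ `|H x p| <= K, `|Hx x p| <= K & `|Hp x p| <= K].
Proof.
move=> P0.
have [K0 K00 h0] := periodic_C1_bounded ham_C1 ham_periodic1 P0.
have [|K1 K10 h1] := @finite_bound R 'I_n _ [set z | `|z.2| <= P] (fun i => 'D_(evec i, 0) Hu).
  move=> i; have [C C0 hC] := periodic_C1_bounded (ham_dC1 (evec i, 0))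
    (periodic_derive (evec i, 0) ham_periodic1) P0.
  by exists C => -[x p]; exact: hC.
have [|K2 K20 h2] := @finite_bound R 'I_n _ [set z | `|z.2| <= P] (fun i => 'D_(0, evec i) Hu).
  move=> i; have [C C0 hC] := periodic_C1_bounded (ham_dC1 (0, evec i))
    (periodic_derive (0, evec i) ham_periodic1) P0.
  by exists C => -[x p]; exact: hC.
exists (K0 + K1 + K2); first by rewrite !addr_ge0.
move=> x p pP; split.
- by apply: le_trans (h0 _ _ pP) _; lra.
- apply: norm_le_coord => [|i]; first by rewrite !addr_ge0.
  by rewrite mxE; apply: le_trans (h1 i (x, p) pP) _; lra.
- apply: norm_le_coord => [|i]; first by rewrite !addr_ge0.
  by rewrite Hp_coord; apply: le_trans (h2 i (x, p) pP) _; lra.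
Qed.

Lemma ham_lipschitz P : exists2 K, 0 <= K & forall x p x' p', `|p| <= P -> `|p'| <= P ->
  [/\ `|H x' p' - H x p| <= K * (`|x' - x| + `|p' - p|),
      `|Hx x' p' - Hx x p| <= K * (`|x' - x| + `|p' - p|) &
      `|Hp x' p' - Hp x p| <= K * (`|x' - x| + `|p' - p|)].
Proof.
have [K0 K00 h0] := periodic_lipschitz P ham_C1 ham_periodic1.
have H1 (u : 'I_n -> 'rV[R]_n * 'rV[R]_n) : exists2 C, 0 <= C & forall i x p x' p',
    `|p| <= P -> `|p'| <= P ->
    `|'D_(u i) Hu (x', p') - 'D_(u i) Hu (x, p)| <= C * (`|x' - x| + `|p' - p|).
  have /choice[C HC] : forall i, exists C, 0 <= C /\ forall x p x' p',
    `|p| <= P -> `|p'| <= P ->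
    `|'D_(u i) Hu (x', p') - 'D_(u i) Hu (x, p)| <= C * (`|x' - x| + `|p' - p|).
    move=> i; have [C C0 hC] := periodic_lipschitz P (ham_dC1 (u i))
      (periodic_derive (u i) ham_periodic1).
    by exists C.
  have C0 i : 0 <= C i by have [] := HC i.
  exists (\sum_i C i) => [|i x p x' p' pP p'P]; first exact: sumr_ge0.
  have [_ hC] := HC i; apply: le_trans (hC _ _ _ _ pP p'P) _.
  by rewrite ler_wpM2r ?addr_ge0// (bigD1 i)//= lerDl sumr_ge0.
have [K1 K10 h1] := H1 (fun i => (evec i, 0)).
have [K2 K20 h2] := H1 (fun i => (0, evec i)).
exists (K0 + K1 + K2); first by rewrite !addr_ge0.
move=> x p x' p' pP p'P.
have D0 : 0 <= `|x' - x| + `|p' - p| by rewrite addr_ge0.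
have m0 := mulr_ge0 K00 D0; have m1 := mulr_ge0 K10 D0; have m2 := mulr_ge0 K20 D0.
split.
- by apply: le_trans (h0 _ _ _ _ pP p'P) _; lra.
- apply: norm_le_coord => [|i]; first by rewrite mulr_ge0// !addr_ge0.
  by rewrite !mxE; apply: le_trans (h1 i _ _ _ _ pP p'P) _; lra.
- apply: norm_le_coord => [|i]; first by rewrite mulr_ge0// !addr_ge0.
  by rewrite coordB !Hp_coord; apply: le_trans (h2 i _ _ _ _ pP p'P) _; lra.
Qed.

Lemma ham_derive2 x p m : 'D_(0, m) ('D_(0, m) Hu) (x, p) =
  \sum_i m 0 i * \sum_j m 0 j * 'D_(0, evec j) ('D_(0, evec i) Hu) (x, p).
Proof.
have -> : 'D_(0, m) Hu = \sum_i (m 0 i \*: 'D_(0, evec i) Hu).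
  apply/funext => z; rewrite (pair_evec2 m) C1_derive_sum; last exact: ham_C1.
  by rewrite fct_sumE.
have dd i : derivable ('D_(0, evec i) Hu) (x, p) (0, m).
  by have [] := ham_dC1 (0, evec i) (0, m).
rewrite derive_sum => [|i]; last exact: derivableZ.
apply: eq_bigr => i _; rewrite deriveZ//; congr (_ * _).
by rewrite (pair_evec2 m) C1_derive_sum//; exact: ham_dC1.
Qed.

(** By periodicity and compactness the positive second derivative in [p] has a positive minimum over
    base points in the ball and unit directions. Homogeneity of degree 2 extends the bound to every
    [m], and Taylor's formula integrates it. *)
Lemma ham_convex P : exists2 kappa, 0 < kappa & forall x p m, `|p| <= P -> `|p + m| <= P ->
  H x p + dotv (Hp x p) m + kappa * `|m| ^+ 2 <= H x (p + m).
Proof.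
pose q (z : 'rV[R]_n * ('rV[R]_n * 'rV[R]_n)) :=
  'D_(0, z.2.2) ('D_(0, z.2.2) Hu) (z.1, z.2.1).
pose K := [set p : 'rV[R]_n | `|p| <= P] `*` [set m : 'rV[R]_n | `|m| = 1].
have [k k0 Hk] : exists2 k, 0 < k & forall x t, K t -> k <= q (x, t).
  (* [K] is empty when [n = 0] or [P < 0], and any positive constant then works. *)
  have [KE|/set0P K0] := eqVneq K set0.
    by exists 1 => // x t; rewrite KE.
  have cK : compact K by apply: compact_setX; [exact: compact_norm_le|exact: compact_norm_eq1].
  have qc x t : {for (x, t), continuous q}.
    rewrite (_ : q = fun z => \sum_i z.2.2 0 i * \sum_j z.2.2 0 j *
       'D_(0, evec j) ('D_(0, evec i) Hu) (z.1, z.2.1)); last first.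
      by apply/funext => z; exact: ham_derive2.
    have cc i : {for (x, t), continuous (fun z : 'rV[R]_n * ('rV[R]_n * 'rV[R]_n) => z.2.2 0 i)}.
      apply: (@continuous_comp _ _ _ (fun z : 'rV[R]_n * ('rV[R]_n * 'rV[R]_n) => z.2.2)
         (fun m : 'rV[R]_n => m 0 i)); last exact: coord_continuous.
      by apply: (@continuous_comp _ _ _ snd snd); exact: cvg_snd.
    have cz : {for (x, t), continuous (fun z : 'rV[R]_n * ('rV[R]_n * 'rV[R]_n) => (z.1, z.2.1))}.
      apply: (@cvg_pair _ _ _ (nbhs (x, t)) (nbhs x) (nbhs t.1)); first exact: cvg_fst.
      apply: (@cvg_comp _ _ _ (fun z : 'rV[R]_n * ('rV[R]_n * 'rV[R]_n) => z.2) fst _ (nbhs t)).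
        exact: cvg_snd.
      by case: (t) => ? ?; exact: cvg_fst.
    apply: continuous_sum_for => i; apply: (cvgM (cc i)).
    apply: continuous_sum_for => j; apply: (cvgM (cc j)).
    apply: (@continuous_comp _ _ _ (fun z : 'rV[R]_n * ('rV[R]_n * 'rV[R]_n) => (z.1, z.2.1))
      ('D_(0, evec j) ('D_(0, evec i) Hu))); first exact: cz.
    by have [_] := ham_dC1 (0, evec i) (0, evec j); apply.
  have qper : periodic1 q.
    move=> x k t kint; rewrite /q /=; apply: periodic_derive => //.
    exact/periodic_derive/ham_periodic1.
  have [x0 [[p0 m0] [[_ /= m01] Hmin]]] := periodic_min cK K0 qc qper.
  exists (q (x0, (p0, m0))) => //; have [_ [_ [+ _]]] := HH; apply.
  by rewrite -normr_eq0 m01 oner_eq0.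
exists (k / 2); first by rewrite divr_gt0.
move=> x p m pP pmP.
have Hq t : 0 <= t <= 1 -> k * `|m| ^+ 2 <= 'D_(0, m) ('D_(0, m) Hu) ((x, p) + t *: (0, m)).
  move=> /andP[t0 t1].
  have -> : (x, p) + t *: (0, m) = (x, p + t *: m).
    by rewrite -[LHS]/(x + t *: 0, p + t *: m) scaler0 addr0.
  have [->|mn0] := eqVneq m 0.
    rewrite normr0 expr0n mulr0 ham_derive2 big1// => i _; by rewrite mxE mul0r.
  have nm : `|m| != 0 by rewrite normr_eq0.
  have -> : 'D_(0, m) ('D_(0, m) Hu) (x, p + t *: m) = `|m| ^+ 2 * q (x, (p + t *: m, `|m|^-1 *: m)).
    rewrite /q /= !ham_derive2 mulr_sumr; apply: eq_bigr => i _.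
    rewrite !mulr_sumr; apply: eq_bigr => j _; rewrite !mxE; field; exact: nm.
  rewrite mulrC ler_wpM2l ?sqr_ge0//; apply: Hk; split => /=.
    have -> : p + t *: m = (1 - t) *: p + t *: (p + m).
      by rewrite scalerDr scalerBl scale1r addrA subrK.
    apply: le_trans (ler_normD _ _) _; rewrite !normrZ (ger0_norm t0) ger0_norm ?subr_ge0//.
    apply: (@le_trans _ _ ((1 - t) * P + t * P)); last by rewrite -mulrDl subrK mul1r.
    by apply: lerD; apply: ler_wpM2l; rewrite ?subr_ge0.
  by rewrite normrZ normfV normr_id mulVf.
have := C2_taylor_lb ham_C2 Hq; rewrite ham_derive dotv0 add0r.
have -> : (x, p) + (0, m) = (x, p + m) by rewrite -[LHS]/(x + 0, p + m) addr0.
rewrite /uncurryH /=; lra.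
Qed.

End hamiltonian.

(** * Legendre duality and expansions of the Lagrangian *)

Section lagrangian.
Context {R : realType} {n : nat} (H : 'rV[R]_n -> 'rV[R]_n -> R).
Hypothesis HH : Hamiltonian_hyp H.
Implicit Types (x p w m xi eta : 'rV[R]_n).
Notation Hu := (uncurryH H).
Notation Hx := (Hx H).
Notation Hp := (Hp H).
Notation Lag := (Lag H).
Notation N := (n%:R : R).

Lemma ham_taylor P : exists2 K, 0 <= K & forall x p w m, `|p| <= P -> `|p + m| <= P ->
  `|H (x + w) (p + m) - H x p - dotv (Hx x p) w - dotv (Hp x p) m| <=
  K * (`|w| + `|m|) ^+ 2.
Proof.
(* The intermediate covector is [p + c *: m] with [|c| <= 1] of unknown sign and [|m| <= 2 * P]. *)
have [K K0 HK] := ham_lipschitz HH (3 * P).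
exists (N * K); first by rewrite mulr_ge0.
move=> x p w m pP pmP.
have du z : derivable Hu z (w, m) by have [] := ham_C1 HH (w, m).
have [c c1 E] := directional_MVT (x, p) 1 du.
move: E; rewrite scale1r mul1r.
have -> : (x, p) + (w, m) = (x + w, p + m) by [].
have -> : (x, p) + c *: (w, m) = (x + c *: w, p + c *: m) by [].
rewrite ham_derive// /uncurryH/= => ->.
rewrite normr1 in c1.
have m2 : `|m| <= 2 * P.
  by rewrite -[m](addKr p) (le_trans (ler_normD _ _))// normrN; lra.
have cm : `|c *: m| <= `|m| by rewrite normrZ ler_piMl.
have cw : `|c *: w| <= `|w| by rewrite normrZ ler_piMl.
have pP3 : `|p| <= 3 * P by have := normr_ge0 p; lra.
have pcP : `|p + c *: m| <= 3 * P by rewrite (le_trans (ler_normD _ _))//; lra.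
have [_ h1 h2] := HK x p (x + c *: w) (p + c *: m) pP3 pcP.
rewrite !(addrAC _ _ (- _)) !subrr !add0r in h1 h2.
have -> : forall a b a' b' : R, a + b - a' - b' = (a - a') + (b - b') by move=> *; ring.
apply: le_trans (ler_normD _ _) _.
have e1 : `|Hx (x + c *: w) (p + c *: m) - Hx x p| <= K * (`|w| + `|m|).
  by apply: le_trans h1 _; apply: ler_wpM2l => //; apply: lerD.
have e2 : `|Hp (x + c *: w) (p + c *: m) - Hp x p| <= K * (`|w| + `|m|).
  by apply: le_trans h2 _; apply: ler_wpM2l => //; apply: lerD.
apply: le_trans (lerD (dotv_dist w e1) (dotv_dist m e2)) _.
by rewrite -mulrDr le_eqVlt; apply/orP; left; apply/eqP; ring.
Qed.

Lemma ham_superlinear M : exists2 Q, 0 <= Q & forall x p, Q <= `|p| -> M * `|p| <= H x p.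
Proof.
have [_ [_ [_ /(_ M)[Q HQ]]]] := HH; exists (Num.max 0 Q); first by rewrite le_max lexx.
by move=> x p; rewrite ge_max => /andP[_]; exact: HQ.
Qed.

(* Young's inequality: the cross terms are absorbed by the quadratic term [k * a ^+ 2]. *)
Lemma young_absorb (k A B a b d : R) : 0 < k ->
  A * a * b + B * a * d - k * a ^+ 2 <= (A ^+ 2 + B ^+ 2) / (2 * k) * (d ^+ 2 + b ^+ 2).
Proof.
move=> k0; have kk : 0 <= (2 * k)^-1 by rewrite invr_ge0 mulr_ge0// ltW.
have h1 : 0 <= (k * a - A * b) ^+ 2 * (2 * k)^-1 by rewrite mulr_ge0// sqr_ge0.
have h2 : 0 <= (k * a - B * d) ^+ 2 * (2 * k)^-1 by rewrite mulr_ge0// sqr_ge0.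
have h3 : 0 <= (A ^+ 2 * d ^+ 2 + B ^+ 2 * b ^+ 2) * (2 * k)^-1.
  by rewrite mulr_ge0// addr_ge0// mulr_ge0// sqr_ge0.
rewrite -subr_ge0.
have -> : (A ^+ 2 + B ^+ 2) / (2 * k) * (d ^+ 2 + b ^+ 2) - (A * a * b + B * a * d - k * a ^+ 2) =
  (k * a - A * b) ^+ 2 * (2 * k)^-1 + (k * a - B * d) ^+ 2 * (2 * k)^-1 +
  (A ^+ 2 * d ^+ 2 + B ^+ 2 * b ^+ 2) * (2 * k)^-1.
  by field; rewrite gt_eqF.
by rewrite !addr_ge0.
Qed.

(** Moving from [p] to [p' = p + m] loses [k * |m|^2] by convexity, and this absorbs the cross terms
    [|m| * |eta|] and [|m| * |w|]. What remains is quadratic in the perturbation, uniformly in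
    [p']. *)
Lemma fenchel_near P : exists2 C, 0 <= C & forall x p p' w eta,
  `|p| <= P -> `|p'| <= P ->
  dotv p' (Hp x p + eta) - H (x + w) p' <=
  dotv p (Hp x p + eta) - H x p - dotv (Hx x p) w + C * (`|w| ^+ 2 + `|eta| ^+ 2).
Proof.
have [KT KT0 HT] := ham_taylor P.
have [KL KL0 HL] := ham_lipschitz HH P.
have [k k0 Hk] := ham_convex HH P.
pose C2 := (N ^+ 2 + (N * KL) ^+ 2) / (2 * k).
have C20 : 0 <= C2 by rewrite divr_ge0 ?addr_ge0 ?sqr_ge0// mulr_ge0// ltW.
exists (KT + C2); first by rewrite addr_ge0.
move=> x p p' w eta pP p'P; set m := p' - p.
have p'E : p' = p + m by rewrite /m addrC subrK.
have t1 : H x p' + dotv (Hx x p') w - KT * `|w| ^+ 2 <= H (x + w) p'.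
  have := HT x p' w 0; rewrite addr0 normr0 addr0 dotv0 subr0 => /(_ p'P p'P).
  by rewrite ler_norml => /andP[t _]; rewrite -subr_ge0; move: t; rewrite lerBrDr addrC -lerBrDr; lra.
have [_ t2 _] := HL x p x p' pP p'P; rewrite subrr normr0 add0r -/m in t2.
have pmP : `|p + m| <= P by rewrite -p'E.
have t3 := Hk x p m pP pmP; rewrite -p'E in t3.
have t4 := dotv_ub m eta.
have t5 : dotv (Hx x p) w - N * KL * `|m| * `|w| <= dotv (Hx x p') w.
  have := dotv_dist w t2; rewrite ler_norml => /andP[+ _].
  by rewrite mulrA lerBrDr addrC.
have -> : dotv p' (Hp x p + eta) =
   dotv p (Hp x p + eta) + dotv (Hp x p) m + dotv m eta.
  by rewrite p'E dotvDl [dotv m _]dotvDr [dotv m (Hp _ _)]dotvC addrA.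
have y := young_absorb N (N * KL) `|m| `|eta| `|w| k0; rewrite -/C2 in y.
have z : 0 <= KT * `|eta| ^+ 2 by rewrite mulr_ge0// sqr_ge0.
move: t1 t3 t4 t5 y z.
move: (H (x + w) p') (H x p') (H x p) (dotv (Hx x p') w) (dotv (Hx x p) w).
move: (dotv m eta) (dotv (Hp x p) m) (dotv p _) (`|m|) (`|w|) (`|eta|).
clear; move: C2 => C2 *; lra.
Qed.

(** For large [p'] superlinear growth makes [H] outweigh all linear terms; the other covectors fall
    under [fenchel_near]. *)
Lemma fenchel_perturbed P : 0 <= P -> exists2 C, 0 <= C & forall x p p' w eta,
  `|p| <= P -> `|eta| <= 1 ->
  dotv p' (Hp x p + eta) - H (x + w) p' <=
  dotv p (Hp x p + eta) - H x p - dotv (Hx x p) w + C * (`|w| ^+ 2 + `|eta| ^+ 2).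
Proof.
move=> P0; have [K K0 HK] := ham_bounds HH P0.
(* The slope [2 * N * (K + 1)] beats the pairing of [p' - p], of norm at most [2 * |p'|], with a
   velocity of norm at most [K + 1]. The additional 1 yields a spare [|p'| > K + N * K], which pays
   for the constant terms. *)
have [Q Q0 HQ] := ham_superlinear (2 * N * (K + 1) + 1).
have NK : 0 <= N * K by rewrite mulr_ge0.
pose Q' := Q + P + K + N * K.
have QQ' : Q <= Q' by rewrite /Q'; clear -P0 K0 NK; lra.
have PQ' : P <= Q' by rewrite /Q'; clear -Q0 K0 NK; lra.
have KQ' : K + N * K <= Q' by rewrite /Q'; clear -Q0 P0; lra.
have [C1 C10 near] := fenchel_near Q'.
exists (C1 + N * K); first by rewrite !addr_ge0.
move=> x p p' w eta pP eta1; have [h0 hx hp] := HK x p pP.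
have s0 : 0 <= `|w| ^+ 2 + `|eta| ^+ 2 by rewrite addr_ge0// sqr_ge0.
have [p'Q|p'Q] := leP `|p'| Q'.
  apply: le_trans (near _ _ _ _ _ (le_trans pP PQ') p'Q) _.
  by rewrite lerD2l; apply: ler_wpM2r => //; rewrite lerDl.
clear near; set m := p' - p; have p'E : p' = p + m by rewrite /m addrC subrK.
have hQ := HQ (x + w) p' (le_trans QQ' (ltW p'Q)).
have c1 : N * K * `|w| ^+ 2 <= (C1 + N * K) * (`|w| ^+ 2 + `|eta| ^+ 2).
  by apply: ler_pM; rewrite ?sqr_ge0//; [rewrite lerDr|rewrite lerDl sqr_ge0].
have e1 : dotv m (Hp x p + eta) <= 2 * N * (K + 1) * `|p'|.
  have -> : 2 * N * (K + 1) * `|p'| = N * (2 * `|p'|) * (K + 1) by ring.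
  apply: dotv_ub_of; last by rewrite (le_trans (ler_normD _ _))// lerD.
  rewrite /m (le_trans (ler_normB _ _))// mulr_natl mulr2n lerD2l.
  exact: le_trans pP (le_trans PQ' (ltW p'Q)).
have e2 : dotv (Hx x p) w <= N * K * `|w|.
  exact: dotv_ub_of.
have e3 : N * K * `|w| <= N * K + N * K * `|w| ^+ 2.
  rewrite -subr_ge0 (_ : _ - _ = N * K * (1 - `|w| + `|w| ^+ 2)); last by ring.
  rewrite mulr_ge0//; have := sqr_ge0 (`|w| - 1 / 2); rewrite sqrrB; clear; lra.
have -> : dotv p' (Hp x p + eta) = dotv p (Hp x p + eta) + dotv m (Hp x p + eta).
  by rewrite {1}p'E dotvDl.
have {}h0 := le_trans (ler_norm _) h0.
move: h0 e1 e2 e3 c1 hQ p'Q KQ'.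
move: (H (x + w) p') (H x p) (dotv (Hx x p) w) (dotv m _) (dotv p _) => *.
lra.
Qed.

Lemma Lag_has_sup x xi : has_sup (range (fun p => dotv xi p - H x p)).
Proof.
split; first by exists (dotv xi 0 - H x 0); exists 0.
have [Q Q0 HQ] := ham_superlinear (N * `|xi|).
have [K K0 HK] := ham_bounds HH Q0.
have NQ : 0 <= N * `|xi| * Q by rewrite !mulr_ge0.
exists (N * `|xi| * Q + K) => _ [p _ <-]; have := dotv_ub xi p; move=> d.
have [pQ|pQ] := leP Q `|p|; first by have := HQ x p pQ; lra.
have [+ _ _] := HK x p (ltW pQ); rewrite ler_norml => /andP[h0 _].
have : N * `|xi| * `|p| <= N * `|xi| * Q by rewrite ler_wpM2l ?mulr_ge0// ltW.
lra.
Qed.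

Lemma Lag_ge x xi p : dotv xi p - H x p <= Lag x xi.
Proof. by apply: ub_le_sup; [case: (Lag_has_sup x xi)|exists p]. Qed.

Lemma Lag_le x xi B : (forall p, dotv xi p - H x p <= B) -> Lag x xi <= B.
Proof.
move=> HB; apply: ge_sup; first by case: (Lag_has_sup x xi).
by move=> _ [p _ <-].
Qed.

(** Since [p] itself gives the matching lower bound through [Lag_ge], this single estimate yields
    the value and both gradients of the Lagrangian at [Hp x p], without differentiating a
    supremum. *)
Lemma Lag_perturbed P : 0 <= P -> exists2 C, 0 <= C & forall x p w eta,
  `|p| <= P -> `|eta| <= 1 ->
  Lag (x + w) (Hp x p + eta) <=
  dotv p (Hp x p + eta) - H x p - dotv (Hx x p) w + C * (`|w| ^+ 2 + `|eta| ^+ 2).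
Proof.
move=> P0; have [C C0 HC] := fenchel_perturbed P0; exists C => // x p w eta pP eta1.
by apply: Lag_le => p'; rewrite dotvC; exact: HC.
Qed.

Lemma Lag_Hp x p : Lag x (Hp x p) = dotv p (Hp x p) - H x p.
Proof.
have [C _ /(_ x p 0 0 (lexx _))] := Lag_perturbed (normr_ge0 p).
rewrite normr0 ler01 !addr0 dotv0 subr0 expr0n addr0 mulr0 addr0 => /(_ isT) h.
by apply/eqP; rewrite eq_le h/= dotvC Lag_ge.
Qed.

Lemma ham_continuous x : continuous (H x).
Proof.
move=> p; apply: continuous_of_dist => e e0.
have [K K0 HK] := ham_lipschitz HH (`|p| + 1).
have K1 : 0 < K + 1 by rewrite ltr_wpDl.
exists (Num.min 1 (e / (K + 1))); first by rewrite lt_min ltr01 divr_gt0.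
move=> y; rewrite lt_min => /andP[y1 ye].
have p1 : `|p| <= `|p| + 1 by rewrite lerDl.
have p2 : `|p + y| <= `|p| + 1 by rewrite (le_trans (ler_normD _ _))// lerD// ltW.
have [h _ _] := HK x p x (p + y) p1 p2.
apply: le_trans h _; rewrite subrr normr0 add0r [p + y]addrC addrK.
apply: (@le_trans _ _ ((K + 1) * `|y|)); first by rewrite ler_wpM2r// lerDl.
by rewrite mulrC -ler_pdivlMr// ltW.
Qed.

(** The preimage of [xi] is a maximizer of [dotv xi p - H x p]. Outside the ball of radius [Q + K]
    this function is at most [- |p|], hence below its value at 0, so a maximum over the ball is
    global. *)
Lemma legendre_surj C : 0 <= C -> exists2 P, 0 <= P & forall x xi, `|xi| <= C ->
  exists2 p, `|p| <= P & Hp x p = xi.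
Proof.
move=> C0; have [K K0 HK] := ham_bounds HH (lexx (0 : R)).
have [Q Q0 HQ] := ham_superlinear (N * C + 1).
exists (Q + K); first by rewrite addr_ge0.
move=> x xi xiC.
have ne : [set p : 'rV[R]_n | `|p| <= Q + K] !=set0.
  by exists 0 => /=; rewrite normr0 addr_ge0.
have fc : {within [set p : 'rV[R]_n | `|p| <= Q + K], continuous (fun p => dotv xi p - H x p)}.
  apply: continuous_in_subspaceT => p _.
  by apply: continuousB; [exact: dotv_continuous|exact: ham_continuous].
have [p /set_mem/= pP Hmax] := EVT_max_rV ne (@compact_norm_le _ _ (Q + K)) fc.
have glob p' : dotv xi p' - H x p' <= dotv xi p - H x p.
  have [p'P|p'P] := leP `|p'| (Q + K); first by apply: Hmax; exact/mem_set.
  have : dotv xi 0 - H x 0 <= dotv xi p - H x p.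
    by apply: Hmax; apply/mem_set; rewrite /= normr0 addr_ge0.
  apply: le_trans; rewrite dotv0.
  have n0 : `|0 : 'rV[R]_n| <= (0 : R) by rewrite normr0.
  have [+ _ _] := HK x 0 n0; rewrite ler_norml => /andP[_ h0].
  have Qp : Q <= `|p'| by lra.
  have hQ := HQ x p' Qp; have := dotv_ub xi p'.
  have : N * `|xi| * `|p'| <= N * C * `|p'| by apply: ler_wpM2r => //; apply: ler_wpM2l.
  lra.
exists p => //.
(* First-order condition: comparison with [p - w] for [|w| <= rho] bounds [Hp x p - xi] by
   [KT * rho], which is arbitrarily small. *)
have [KT KT0 HT] := ham_taylor (`|p| + 1).
apply/eqP; rewrite -subr_eq0 -normr_eq0 eq_le normr_ge0 andbT.
apply/ler_addgt0Pr => e e0; rewrite add0r.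
pose rho := Num.min 1 (e / (KT + 1)).
have KT1 : 0 < KT + 1 by rewrite ltr_wpDl.
have rho0 : 0 < rho by rewrite lt_min ltr01 divr_gt0.
apply: (@le_trans _ _ (KT * rho)); last first.
  have : rho * (KT + 1) <= e by rewrite -ler_pdivlMr// ge_min lexx orbT.
  by move: rho0; rewrite mulrDr; lra.
apply: (norm_le_dotv rho0); first by rewrite mulr_ge0// ltW.
move=> w wr; have w1 : `|w| <= 1 by rewrite (le_trans wr)// ge_min lexx.
have := HT x p 0 (- w); rewrite normrN normr0 add0r addr0 dotv0 subr0 dotvNr opprK.
have p1 : `|p| <= `|p| + 1 by rewrite lerDl.
have p2 : `|p - w| <= `|p| + 1 by rewrite (le_trans (ler_normB _ _))// lerD2l.
move=> /(_ p1 p2); rewrite ler_norml => /andP[_ h].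
have := glob (p - w); rewrite dotvBr dotvBl.
have : KT * `|w| ^+ 2 <= KT * rho * rho.
  by rewrite -mulrA; apply: ler_wpM2l => //; rewrite expr2; apply: ler_pM.
lra.
Qed.

Lemma Lxi_Hp x p : Lxi H x (Hp x p) = p.
Proof.
have [C C0 HC] := Lag_perturbed (normr_ge0 p).
have [] // := @differentiable_of_quad R n (Lag x) (Hp x p) p C.
move=> eta eta1; have := HC x p 0 eta (lexx _) eta1.
rewrite normr0 expr0n add0r addr0 dotv0 subr0 => h1.
have h2 := Lag_ge x (Hp x p + eta) p; rewrite dotvC in h2.
have h3 : 0 <= C * `|eta| ^+ 2 by rewrite mulr_ge0// sqr_ge0.
move: h1 h2; rewrite Lag_Hp dotvDr ler_norml; lra.
Qed.

Lemma Lx_Hp x p : Lx H x (Hp x p) = - Hx x p.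
Proof.
have [C C0 HC] := Lag_perturbed (normr_ge0 p).
have [K K0 HK] := ham_taylor `|p|.
have [] // := @differentiable_of_quad R n (fun z => Lag z (Hp x p)) x (- Hx x p) (C + K).
move=> w w1; have := HC x p w 0 (lexx _).
rewrite normr0 expr0n !addr0 => /(_ ler01) h1.
have h2 := Lag_ge (x + w) (Hp x p) p; rewrite dotvC in h2.
have := HK x p w 0; rewrite addr0 normr0 dotv0 subr0 addr0 => /(_ (lexx _) (lexx _)).
rewrite ler_norml => /andP[_ h3].
have h4 : 0 <= C * `|w| ^+ 2 by rewrite mulr_ge0// sqr_ge0.
have h5 : 0 <= K * `|w| ^+ 2 by rewrite mulr_ge0// sqr_ge0.
move: h1 h2; rewrite Lag_Hp dotvNl ler_norml; lra.
Qed.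

Lemma Lag_bounded C : 0 <= C -> exists2 B, 0 <= B & forall x xi, `|xi| <= C -> Lag x xi <= B.
Proof.
move=> C0; have [P P0 HP] := legendre_surj C0; have [K K0 HK] := ham_bounds HH P0.
exists (N * P * C + K); first by rewrite addr_ge0// !mulr_ge0.
move=> x xi xiC; have [p pP E] := HP x xi xiC; rewrite -E Lag_Hp E.
have [h0 _ _] := HK x p pP; have d := dotv_ub_of pP xiC.
by apply: lerD => //; rewrite (le_trans (ler_norm _))// normrN.
Qed.

End lagrangian.

Lemma is_derive_dotv {R : realType} {n : nat} (r : 'rV[R]_n) (g : R -> 'rV[R]_n) (s : R) :
  derivable g s 1 -> is_derive s (1 : R) (fun t => dotv r (g t)) (dotv r ('D_1 g s)).
Proof.
move=> gd; have L : (h^-1 *: (dotv r (g (h *: 1 + s)) - dotv r (g s))) @[h --> (0 : R)^'] -->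
    dotv r ('D_1 g s).
  have := cvg_comp _ _ gd (@dotv_continuous R n r ('D_1 g s)); apply: cvg_trans.
  apply: near_eq_cvg; near=> h; by rewrite /= dotvZr dotvBr.
by apply: DeriveDef; [apply/cvg_ex; eexists; exact: L|exact: (cvg_lim _ L)].
Unshelve. all: by end_near. Qed.

Lemma is_derive_expR_lin {R : realType} (eps s : R) :
  is_derive s (1 : R) (fun t : R => expR (eps * t)) (eps * expR (eps * s)).
Proof.
have h : is_derive s (1 : R) (fun t : R => eps * t) eps.
  have := is_deriveM (is_derive_cst eps s (1 : R)) (is_derive_id s (1 : R)).
  by move=> hh; apply: (is_derive_eq hh); rewrite scaler0 addr0 [LHS]mulr1.
by have := is_derive1_comp (is_derive_expR _) h; rewrite mulrC; apply.
Qed.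

Lemma abs_cont_sub {R : realType} {V : normedModType R} (F : R -> V) (a b a' b' : R) :
  a <= a' -> b' <= b -> abs_cont F a b -> abs_cont F a' b'.
Proof.
move=> aa bb Fac e e0; have [d [d0 H]] := Fac e e0; exists d; split => // m s t st ts.
apply: H => // k km; have [h1 [h2 h3]] := st k km; split; first exact: le_trans h1.
by split => //; exact: le_trans bb.
Qed.

Lemma abs_cont_lipschitz {R : realType} {V : normedModType R} (F : R -> V) (a b C : R) :
  (forall s t, a <= s -> s <= t -> t <= b -> `|F t - F s| <= C * (t - s)) -> abs_cont F a b.
Proof.
move=> HF; have C0 : 0 < `|C| + 1 by rewrite ltr_wpDl.
move=> e e0; exists (e / (`|C| + 1)); split; first by rewrite divr_gt0.
move=> m s t st ts; rewrite ltr_pdivlMr// mulrC; apply: le_lt_trans.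
rewrite mulr_sumr; apply: ler_sum => k _; have [h1 [h2 h3]] := st k (ltn_ord k).
apply: le_trans (HF _ _ h1 h2 h3) _; apply: ler_wpM2r; first by rewrite subr_ge0.
by rewrite (le_trans (ler_norm _))// lerDl.
Qed.

(** * Bounds on the action and Lipschitz estimates *)

Section action_bounds.
Context {R : realType} {n : nat} (H : 'rV[R]_n -> 'rV[R]_n -> R).
Variables (c : 'rV[R]_n) (h eps : R) (v : 'rV[R]_n -> R).
Hypothesis HH : Hamiltonian_hyp H.
Hypothesis eps0 : 0 < eps.
Hypothesis rep : forall (x : 'rV[R]_n) (T : R), 0 < T ->
  (v x)%:E = ereal_inf [set action eps H c h v g T | g in admissible x T].
Notation mu := (@lebesgue_measure R).
Notation Lag := (Lag H).

(** The segment run at constant speed is a competitor in the representation formula, and a pointwise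
    bound on the integrand passes to its integral by [le_lint]. *)
Lemma segment_upper_bound (ya yb : 'rV[R]_n) (d B : R) : 0 < d ->
  (forall s, - d <= s -> s <= 0 -> expR (eps * s) *
    (Lag (yb + s *: (d^-1 *: (yb - ya))) (d^-1 *: (yb - ya)) -
     dotv c (d^-1 *: (yb - ya)) + h) <= B) ->
  v yb <= expR (- (eps * d)) * v ya + B * d.
Proof.
move=> d0 HB; pose eta := d^-1 *: (yb - ya); pose g s := yb + s *: eta.
have gD s : 'D_1 g s = eta.
  apply: derive_val; have h1 : is_derive s (1 : R) (fun t : R => t *: eta) eta.
    have L : (k^-1 *: ((k *: 1 + s) *: eta - s *: eta)) @[k --> (0 : R)^'] --> eta.
      apply: (@cvg_trans _ (cst eta k @[k --> (0 : R)^'])); last exact: cvg_cst.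
      apply: near_eq_cvg; near=> k; have k0 : k != 0 by near: k; exact: nbhs_dnbhs_neq.
      by rewrite /= scalerDl addrK scalerA [k *: 1]mulr1 mulVf// scale1r.
    by apply: DeriveDef; [apply/cvg_ex; eexists; exact: L|exact: (cvg_lim _ L)].
  have := is_deriveD (is_derive_cst yb s (1 : R)) h1; rewrite add0r; exact.
have gad : admissible yb d g.
  split; last by rewrite /g scale0r addr0.
  apply: (@abs_cont_lipschitz _ _ _ _ _ `|eta|) => s t _ st _.
  by rewrite /g opprD addrACA subrr add0r -scalerBl normrZ mulrC ger0_norm// subr_ge0.
have gT : g (- d) = ya.
  by rewrite /g /eta scalerA mulNr divff ?gt_eqF// scaleN1r opprB addrC subrK.
have : ((v yb)%:E <= action eps H c h v g d)%E.
  by rewrite (rep yb d0); apply: ereal_inf_lbound; exists g.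
rewrite /action gT => /le_trans vle; rewrite -lee_fin addrC EFinD.
apply: vle; rewrite leeD2r//.
apply: (@le_trans _ _ (\int[mu]_(s in segm d) cst B%:E s)%E).
  apply: le_lint => s; rewrite /segm /= in_itv/= => /andP[ds s0]; rewrite lee_fin.
  by rewrite gD; exact: HB.
have mE : mu (segm d : set R) = d%:E.
  by rewrite /segm [LHS]lebesgue_measure_itv/= lte_fin oppr_lt0 d0 -EFinD sub0r opprK.
by rewrite integral_cst; [rewrite [X in (_ * X)%E]mE|exact: measurable_itv].
Unshelve. all: by end_near. Qed.

(** Fenchel's inequality with the constant covector [c + r] bounds the undiscounted integrand below
    by [dotv r g' - H (g s) (c + r) + h]. Integrating the discounted first term by parts produces
    [dotv r (g b - g a)] and the correction [eps * dotv r (g s - g a)]. *)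
Lemma minimizing_lower_bound x g (a b B : R) (r : 'rV[R]_n) :
  minimizing eps H c h v x g -> a < b -> b < 0 ->
  (forall s, a <= s -> s <= b -> expR (eps * (s - b)) *
     (eps * dotv r (g s - g a) + H (g s) (c + r) - h) <= B) ->
  dotv r (g b - g a) - B * (b - a) <= v (g b) - expR (- (eps * (b - a))) * v (g a).
Proof.
move=> [gx gmin] ab b0 HB.
have a0 : a < 0 by exact: lt_trans b0.
pose f s := expR (eps * s) * (Lag (g s) ('D_1 g s) - dotv c ('D_1 g s) + h).
have actE T : 0 < T -> (\int[mu]_(s in segm T) (f s)%:E)%E =
    (v x - expR (- (eps * T)) * v (g (- T)))%:E.
  move=> T0; have [_] := gmin T T0; rewrite -(rep x T0) /action.
  rewrite -[X in (X + _)%E]/(\int[mu]_(s in segm T) (f s)%:E)%E.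
  case: (\int[mu]_(s in segm T) (f s)%:E)%E => [y| |]//= [<-].
  by rewrite addrK.
have [K K0 HK] := ham_bounds HH (normr_ge0 c).
have fK s : s <= 0 -> - (K + `|h|) <= f s.
  move=> s0; have e1 : expR (eps * s) <= 1 by rewrite -expR0 ler_expR pmulr_rle0.
  have h1 := Lag_ge HH (g s) ('D_1 g s) c; rewrite dotvC in h1.
  have [h2 _ _] := HK (g s) c (lexx _); have {}h2 := le_trans (ler_norm _) h2.
  have h3 : - `|h| <= h by rewrite lerNl -normrN ler_norm.
  have X0 : - (K + `|h|) <= Lag (g s) ('D_1 g s) - dotv c ('D_1 g s) + h.
    by move: h1 h2 h3; move: (Lag _ _) (dotv _ _) (H _ _) `|h| => *; lra.
  apply: le_trans (_ : expR (eps * s) * - (K + `|h|) <= _).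
    by rewrite mulrN lerN2 ler_piMl// addr_ge0.
  by rewrite ler_wpM2l// expR_ge0.
have mI (i : interval R) : measurable ([set` i] : set R) by exact: measurable_itv.
have mI' (i : interval R) : measurable ([set` i] : set (measurableTypeR R)) by exact: measurable_itv.
have mab : (mu (`[a, b[%classic : set R) < +oo)%E.
  by rewrite [X in (X < _)%E]lebesgue_measure_itv/= lte_fin ab -EFinB ltry.
have mb0 : (mu (`[b, 0%R]%classic : set R) < +oo)%E.
  by rewrite [X in (X < _)%E]lebesgue_measure_itv/= lte_fin b0 -EFinB ltry.
(* The action over [[a, b[] is the difference of the optimal actions over [[a, 0]] and [[b, 0]]; the
   lower bound on [f] makes the integral additive. *)
have intab : (\int[mu]_(s in `[a, b[%classic) (f s)%:E =
    (expR (eps * b) * v (g b) - expR (eps * a) * v (g a))%:E)%E.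
  have U : segm (- a) = `[a, b[%classic `|` `[b, 0]%classic.
    by rewrite /segm opprK -itv_bndbnd_setU// bnd_simp ltW.
  have D : [disjoint (`[a, b[%classic : set R) & `[b, 0]%classic].
    apply/disj_setPS => s [] /=; rewrite !in_itv/= => /andP[_ sb] /andP[bs _].
    by move: (lt_le_trans sb bs); rewrite ltxx.
  have na : 0 < - a by rewrite oppr_gt0.
  have nb : 0 < - b by rewrite oppr_gt0.
  have := actE _ na; rewrite U lint_setU//; last 2 first.
  - apply: (lint_neg_fin_num (K := K + `|h|)) => // s /=; rewrite in_itv/= => /andP[_ sb].
    by apply: fK; rewrite ltW// (lt_trans sb).
  - by apply: (lint_neg_fin_num (K := K + `|h|)) => // s /=; rewrite in_itv/= => /andP[_ /fK].
  have := actE _ nb; rewrite /segm !opprK !mulrN !opprK => ->.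
  by case: (\int[mu]_(s in `[a, b[%classic) (f s)%:E)%E => [y| |]//= [E]; congr (_%:E); lra.
have gac : abs_cont g a b.
  have na : 0 < - a by rewrite oppr_gt0.
  have [gac _] := gmin _ na; rewrite opprK in gac.
  by apply: (abs_cont_sub (lexx a) (ltW b0)); exact: gac.
pose D s := dotv r (g s - g a).
have Dac : abs_cont D a b.
  apply: (abs_cont_le (C := n%:R * `|r|) gac) => s t _ st _.
  rewrite /D -dotvBr opprB addrA subrK; apply: le_trans (dotv_le _ _) _.
  by apply: ler_wpM2l; rewrite ?mulr_ge0// lerDl subr_ge0.
have [G G0 HG] : exists2 G : R, 0 <= G & forall s, a <= s -> s <= b -> `|D s| <= G.
  exists (tv D a b - tv D a a) => [|s as' sb].
    by apply: le_trans (tv_ge Dac (lexx a) (ltW ab) (lexx b)).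
  have Da : D a = 0 by rewrite /D subrr dotv0.
  have h1 := tv_ge Dac (lexx a) as' sb; rewrite Da subr0 in h1.
  have h2 := le_trans (normr_ge0 _) (tv_ge Dac as' sb (lexx b)).
  apply: le_trans h1 _; rewrite lerD2r; move: h2; rewrite subr_ge0; exact.
pose Eb := expR (eps * b).
(* By [HB] and Fenchel's inequality the derivative of [F] lies below [f] almost everywhere on [[a,
   b[]. *)
pose F s := expR (eps * s) * D s - Eb * B * s.
have Fac : abs_cont F a b.
  apply: (abs_cont_le (C := 1 + eps * G + `|Eb * B|) Dac) => s t as' st tb.
  have ts : 0 <= t - s by rewrite subr_ge0.
  have es : expR (eps * s) <= 1.
    by rewrite -expR0 ler_expR pmulr_rle0// (le_trans st)// (le_trans tb)// ltW.
  have et : expR (eps * t) <= 1.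
    by rewrite -expR0 ler_expR pmulr_rle0// (le_trans tb)// ltW.
  have ets : 0 <= expR (eps * t) - expR (eps * s) <= eps * (t - s).
    rewrite subr_ge0 ler_expR ler_pM2l// st /=.
    have -> : expR (eps * s) = expR (eps * t) * expR (- (eps * (t - s))).
      by rewrite -expRD; congr expR; ring.
    have h1 := expR_ge1Dx (- (eps * (t - s))).
    have h2 : 0 <= expR (eps * t) * (expR (- (eps * (t - s))) - (1 - eps * (t - s))).
      by rewrite mulr_ge0 ?expR_ge0// subr_ge0.
    have h3 : 0 <= (1 - expR (eps * t)) * (eps * (t - s)).
      by rewrite mulr_ge0 ?subr_ge0// mulr_ge0// ltW.
    move: h2 h3; set X := expR _; set Y := expR _; lra.
  have [e1 e2] := andP ets.
  have -> : F t - F s = expR (eps * s) * (D t - D s) +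
     (expR (eps * t) - expR (eps * s)) * D t - Eb * B * (t - s) by rewrite /F; ring.
  apply: le_trans (ler_normB _ _) _; apply: (@le_trans _ _
     (`|D t - D s| + eps * G * (t - s) + `|Eb * B| * (t - s))).
    apply: lerD; last by rewrite normrM (ger0_norm ts).
    apply: le_trans (ler_normD _ _) _; apply: lerD; rewrite normrM ger0_norm ?expR_ge0//.
      by rewrite ler_piMl.
    have -> : eps * G * (t - s) = eps * (t - s) * G by ring.
    by apply: ler_pM => //; apply: HG => //; exact: le_trans st.
  have d0 := normr_ge0 (D t - D s); have b0' := normr_ge0 (Eb * B).
  have eG : 0 <= eps * G by rewrite mulr_ge0// ltW.
  rewrite -subr_ge0; set X := `|D t - D s| in d0 *.
  have -> : (1 + eps * G + `|Eb * B|) * (X + (t - s)) -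
    (X + eps * G * (t - s) + `|Eb * B| * (t - s)) = (t - s) + (eps * G + `|Eb * B|) * X by ring.
  by rewrite addr_ge0// mulr_ge0// addr_ge0.
have [phi [iphi phiE phiD]] := abs_cont_FTC ab Fac.
have gD : {ae mu, forall s, a < s < b -> derivable g s 1}.
  have gi (i : 'I_n) : {ae mu, forall s, a < s < b -> derivable (fun t => g t 0 i) s 1}.
    have gac' : abs_cont (fun t => g t 0 i) a b.
      apply: (abs_cont_le (C := 1) gac) => s t _ st _.
      rewrite mul1r -coordB; apply: le_trans (coord_le_norm _ _) _.
      by rewrite lerDl subr_ge0.
    have [p [_ _]] := abs_cont_FTC ab gac'.
    by apply: (@filterS _ _ (ae_filter_ringOfSetsType mu)) => s H1 /H1[].
  have := @filter_forall _ _ _ _ (ae_filter_ringOfSetsType mu) gi.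
  apply: (@filterS _ _ (ae_filter_ringOfSetsType mu)).
  move=> s H1 sab.
  by apply/derivable_mxP => j i; rewrite ord1; exact: H1.
(* The derivative is identified only in the open interval, while the integral is over [[a, b[]. *)
have na : {ae mu, forall s : R, s != a}.
  exists [set a]; split => //; first exact: lebesgue_measure_set1.
  by move=> s /= /negP; rewrite negbK => /eqP.
have kf : {ae mu, forall s, `[a, b[%classic s -> phi s <= f s}.
  have := @filterI _ _ (ae_filter_ringOfSetsType mu) _ _ phiD
    (@filterI _ _ (ae_filter_ringOfSetsType mu) _ _ gD na).
  apply: (@filterS _ _ (ae_filter_ringOfSetsType mu)).
  move=> s [H1 [H2 sa]] /=.
  rewrite in_itv/= => /andP[as' sb].
  have sab : a < s < b by rewrite lt_neqAle eq_sym sa as'.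
  have gs := H2 sab; have [_ <-] := H1 sab.
  have h1 : is_derive s (1 : R) D (dotv r ('D_1 g s)).
    have := is_deriveB (is_derive_dotv r gs) (is_derive_cst (dotv r (g a)) s (1 : R)).
    rewrite subr0; congr is_derive; apply/funext => t; by rewrite /D dotvBr.
  have h2 := is_deriveM (is_derive_expR_lin eps s) h1.
  have h3 := is_deriveM (is_derive_cst (Eb * B) s (1 : R)) (is_derive_id s (1 : R)).
  have -> : 'D_1 F s = expR (eps * s) * (dotv r ('D_1 g s) + eps * D s) - Eb * B.
    have [_ E] := is_deriveB h2 h3; apply: (etrans E).
    by rewrite scaler0 addr0 /GRing.scale /= mulr1; ring.
  have Bs := HB s as' (ltW sb).
  have es : expR (eps * s) = Eb * expR (eps * (s - b)).
    by rewrite /Eb -expRD; congr expR; ring.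
  have Eb0 : 0 <= Eb by exact: expR_ge0.
  have {}Bs := ler_wpM2l Eb0 Bs; rewrite mulrA -es -/(D s) in Bs.
  have LL := Lag_ge HH (g s) ('D_1 g s) (c + r).
  rewrite dotvDr ![dotv ('D_1 g s) _]dotvC in LL.
  have L2 : expR (eps * s) * (dotv c ('D_1 g s) + dotv r ('D_1 g s) - H (g s) (c + r)) <=
            expR (eps * s) * Lag (g s) ('D_1 g s) by apply: ler_wpM2l => //; exact: expR_ge0.
  rewrite /f; move: L2 Bs; move: (expR _) (Lag _ _) (H _ _) (dotv _ _) (dotv _ _) => *; lra.
have ik : mu.-integrable `[a, b[ (EFin \o phi) by exact: (integrableS measurableT).
have mphi (i : interval R) : measurable_fun ([set` i] : set (measurableTypeR R)) (EFin \o phi).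
  by case/integrableP : iphi => + _; exact: measurable_funS.
have kE : (\int[mu]_(s in `[a, b[%classic) (phi s)%:E = (F b - F a)%:E)%E.
  rewrite -(phiE a b)// ?ltW// integral_itv_bndo_bndc; last exact: mphi.
  by rewrite -integral_itv_obnd_cbnd; last exact: mphi.
have := lint_ge_ae (mI' `[a, b[) ik kf (K := K + `|h|).
rewrite intab kE lee_fin => h1.
have {}h1 : F b - F a <= expR (eps * b) * v (g b) - expR (eps * a) * v (g a).
  by apply: h1 => s /=; rewrite in_itv/= => /andP[_ sb]; apply: fK; rewrite ltW// (lt_trans sb).
have Eb0 : 0 < Eb by exact: expR_gt0.
rewrite -(ler_pM2l Eb0); move: h1; rewrite /F /D subrr dotv0 mulr0.
have -> : expR (eps * a) = Eb * expR (- (eps * (b - a))).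
  by rewrite /Eb -expRD; congr expR; ring.
rewrite -/Eb => h2; lra.
Qed.

End action_bounds.

(** The constant is independent of [d], so a scale that depends on the curve still leads to a
    uniform Lipschitz constant. *)
Lemma lipschitz_of_local {R : realType} {V : normedModType R} (g : R -> V) (a b d C : R) :
  0 < d ->
  (forall s t, a <= s -> s <= t -> t <= b -> t - s < d -> `|g t - g s| <= C * (t - s)) ->
  forall s t, a <= s -> s <= t -> t <= b -> `|g t - g s| <= C * (t - s).
Proof.
move=> d0 Hd s t as' st tb.
suff H k : forall t', s <= t' -> t' <= b -> t' - s <= d / 2 *+ k ->
    `|g t' - g s| <= C * (t' - s).
  have d20 : 0 < d / 2 by rewrite divr_gt0.
  apply: (H (Num.bound ((t - s) / (d / 2)))) => //.
  have : 0 <= (t - s) / (d / 2) by rewrite divr_ge0 ?(ltW d20)// subr_ge0.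
  by move=> /archi_boundP; rewrite ltr_pdivrMr// mulrC mulr_natr => /ltW.
elim: k => [|k IH] t' st' tb' td.
  have -> : t' = s by apply/eqP; rewrite eq_le st' andbT -subr_le0 (le_trans td)// mulr0n.
  by rewrite !subrr normr0 mulr0.
rewrite mulrS in td; have [tsd|dts] := ltP (t' - s) d; first exact: Hd.
have h1 : s <= t' - d / 2 by lra.
have h2 : t' - d / 2 <= b by lra.
have h3 : t' - d / 2 - s <= d / 2 *+ k by lra.
have h4 : a <= t' - d / 2 by lra.
have h5 : t' - d / 2 <= t' by lra.
have h6 : t' - (t' - d / 2) < d by lra.
have i2 := Hd _ _ h4 h5 tb' h6; have i1 := IH _ h1 h2 h3.
rewrite -(subrKA (g (t' - d / 2)) (g t')).
apply: le_trans (ler_normD _ _) _; apply: le_trans (lerD i2 i1) _.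
by rewrite -mulrDr le_eqVlt; apply/orP; left; apply/eqP; congr (_ * _); ring.
Qed.

Lemma expR_weight {R : realType} (x : R) : 0 <= x -> 1 - x <= expR (- x) <= 1.
Proof.
by move=> x0; rewrite expR_ge1Dx /= -expR0 ler_expR oppr_le0.
Qed.

(** Removing a discount weight [w] costs at most [x] times the size of the main part [X]; the
    nonnegative remainder [Y] only grows when its weight is removed. *)
Lemma weight_le {R : realType} (x w X0 X Y : R) : 1 - x <= w -> w <= 1 -> 0 <= w ->
  `|X| <= X0 -> 0 <= Y -> w * (X + Y) <= X + x * X0 + Y.
Proof.
move=> xw w1 w0 XX0 Y0.
have h1 : 0 <= (1 - w) * (X + X0).
  by rewrite mulr_ge0 ?subr_ge0//; move: XX0; rewrite ler_norml; lra.
have h2 : 0 <= (w - (1 - x)) * X0.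
  by rewrite mulr_ge0 ?subr_ge0// (le_trans _ XX0).
have h3 : 0 <= (1 - w) * Y by rewrite mulr_ge0 ?subr_ge0.
lra.
Qed.

(** * Lipschitz bounds for the value function and for minimizers *)

Section value_function.
Context {R : realType} {n : nat} (H : 'rV[R]_n -> 'rV[R]_n -> R).
Variables (c : 'rV[R]_n) (h eps : R) (v : 'rV[R]_n -> R).
Hypothesis HH : Hamiltonian_hyp H.
Hypothesis eps0 : 0 < eps.
Hypothesis rep : forall (x : 'rV[R]_n) (T : R), 0 < T ->
  (v x)%:E = ereal_inf [set action eps H c h v g T | g in admissible x T].
Hypotheses (vcont : continuous v) (vper : Zperiodic v).
Notation Lag := (Lag H).
Notation Hp := (Hp H).
Notation Hx := (Hx H).
Notation N := (n%:R : R).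

Lemma value_bounded : exists2 V : R, 0 <= V & forall x, `|v x| <= V.
Proof.
have ne : [set p : 'rV[R]_n | `|p| <= 1] !=set0 by exists 0 => /=; rewrite normr0.
have vc : {within [set p : 'rV[R]_n | `|p| <= 1], continuous (fun x => `|v x|)}.
  apply: continuous_in_subspaceT => x _.
  apply: continuous_comp; [exact: vcont|exact: norm_continuous].
have [x0 _ Hmax] := EVT_max_rV ne (@compact_norm_le _ _ 1) vc.
exists `|v x0| => // x; have [k kint xk] := int_shift x.
by rewrite -(vper x kint); apply: Hmax; exact/mem_set.
Qed.

(** Comparison with a segment of unit speed; [eps * V] accounts for the discount of the value at its
    starting point. *)
Lemma value_lipschitz : exists2 K : R, 0 <= K & forall x y, `|v y - v x| <= K * `|y - x|.
Proof.
have [V V0 HV] := value_bounded.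
have [B1 B10 HB] := Lag_bounded HH (@ler01 R).
pose B := B1 + N * `|c| + `|h|.
have B0 : 0 <= B by rewrite !addr_ge0// mulr_ge0.
exists (B + eps * V); first by rewrite addr_ge0// mulr_ge0// ltW.
have half x y : v y - v x <= (B + eps * V) * `|y - x|.
  have [->|yx] := eqVneq y x; first by rewrite !subrr normr0 mulr0.
  have d0 : 0 < `|y - x| by rewrite normr_gt0 subr_eq0.
  set d := `|y - x| in d0 *.
  have nd : `|d^-1 *: (y - x)| = 1 by rewrite normrZ gtr0_norm ?invr_gt0// mulVf// gt_eqF.
  have S : v y <= expR (- (eps * d)) * v x + B * d.
    apply: (segment_upper_bound rep d0) => s ds s0.
    have e1 : expR (eps * s) <= 1 by rewrite -expR0 ler_expR pmulr_rle0.
    apply: (@le_trans _ _ (expR (eps * s) * B)); last by rewrite ler_piMl.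
    apply: ler_wpM2l; first exact: expR_ge0.
    apply: lerD; last exact: ler_norm.
    apply: lerD; first by apply: HB; rewrite nd.
    by rewrite -dotvNr; apply: le_trans (dotv_ub _ _) _; rewrite normrN nd mulr1.
  have ed0 : 0 <= eps * d by rewrite mulr_ge0// ltW.
  have /andP[w1 w2] := expR_weight ed0.
  have h1 : `|(1 - expR (- (eps * d))) * v x| <= eps * d * V.
    rewrite normrM ger0_norm ?subr_ge0//; apply: ler_pM => //; first by rewrite subr_ge0.
    by rewrite lerBlDr addrC -lerBlDr.
  move: h1; rewrite ler_norml => /andP[h1 _].
  move: S h1; rewrite /d; move: (expR _) => e; lra.
move=> x y; rewrite ler_norml half andbT lerNl opprB.
by apply: le_trans (half _ _) _; rewrite distrC.
Qed.

(** Test covectors of norm [K + 1], one more than the Lipschitz constant of [v], give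
    [(K + 1) * D <= K * D + C * (b - a)] for the displacement [D], hence [D <= C * (b - a)]. The
    correction [eps * dotv r (g s - g a)] is controlled where the curve moves by at most 1; absolute
    continuity provides such intervals, at a scale depending on [g]. *)
Lemma minimizing_lipschitz : exists2 C : R, 0 <= C & forall x g, minimizing eps H c h v x g ->
  forall s t, s <= t -> t < 0 -> `|g t - g s| <= C * (t - s).
Proof.
have [V V0 HV] := value_bounded; have [K K0 HK] := value_lipschitz.
pose M := K + 1; have M0 : 0 < M by rewrite /M ltr_wpDl.
have cM0 : 0 <= `|c| + M by rewrite addr_ge0// ltW.
have [KH KH0 HKH] := ham_bounds HH cM0.
pose B := eps * (N * M) + KH + `|h|.
have eNM : 0 <= eps * (N * M) by rewrite !mulr_ge0// ltW.
have B0 : 0 <= B by rewrite !addr_ge0.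
have eV : 0 <= eps * V by rewrite mulr_ge0// ltW.
exists (B + eps * V); first by rewrite addr_ge0.
move=> x g gmin.
have local a b : a < b -> b < 0 -> (forall s, a <= s -> s <= b -> `|g s - g a| <= 1) ->
    `|g b - g a| <= (B + eps * V) * (b - a).
  move=> ab b0 osc.
  have ba : 0 <= eps * (b - a) by rewrite mulr_ge0 ?subr_ge0 ?ltW.
  have key r : `|r| <= M -> dotv r (g b - g a) <= K * `|g b - g a| + (B + eps * V) * (b - a).
    move=> rM.
    have L : dotv r (g b - g a) - B * (b - a) <= v (g b) - expR (- (eps * (b - a))) * v (g a).
      apply: (minimizing_lower_bound HH eps0 rep gmin ab b0) => s as' sb.
      have e1 : expR (eps * (s - b)) <= 1.
        by rewrite -expR0 ler_expR pmulr_rle0// subr_le0.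
      apply: (@le_trans _ _ (expR (eps * (s - b)) * B)); last by rewrite ler_piMl.
      apply: ler_wpM2l; first exact: expR_ge0.
      apply: lerD; last by rewrite -normrN ler_norm.
      apply: lerD.
        apply: ler_wpM2l; first exact: ltW.
        by have := dotv_ub_of rM (osc _ as' sb); rewrite mulr1.
      have [h1 _ _] := HKH (g s) (c + r) (le_trans (ler_normD _ _) (lerD (lexx _) rM)).
      exact: le_trans (ler_norm _) h1.
    have /andP[w1 w2] := expR_weight ba.
    have h1 : `|(1 - expR (- (eps * (b - a)))) * v (g a)| <= eps * (b - a) * V.
      rewrite normrM ger0_norm ?subr_ge0//; apply: ler_pM => //; first by rewrite subr_ge0.
      by rewrite lerBlDr addrC -lerBlDr.
    have h2 := le_trans (ler_norm _) (HK (g a) (g b)).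
    move: h1; rewrite ler_norml => /andP[_ h1].
    move: L h1 h2; move: (expR _) (v (g a)) (v (g b)) (dotv r _) `|g b - g a| => *; lra.
  set D := `|g b - g a| in key *; set C := B + eps * V in key *.
  have Cge : 0 <= C by exact: addr_ge0.
  have C0 : 0 <= C * (b - a) by rewrite mulr_ge0// subr_ge0 ltW.
  have DM : D <= (K * D + C * (b - a)) / M.
    apply: norm_le_coord => [|i].
      by rewrite divr_ge0 ?(ltW M0)// addr_ge0// mulr_ge0// /D.
    rewrite ler_pdivlMr// -[X in _ * X <= _](gtr0_norm M0) -normrM mulrC.
    have eM : `|M *: (evec i : 'rV[R]_n)| <= M.
      by rewrite normrZ gtr0_norm// ler_piMr ?norm_evec// ltW.
    have := key _ eM; rewrite dotvZl dotvC dotv_evec => k1.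
    have eM' : `|- (M *: (evec i : 'rV[R]_n))| <= M by rewrite normrN.
    have := key _ eM'; rewrite dotvNl dotvZl dotvC dotv_evec => k2.
    by rewrite ler_norml k1 andbT lerNl.
  move: DM; by rewrite ler_pdivlMr// /M mulrDr mulr1 [D * K]mulrC -lerBrDl addrAC subrr add0r.
move=> s t st t0.
have s0 : s < 0 by exact: le_lt_trans t0.
have ns : 0 < - s by rewrite oppr_gt0.
have [gac _] := gmin.2 _ ns; rewrite opprK in gac.
have [d d0 Hd] := abs_cont_chain (gac : abs_cont g s 0) ltr01.
have near a b : s <= a -> a <= b -> b <= t -> b - a < d -> `|g b - g a| <= 1.
  move=> sa ab bt bad; apply: ltW.
  have := Hd [:: (a, b)]; rewrite /= !big_cons !big_nil !addr0; apply => //.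
  by rewrite sa ab (le_trans bt (ltW t0)).
apply: (@lipschitz_of_local _ _ g s t d) => // a b sa; rewrite le_eqVlt.
move=> /predU1P[-> _ _|ab bt bad]; first by rewrite !subrr normr0 mulr0.
apply: local => //; first exact: le_lt_trans t0.
move=> s' as' s'b; apply: near => //; first exact: le_trans bt.
by apply: le_lt_trans bad; rewrite lerD2r.
Qed.

End value_function.

Lemma dotv_abs_of {R : realType} {n : nat} (u w : 'rV[R]_n) (B C : R) :
  `|u| <= B -> `|w| <= C -> `|dotv u w| <= n%:R * B * C.
Proof.
move=> uB wC; apply: le_trans (dotv_le _ _) _.
by apply: ler_pM; rewrite ?mulr_ge0//; apply: ler_wpM2l.
Qed.

(** * Second-order action estimates over short times *)

Section two_point.
Context {R : realType} {n : nat} (H : 'rV[R]_n -> 'rV[R]_n -> R).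
Variables (c : 'rV[R]_n) (h eps : R) (v : 'rV[R]_n -> R).
Hypothesis HH : Hamiltonian_hyp H.
Hypothesis eps0 : 0 < eps.
Hypothesis rep : forall (x : 'rV[R]_n) (T : R), 0 < T ->
  (v x)%:E = ereal_inf [set action eps H c h v g T | g in admissible x T].
Hypotheses (vcont : continuous v) (vper : Zperiodic v).
Notation Lag := (Lag H).
Notation Hp := (Hp H).
Notation Hx := (Hx H).
Notation N := (n%:R : R).

(* Cost of the segment from [ya] to [yb]; [w] is a shift common to both endpoints, kept at
   first order, and [b] bounds the deviation of the velocity from [Hp y p]. *)
Lemma two_point_upper (P D : R) : 0 <= P -> 0 <= D -> exists2 C : R, 0 <= C &
  forall y p w ya yb d b, `|p| <= P -> 0 < d -> d <= 1 -> `|w| <= 1 ->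
  `|yb - y - w| <= D * d -> `|ya - y - w| <= D * d -> b <= 1 ->
  `|d^-1 *: (yb - ya) - Hp y p| <= b ->
  v yb <= expR (- (eps * d)) * v ya + dotv (p - c) (yb - ya)
    - d * (H y p - h + dotv (Hx y p) w) + C * d * (d + b ^+ 2 + `|w| ^+ 2).
Proof.
move=> P0 D0; have [K K0 HK] := ham_bounds HH P0.
have [CL CL0 HL] := Lag_perturbed HH P0.
(* [X0] bounds the leading part [X] of the running cost, for velocities of norm at most [K + 1] and
   [|w| <= 1]; [weight_le] then charges [eps * d * X0] for the discount. *)
pose X0 := N * (P + `|c|) * (K + 1) + K + `|h| + N * K.
have Pc0 : 0 <= P + `|c| by rewrite addr_ge0.
have K10 : 0 <= K + 1 by rewrite addr_ge0.
have X00 : 0 <= X0 by rewrite /X0 !addr_ge0// !mulr_ge0.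
have eX0 : 0 <= eps * X0 by rewrite mulr_ge0// ltW.
pose C := eps * X0 + N * K * (3 * D) + CL * (2 + 2 * (3 * D) ^+ 2).
have D30 : 0 <= 3 * D by rewrite mulr_ge0.
exists C.
  by rewrite /C !addr_ge0// !mulr_ge0// addr_ge0// mulr_ge0// sqr_ge0.
move=> y p w ya yb d b pP d0 d1 w1 ybD yaD b1 etab.
set vel := d^-1 *: (yb - ya) in etab *; set eta := vel - Hp y p in etab.
have velE : vel = Hp y p + eta by rewrite /eta addrC subrK.
have eta1 : `|eta| <= 1 by exact: le_trans b1.
have b0 : 0 <= b by exact: le_trans etab.
have [hH hX hP] := HK y p pP.
have velK : `|vel| <= K + 1 by rewrite velE (le_trans (ler_normD _ _))// lerD.
pose X := dotv (p - c) vel - (H y p - h) - dotv (Hx y p) w.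
have XX0 : `|X| <= X0.
  rewrite /X /X0; apply: le_trans (ler_normB _ _) _; apply: lerD; last first.
    by have := dotv_abs_of hX w1; rewrite mulr1.
  rewrite -[X in _ <= X]addrA; apply: le_trans (ler_normB _ _) _; apply: lerD.
    by apply: dotv_abs_of => //; rewrite (le_trans (ler_normB _ _))// lerD.
  by rewrite (le_trans (ler_normB _ _))// lerD.
pose Y := N * K * (3 * D) * d + CL * (2 * `|w| ^+ 2 + 2 * (3 * D) ^+ 2 * d + b ^+ 2).
have Y0 : 0 <= Y.
  by rewrite /Y !addr_ge0// !mulr_ge0// ?(ltW d0)// !addr_ge0// ?mulr_ge0// ?sqr_ge0// ltW.
have S : v yb <= expR (- (eps * d)) * v ya + (X + eps * d * X0 + Y) * d.
  apply: (segment_upper_bound rep d0) => s ds s0.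
  rewrite -/vel.
  have es : 0 <= eps * - s by rewrite mulr_ge0 ?oppr_ge0// ltW.
  have /andP[w1' w2] := expR_weight es.
  rewrite mulrN opprK in w1' w2.
  have xd : 1 - eps * d <= expR (eps * s).
    by apply: le_trans w1'; rewrite lerD2l lerNl -mulrN ler_pM2l// lerNl.
  apply: le_trans (weight_le xd w2 (expR_ge0 _) XX0 Y0).
  apply: ler_wpM2l; first exact: expR_ge0.
  pose z := yb + s *: vel - y - w.
  have sd : `|s| <= d by rewrite ler0_norm// lerNl.
  have zD : `|z| <= 3 * D * d.
    have -> : z = (yb - y - w) + s *: vel by rewrite /z -!addrA; congr (_ + _); rewrite addrC -addrA.
    have sv : `|s *: vel| <= `|yb - ya|.
      have dn : `|d^-1| = d^-1 by rewrite gtr0_norm ?invr_gt0.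
      by rewrite normrZ /vel normrZ mulrA ler_piMl// dn ler_pdivrMr// mul1r.
    have dab : `|yb - ya| <= D * d + D * d.
      have -> : yb - ya = (yb - y - w) - (ya - y - w).
        by rewrite opprB addrA subrK opprB addrA subrK.
      by apply: le_trans (ler_normB _ _) _; apply: lerD.
    apply: le_trans (ler_normD _ _) _; apply: le_trans (lerD ybD (le_trans sv dab)) _.
    by rewrite le_eqVlt; apply/orP; left; apply/eqP; ring.
  have -> : yb + s *: vel = y + (w + z).
    by rewrite /z [w + _]addrC subrK [y + _]addrC subrK.
  have LL := HL y p (w + z) eta pP eta1; rewrite -velE dotvDr in LL.
  have q1 : `|w + z| ^+ 2 <= 2 * `|w| ^+ 2 + 2 * (3 * D) ^+ 2 * d.
    have t1 : `|w + z| ^+ 2 <= (`|w| + `|z|) ^+ 2.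
      by rewrite ler_sqr ?nnegrE ?addr_ge0// ler_normD.
    have t2 : (`|w| + `|z|) ^+ 2 <= 2 * `|w| ^+ 2 + 2 * `|z| ^+ 2.
      rewrite -subr_ge0; have -> : 2 * `|w| ^+ 2 + 2 * `|z| ^+ 2 - (`|w| + `|z|) ^+ 2 =
        (`|w| - `|z|) ^+ 2 by ring.
      exact: sqr_ge0.
    have t3 : `|z| ^+ 2 <= (3 * D) ^+ 2 * d.
      apply: (@le_trans _ _ ((3 * D * d) ^+ 2)); first by rewrite ler_sqr ?nnegrE ?mulr_ge0// ltW.
      by rewrite exprMn expr2 [d ^+ 2]expr2; apply: ler_wpM2l; rewrite ?mulr_ge0// ler_piMl// ltW.
    apply: le_trans t1 (le_trans t2 _); rewrite lerD2l -mulrA.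
    by apply: ler_wpM2l.
  have q2 : `|eta| ^+ 2 <= b ^+ 2 by rewrite ler_sqr ?nnegrE.
  have q3 : CL * (`|w + z| ^+ 2 + `|eta| ^+ 2) <=
     CL * (2 * `|w| ^+ 2 + 2 * (3 * D) ^+ 2 * d + b ^+ 2).
    by apply: ler_wpM2l => //; apply: lerD.
  have q4 : - dotv (Hx y p) z <= N * K * (3 * D) * d.
    rewrite -dotvNr -mulrA; apply: dotv_ub_of => //; by rewrite normrN.
  move: LL q3 q4; rewrite /X /Y dotvBl.
  move: (CL * _) (CL * _) (Lag _ _) (dotv (Hx y p) z) => A1 A2 A3 A4 LL q3 q4.
  move: (dotv p vel) (dotv c vel) (H y p) (dotv (Hx y p) w) (N * K * (3 * D) * d) LL q3 q4.
  clear -eps0 => *; lra.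
have XE : X * d = dotv (p - c) (yb - ya) - d * (H y p - h + dotv (Hx y p) w).
  have -> : yb - ya = d *: vel by rewrite /vel scalerA divff ?scale1r// gt_eqF.
  rewrite dotvZr /X; ring.
have SE : (X + eps * d * X0 + Y) * d = dotv (p - c) (yb - ya)
    - d * (H y p - h + dotv (Hx y p) w) + d * (eps * X0 * d + Y) by rewrite -XE; ring.
apply: le_trans S _; rewrite SE !addrA lerD2l -[leRHS]mulrA [leRHS]mulrCA.
apply: ler_wpM2l; first exact: ltW.
have dd : 0 <= d by exact: ltW.
have b2 := sqr_ge0 b; have ww := sqr_ge0 `|w|.
rewrite -subr_ge0 /C /Y.
set A := eps * X0 in eX0 *; set B := N * K * (3 * D); set E := (3 * D) ^+ 2.
have B0 : 0 <= B by rewrite !mulr_ge0.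
have E0 : 0 <= E by exact: sqr_ge0.
have -> : (A + B + CL * (2 + 2 * E)) * (d + b ^+ 2 + `|w| ^+ 2) -
  (A * d + B * d + CL * (2 * `|w| ^+ 2 + 2 * E * d + b ^+ 2)) =
  (A + B) * (b ^+ 2 + `|w| ^+ 2) + CL * (2 * d + (1 + 2 * E) * b ^+ 2 + 2 * E * `|w| ^+ 2).
  by ring.
by rewrite !addr_ge0// ?mulr_ge0// ?addr_ge0// ?mulr_ge0// ?addr_ge0// ?mulr_ge0.
Qed.

(** By the Lipschitz bound on [g], freezing the position at [g t] and the discount over [[a, b]]
    changes the integrand by a term of order [b - a]. *)
Lemma minimizing_lower (P : R) : 0 <= P -> exists2 C : R, 0 <= C &
  forall x g, minimizing eps H c h v x g -> forall a b t p, a < b -> b < 0 -> b - a <= 1 ->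
  a <= t -> t <= b -> `|p| <= P ->
  expR (- (eps * (b - a))) * v (g a) + dotv (p - c) (g b - g a)
    - (b - a) * (H (g t) p - h) - C * (b - a) ^+ 2 <= v (g b).
Proof.
move=> P0; have [K K0 HK] := ham_bounds HH P0.
have [KL KL0 HKL] := ham_lipschitz HH P.
have [Cg Cg0 HCg] := minimizing_lipschitz HH eps0 rep vcont vper.
pose Pc := P + `|c|; have Pc0 : 0 <= Pc by rewrite addr_ge0.
have ePC : 0 <= eps * (N * Pc * Cg) by rewrite !mulr_ge0// ltW.
have KC : 0 <= KL * Cg by rewrite mulr_ge0.
have eKh : 0 <= eps * (K + `|h|) by rewrite mulr_ge0 ?addr_ge0// ltW.
pose C := eps * (N * Pc * Cg) + KL * Cg + eps * (K + `|h|).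
exists C; first by rewrite !addr_ge0.
move=> x g gmin a b t p ab b0 ba1 at' tb pP; have gl := HCg x g gmin.
have ba : 0 <= b - a by rewrite subr_ge0 ltW.
have pcP : `|p - c| <= Pc by rewrite (le_trans (ler_normB _ _))// lerD.
have := minimizing_lower_bound HH eps0 rep gmin ab b0 (r := p - c)
  (B := H (g t) p - h + C * (b - a)); rewrite [c + _]addrC subrK => L.
suff L2 : dotv (p - c) (g b - g a) - (H (g t) p - h + C * (b - a)) * (b - a) <=
    v (g b) - expR (- (eps * (b - a))) * v (g a).
  move: L2; rewrite expr2; move: (expR _) => e; lra.
apply: L => s as' sb.
have es : 0 <= eps * (b - s) by rewrite mulr_ge0 ?subr_ge0// ltW.
have /andP[w1 w2] := expR_weight es.
rewrite -mulrN opprB in w1 w2.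
have xd : 1 - eps * (b - a) <= expR (eps * (s - b)).
  by apply: le_trans w1; rewrite lerD2l -mulrN opprB ler_pM2l// lerD2r.
pose X := H (g t) p - h.
have XX : `|X| <= K + `|h|.
  by have [h1 _ _] := HK (g t) p pP; rewrite (le_trans (ler_normB _ _))// lerD.
have gab u u' : a <= u -> u <= b -> a <= u' -> u' <= b -> `|g u - g u'| <= Cg * (b - a).
  wlog uu : u u' / u' <= u.
    move=> W au ub au' ub'; have [?|?] := leP u' u; first exact: W.
    by rewrite distrC; apply: W => //; exact: ltW.
  move=> au ub au' ub'; apply: le_trans (gl _ _ uu (le_lt_trans ub b0)) _.
  by apply: ler_wpM2l => //; rewrite lerB.
pose Y := eps * (N * Pc * Cg) * (b - a) + KL * Cg * (b - a).
have Y0 : 0 <= Y by rewrite addr_ge0// mulr_ge0.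
apply: (@le_trans _ _ (X + eps * (b - a) * (K + `|h|) + Y)); last first.
  by rewrite /X /Y /C le_eqVlt; apply/orP; left; apply/eqP; ring.
apply: le_trans (weight_le xd w2 (expR_ge0 _) XX Y0).
apply: ler_wpM2l; first exact: expR_ge0.
have h1 : eps * dotv (p - c) (g s - g a) <= eps * (N * Pc * Cg) * (b - a).
  rewrite -!mulrA; apply: ler_wpM2l; first exact: ltW.
  rewrite mulrA; apply: dotv_ub_of => //; apply: gab => //; exact: le_trans sb.
have [h2 _ _] := HKL (g t) p (g s) p pP pP.
have {}h2 := le_trans (ler_norm _) h2; rewrite subrr normr0 addr0 in h2.
have h3 : KL * `|g s - g t| <= KL * Cg * (b - a).
  by rewrite -mulrA; apply: ler_wpM2l => //; exact: gab.
rewrite /X /Y; move: h1 h2 h3.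
move: (eps * dotv _ _) (eps * _ * _) (KL * _ * _) (KL * _) => *; lra.
Qed.

End two_point.

(** A cluster point, expressed by approximation at arbitrarily late indices, which avoids extracting
    a subsequence. *)
Lemma bolzano_weierstrass {R : realType} {n : nat} (u : nat -> 'rV[R]_n) (B : R) :
  (forall m, `|u m| <= B) ->
  exists q, forall e M, 0 < e -> exists2 m, (M <= m)%N & `|u m - q| < e.
Proof.
move=> uB; have : (u @ \oo) [set p : 'rV[R]_n | `|p| <= B].
  by exists 0 => // m _; exact: uB.
move=> /(@compact_norm_le R n B (u @ \oo) _)[q [_ Hq]]; exists q => e M e0.
have A : (u @ \oo) [set u m | m in [set m | (M <= m)%N]].
  by exists M => // m /= Mm; exists m.
have Bq : nbhs q [set p | `|p - q| < e].
  by apply/nbhs_ballP; exists e => // p; rewrite -ball_normE/= distrC.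
by have [_ [[m /= Mm <-] mq]] := Hq _ _ A Bq; exists m.
Qed.

(** * Flatness *)

Section flat.
Context {R : realType} {n : nat} (v : 'rV[R]_n -> R).
Notation N := (n%:R : R).

(* [v] agrees with the affine function of slope [q] up to [C * mu ^+ 4] on the ball of radius
   [mu ^+ 3] around [y], that is, up to order 4/3; the parameter [mu] is the square root of the
   duration of the test segments, and avoids fractional powers. *)
Definition flat (C : R) (y q : 'rV[R]_n) := forall (mu : R) w,
  0 < mu -> mu <= 1 -> `|w| <= mu ^+ 3 -> `|v (y + w) - v y - dotv q w| <= C * mu ^+ 4.

(** The slopes at scales [mu] and [mu' >= mu / 2] both approximate [v] on the ball of radius
    [(mu / 2)^3], so they differ by at most [2 * C * mu^4 / (mu / 2)^3 = 16 * C * mu]. Summing over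
    halvings gives [32 * C * mu], hence one limit slope with an error linear in [mu]. *)
Lemma flat_of_scales (C : R) : 0 <= C -> exists2 C', 0 <= C' & forall y (r : R -> 'rV[R]_n),
  (forall mu w, 0 < mu -> mu <= 1 -> `|w| <= mu ^+ 3 ->
    `|v (y + w) - v y - dotv (r mu) w| <= C * mu ^+ 4) ->
  exists2 q, flat C' y q & forall mu, 0 < mu -> mu <= 1 -> `|r mu - q| <= C' * mu.
Proof.
move=> C0; exists (C + N * (32 * C) + 32 * C).
  by rewrite !addr_ge0// !mulr_ge0.
move=> y r Hr.
have step mu mu' : 0 < mu -> mu <= 1 -> mu / 2 <= mu' -> mu' <= mu ->
    `|r mu - r mu'| <= 16 * C * mu.
  move=> m0 m1 m2 m3; have m'0 : 0 < mu' by lra.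
  have rho0 : 0 < (mu / 2) ^+ 3 by rewrite exprn_gt0// divr_gt0.
  apply: (norm_le_dotv rho0); first by rewrite !mulr_ge0// ltW.
  move=> w w3.
  have w3' : `|w| <= mu' ^+ 3.
    by apply: le_trans w3 _; rewrite lerXn2r ?nnegrE ?divr_ge0// ltW.
  have w3'' : `|w| <= mu ^+ 3.
    by apply: le_trans w3' _; rewrite lerXn2r ?nnegrE// ltW.
  have := Hr _ _ m0 m1 w3''; have := Hr _ _ m'0 (le_trans m3 m1) w3'.
  rewrite !ler_norml => /andP[a1 a2] /andP[b1 b2].
  have m4 : C * mu' ^+ 4 <= C * mu ^+ 4.
    by apply: ler_wpM2l => //; rewrite lerXn2r ?nnegrE// ltW.
  have -> : 16 * C * mu * (mu / 2) ^+ 3 = 2 * (C * mu ^+ 4) by field.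
  rewrite dotvBl; lra.
have dist k : forall mu mu', 0 < mu -> mu <= 1 -> mu <= mu' *+ (2 ^ k) -> mu' <= mu ->
    `|r mu - r mu'| <= 32 * C * mu.
  elim: k => [|k IH] mu mu' m0 m1 mk mm.
    rewrite expn0 mulr1n in mk; have -> : mu' = mu by apply/eqP; rewrite eq_le mm.
    by rewrite subrr normr0 !mulr_ge0// ltW.
  have [h2|h2] := leP (mu / 2) mu'.
    by apply: le_trans (step _ _ m0 m1 h2 mm) _; rewrite ler_pM2r//; lra.
  have m20 : 0 < mu / 2 by rewrite divr_gt0.
  have m21 : mu / 2 <= 1 by lra.
  have mk2 : mu / 2 <= mu' *+ (2 ^ k).
    by rewrite ler_pdivrMr// mulr_natr -mulrnA -expnSr.
  have h22 : mu / 2 <= mu by lra.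
  have i1 := IH _ _ m20 m21 mk2 (ltW h2).
  have i2 := step _ _ m0 m1 (lexx _) h22.
  rewrite -(subrKA (r (mu / 2))); apply: le_trans (ler_normD _ _) _.
  by apply: le_trans (lerD i2 i1) _; rewrite le_eqVlt; apply/orP; left; apply/eqP; field.
have dist' mu mu' : 0 < mu' -> mu <= 1 -> mu' <= mu -> `|r mu - r mu'| <= 32 * C * mu.
  move=> m'0 m1 mm; have m0 := lt_le_trans m'0 mm.
  apply: (dist (Num.bound (mu / mu'))) => //.
  rewrite -mulr_natl -ler_pdivrMr//; apply: le_trans (ltW (archi_boundP _)) _.
    by rewrite divr_ge0// ltW.
  by rewrite ler_nat ltnW// ltn_expl.
pose u m := r (m.+1%:R^-1).
have i0 m : 0 < (m.+1%:R^-1 : R) by rewrite invr_gt0.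
have i1 m : (m.+1%:R^-1 : R) <= 1 by rewrite invf_le1// ler1n.
have uB m : `|u m| <= `|r 1| + 32 * C.
  have := dist' 1 _ (i0 m) (lexx _) (i1 m); rewrite mulr1 => d1.
  rewrite -[u m](subKr (r 1)); apply: le_trans (ler_normB _ _) _.
  by rewrite lerD2l.
have [q Hq] := bolzano_weierstrass uB.
have rq mu : 0 < mu -> mu <= 1 -> `|r mu - q| <= 32 * C * mu.
  move=> m0 m1; apply/ler_addgt0Pr => e e0.
  have [m Mm me] := Hq e (Num.bound mu^-1) e0.
  have mm : m.+1%:R^-1 <= mu.
    rewrite invf_ple ?posrE//; apply: le_trans (ltW (archi_boundP _)) _.
      by rewrite invr_ge0 ltW.
    by rewrite ler_nat (leq_trans Mm).
  rewrite -(subrKA (u m)); apply: le_trans (ler_normD _ _) _.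
  by apply: lerD; [exact: dist'|exact: ltW].
exists q => [mu w m0 m1 w3|mu m0 m1]; last first.
  apply: le_trans (rq _ m0 m1) _; rewrite ler_pM2r// lerDr addr_ge0// !mulr_ge0//.
have h1 := Hr _ _ m0 m1 w3; have h2 := dotv_abs_of (rq _ m0 m1) w3.
have -> : v (y + w) - v y - dotv q w =
  (v (y + w) - v y - dotv (r mu) w) + dotv (r mu - q) w by rewrite dotvBl; ring.
apply: le_trans (ler_normD _ _) _; apply: le_trans (lerD h1 h2) _.
have : 0 <= 32 * C * mu ^+ 4.
  by apply: mulr_ge0; [exact: mulr_ge0|apply: exprn_ge0; exact: ltW].
move=> z; rewrite -subr_ge0.
have -> : (C + N * (32 * C) + 32 * C) * mu ^+ 4 - (C * mu ^+ 4 + N * (32 * C * mu) * mu ^+ 3) =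
  32 * C * mu ^+ 4 by ring.
by [].
Qed.

(** At the scale [mu = |w|^(1/3)] the error is [C * mu * |w|]. *)
Lemma flat_differentiable (C : R) y q : 0 <= C -> flat C y q ->
  differentiable v y /\ grad v y = q.
Proof.
move=> C0 fl; apply: differentiable_of_approx => e e0.
have C1 : 0 < C + 1 by rewrite ltr_wpDl.
pose m0 := Num.min 1 (e / (C + 1)).
have m00 : 0 < m0 by rewrite lt_min ltr01 divr_gt0.
exists (m0 ^+ 3); first by rewrite exprn_gt0.
move=> w wm; have [->|wn0] := eqVneq w 0.
  by rewrite addr0 dotv0 !subrr !normr0 mulr0.
have w0 : 0 < `|w| by rewrite normr_gt0.
pose mu := `|w| `^ (3^-1).
have mu0 : 0 < mu by exact: powR_gt0.
have mu3 : mu ^+ 3 = `|w|.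
  by rewrite -powR_mulrn ?powR_ge0// -powRrM mulVf ?pnatr_eq0// powRr1.
have mum : mu <= m0.
  by rewrite -(ler_pXn2r (n := 3))// ?nnegrE ?(ltW mu0) ?(ltW m00)// mu3 ltW.
have mu1 : mu <= 1 by rewrite (le_trans mum)// ge_min lexx.
have w3 : `|w| <= mu ^+ 3 by rewrite mu3.
apply: le_trans (fl _ _ mu0 mu1 w3) _.
have -> : C * mu ^+ 4 = C * mu * `|w| by rewrite -mu3; ring.
apply: ler_wpM2r => //; have : mu * (C + 1) <= e.
  by rewrite -ler_pdivlMr// (le_trans mum)// ge_min lexx orbT.
by move: mu0; rewrite mulrDr mulr1 [C * mu]mulrC; lra.
Qed.

(** A modulus of continuity for the slope. The increments of [v] from [y] to [y'], from [y] to
    [y' + w] and from [y'] to [y' + w] cancel, leaving three errors [C * mu^4] against test vectors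
    of radius [mu^3 / 2]. *)
Lemma flat_dist (C : R) y q y' q' (mu : R) : 0 <= C -> flat C y q -> flat C y' q' ->
  0 < mu -> mu <= 1 -> `|y' - y| <= mu ^+ 3 / 2 -> `|q - q'| <= 6 * C * mu.
Proof.
move=> C0 fl fl' m0 m1 yy.
have mu30 : 0 < mu ^+ 3 by rewrite exprn_gt0.
have rho0 : 0 < mu ^+ 3 / 2 by rewrite divr_gt0.
apply: (norm_le_dotv rho0); first by rewrite !mulr_ge0// ltW.
move=> w wr.
have a1 : `|w| <= mu ^+ 3 by lra.
have a2 : `|y' - y| <= mu ^+ 3 by lra.
have a3 : `|y' - y + w| <= mu ^+ 3 by rewrite (le_trans (ler_normD _ _))//; lra.
have := fl _ _ m0 m1 a3; have := fl _ _ m0 m1 a2; have := fl' _ _ m0 m1 a1.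
have E2 : y + (y' - y) = y' by rewrite addrC subrK.
have E1 : y + (y' - y + w) = y' + w by rewrite addrA E2.
rewrite E1 E2 [dotv q (_ + _)]dotvDr !ler_norml dotvBl.
have -> : 6 * C * mu * (mu ^+ 3 / 2) = 3 * (C * mu ^+ 4) by field.
lra.
Qed.

Lemma flat_shift (C : R) y q k : Zperiodic v -> is_int_vec k -> flat C y q -> flat C (y + k) q.
Proof.
by move=> vper kint fl mu w m0 m1 w3; rewrite [y + k + w]addrAC (vper (y + w) _ kint) (vper y _ kint); exact: fl.
Qed.

Section lipschitz.
Variable K : R.
Hypothesis (K0 : 0 <= K) (vK : forall x y, `|v y - v x| <= K * `|y - x|).

Lemma flat_slope_le (C : R) y q : 0 <= C -> flat C y q -> `|q| <= K + C.
Proof.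
move=> C0 fl; apply: (@norm_le_dotv _ _ q 1) => //; first exact: addr_ge0.
move=> w w1; have w3 : `|w| <= 1 ^+ 3 by rewrite expr1n.
have := fl 1 w ltr01 (lexx _) w3; rewrite expr1n mulr1 ler_norml => /andP[h1 _].
have := le_trans (ler_norm _) (vK y (y + w)); rewrite [y + w - y]addrAC subrr add0r => h2.
have : K * `|w| <= K by rewrite ler_piMr.
lra.
Qed.

Lemma flat_limit (C : R) y q :
  (forall e, 0 < e -> exists y' q', [/\ flat C y' q', `|y' - y| < e & `|q' - q| < e]) ->
  flat C y q.
Proof.
move=> Hl mu w m0 m1 w3; apply/ler_addgt0Pr => e e0.
have KN : 0 < 2 * K + N + 1 by rewrite ltr_wpDl// addr_ge0// mulr_ge0.
have [y' [q' [fl yy qq]]] := Hl (e / (2 * K + N + 1)) (divr_gt0 e0 KN).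
set d := e / _ in yy qq; have d0 : 0 < d by rewrite divr_gt0.
have h1 := fl _ _ m0 m1 w3.
have h2 := vK (y + w) (y' + w); have h3 := vK y y'.
rewrite [y' + w]addrC [y + w]addrC opprD addrACA subrr add0r in h2.
have w1 : `|w| <= 1 by rewrite (le_trans w3)// exprn_ile1// ltW.
have h4 := dotv_abs_of (ltW qq) w1; rewrite mulr1 in h4.
have Kd : K * `|y' - y| <= K * d by rewrite ler_wpM2l// ltW.
have de : d * (2 * K + N + 1) = e by rewrite /d divfK// gt_eqF.
move: h1 h2 h3 h4 Kd; rewrite dotvBl [w + y]addrC [w + y']addrC !ler_norml -de.
move: (dotv _ _) (dotv _ _) (v _) (v _) (v _) (v _) (K * `|_|) => *; lra.
Qed.

(** The slopes are bounded by [K + C], so they cluster, and flatness with a fixed [C] passes to the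
    limit. *)
Lemma flat_closure (C : R) y : 0 <= C ->
  (forall e, 0 < e -> exists y' q', flat C y' q' /\ `|y' - y| < e) ->
  exists q, flat C y q.
Proof.
move=> C0 Hl.
have /choice[f Hf] : forall m : nat, exists z : 'rV[R]_n * 'rV[R]_n,
    flat C z.1 z.2 /\ `|z.1 - y| < m.+1%:R^-1.
  move=> m; have m0 : 0 < (m.+1%:R^-1 : R) by rewrite invr_gt0.
  by have [y' [q' yq]] := Hl _ m0; exists (y', q').
have fB m : `|(f m).2| <= K + C by have [fl _] := Hf m; exact: flat_slope_le C0 fl.
have [q Hq] := bolzano_weierstrass fB; exists q; apply: flat_limit => e e0.
have [m Mm me] := Hq e (Num.bound e^-1) e0.
exists (f m).1, (f m).2; have [fl ym] := Hf m; split => //; apply: lt_le_trans ym _.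
rewrite invf_ple ?posrE//; apply: le_trans (ltW (archi_boundP _)) _.
  by rewrite invr_ge0 ltW.
by rewrite ler_nat (leq_trans Mm).
Qed.

End lipschitz.
End flat.

Lemma flat_le {R : realType} {n : nat} (v : 'rV[R]_n -> R) (C C' : R) y q :
  C <= C' -> flat v C y q -> flat v C' y q.
Proof.
move=> CC fl mu w m0 m1 w3; apply: le_trans (fl _ _ m0 m1 w3) _.
by apply: ler_wpM2r => //; apply: exprn_ge0; exact: ltW.
Qed.

(** * Flatness of the value function along a minimizer *)

Section regularity.
Context {R : realType} {n : nat} (H : 'rV[R]_n -> 'rV[R]_n -> R).
Variables (c : 'rV[R]_n) (h eps : R) (v : 'rV[R]_n -> R).
Hypothesis HH : Hamiltonian_hyp H.
Hypothesis eps0 : 0 < eps.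
Hypothesis rep : forall (x : 'rV[R]_n) (T : R), 0 < T ->
  (v x)%:E = ereal_inf [set action eps H c h v g T | g in admissible x T].
Hypotheses (vcont : continuous v) (vper : Zperiodic v).
Notation Hp := (Hp H).
Notation Hx := (Hx H).
Notation N := (n%:R : R).

(** [p] and [p'] are the covectors dual to the mean velocities before and after [t]. Displacing an
    end by [w] over the duration [d = mu^2] changes the velocity by at most [mu], so
    [two_point_upper] applies with [b = mu] and error of order [mu^4]. The bound [t <= -2] ensures
    [t + mu^2 < 0]. *)
Lemma minimizing_one_sided : exists A P : R, [/\ 0 <= A, 0 <= P &
  forall x g, minimizing eps H c h v x g -> forall t mu, t <= -2 -> 0 < mu -> mu <= 1 ->
  exists p p', [/\ `|p| <= P /\ `|p'| <= P,
    Hp (g t) p = (mu ^+ 2)^-1 *: (g t - g (t - mu ^+ 2)),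
    Hp (g t) p' = (mu ^+ 2)^-1 *: (g (t + mu ^+ 2) - g t) &
    forall w, `|w| <= mu ^+ 3 ->
      dotv (p' - c) w - A * mu ^+ 4 <= v (g t + w) - v (g t) <=
      dotv (p - c) w + A * mu ^+ 4]].
Proof.
have [Cg Cg0 HCg] := minimizing_lipschitz HH eps0 rep vcont vper.
have [K K0 HK] := value_lipschitz HH eps0 rep vcont vper.
have [P P0 HP] := legendre_surj HH Cg0.
have D0 : 0 <= Cg + 1 by rewrite addr_ge0.
have [CU CU0 HU] := two_point_upper HH eps0 rep P0 D0.
have [CL CL0 HL] := minimizing_lower HH eps0 rep vcont vper P0.
have eK : 0 <= eps * K by rewrite mulr_ge0// ltW.
exists (2 * CU + CL + eps * K), P; split => //; first by rewrite !addr_ge0// mulr_ge0.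
move=> x g gmin t mu t2 m0 m1.
have gl := HCg x g gmin; set d := mu ^+ 2.
have d0 : 0 < d by rewrite exprn_gt0.
have d1 : d <= 1 by rewrite exprn_ile1// ltW.
have td0 : t + d < 0 by lra.
have t0 : t < 0 by lra.
have d_le (a b : 'rV[R]_n) : `|b - a| <= Cg * d -> `|d^-1 *: (b - a)| <= Cg.
  by move=> ba; rewrite normrZ gtr0_norm ?invr_gt0// mulrC ler_pdivrMr.
have E1 : t - (t - d) = d by ring.
have E2 : t + d - t = d by ring.
have n1 : `|g t - g (t - d)| <= Cg * d.
  by have := gl (t - d) t; rewrite E1; apply => //; lra.
have n2 : `|g (t + d) - g t| <= Cg * d.
  by have := gl t (t + d); rewrite E2; apply => //; lra.
have [p pP pE] := HP (g t) _ (d_le _ _ n1).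
have [p' p'P p'E] := HP (g t) _ (d_le _ _ n2).
exists p, p'; split => // w w3.
have wd : `|w| <= d.
  by apply: le_trans w3 _; rewrite /d exprS ler_piMl// sqr_ge0.
have n00 : `|0 : 'rV[R]_n| <= 1 by rewrite normr0.
have dw : `|d^-1 *: w| <= mu.
  by rewrite normrZ gtr0_norm ?invr_gt0// mulrC ler_pdivrMr.
have Cgd : 0 <= Cg * d by rewrite mulr_ge0// ltW.
have m4 : d * d = mu ^+ 4 by rewrite /d -exprD.
have erd : CU * d * (d + mu ^+ 2 + `|0 : 'rV[R]_n| ^+ 2) = 2 * CU * mu ^+ 4.
  by rewrite normr0 expr0n addr0 -/d -m4; ring.
apply/andP; split.
- have e1 : `|g (t + d) - g t - 0| <= (Cg + 1) * d.
    by rewrite subr0 (le_trans n2)// mulrDl mul1r lerDl ltW.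
  have e2 : `|g t + w - g t - 0| <= (Cg + 1) * d.
    by rewrite subr0 [g t + w]addrC addrK (le_trans wd)// mulrDl mul1r lerDr.
  have e3 : `|d^-1 *: (g (t + d) - (g t + w)) - Hp (g t) p'| <= mu.
    rewrite p'E -scalerBr opprD addrA [_ - w - _]addrAC subrr add0r.
    by rewrite scalerN normrN.
  have := HU _ _ _ _ _ _ _ p'P d0 d1 n00 e1 e2 m1 e3; rewrite erd dotv0 addr0 => U.
  have := HL x g gmin t (t + d) t p'; rewrite E2.
  have tt : t < t + d by rewrite ltrDl.
  move=> /(_ tt td0 d1 (lexx _) (ltW tt) p'P); rewrite expr2 m4 => L.
  have E : dotv (p' - c) (g (t + d) - (g t + w)) =
    dotv (p' - c) (g (t + d) - g t) - dotv (p' - c) w.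
    by rewrite -dotvBr opprD [g (t + d) + _]addrA.
  rewrite E in U.
  have ed0 : 0 <= eps * d by rewrite mulr_ge0// ltW.
  have /andP[w1 w2] := expR_weight ed0.
  (* Here the segment starts at the displaced point, so the increment of [v] appears discounted;
     since [|w| <= d], undoing the discount costs [eps * K * d^2]. *)
  have vK := HK (g t) (g t + w); rewrite [g t + w - _]addrAC subrr add0r in vK.
  have z : `|(1 - expR (- (eps * d))) * (v (g t + w) - v (g t))| <= eps * K * mu ^+ 4.
    rewrite normrM ger0_norm ?subr_ge0// -m4.
    have -> : eps * K * (d * d) = eps * d * (K * d) by ring.
    apply: ler_pM => //; first by rewrite subr_ge0.
      by rewrite lerBlDr addrC -lerBlDr.
    by apply: le_trans vK _; apply: ler_wpM2l.
  move: z; rewrite ler_norml => /andP[z1 z2].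
  move: U L z1 z2; move: (expR _) (v (g t + w)) (v (g t)) (v (g (t + d))) => e v1 v2 v3.
  move: (dotv _ _) (dotv _ _) (d * _) (mu ^+ 4) => *; lra.
- have e1 : `|g t + w - g t - 0| <= (Cg + 1) * d.
    by rewrite subr0 [g t + w]addrC addrK (le_trans wd)// mulrDl mul1r lerDr.
  have e2 : `|g (t - d) - g t - 0| <= (Cg + 1) * d.
    by rewrite subr0 distrC (le_trans n1)// mulrDl mul1r lerDl ltW.
  have e3 : `|d^-1 *: (g t + w - g (t - d)) - Hp (g t) p| <= mu.
    rewrite pE -scalerBr (_ : _ - _ = w)//.
    by rewrite opprB addrA subrK [g t + w]addrC addrK.
  have := HU _ _ _ _ _ _ _ pP d0 d1 n00 e1 e2 m1 e3; rewrite erd dotv0 addr0 => U.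
  have := HL x g gmin (t - d) t t p; rewrite E1.
  have tt : t - d < t by rewrite ltrBlDr ltrDl.
  move=> /(_ tt t0 d1 (ltW tt) (lexx _) pP); rewrite expr2 m4 => L.
  have E : dotv (p - c) (g t + w - g (t - d)) =
    dotv (p - c) (g t - g (t - d)) + dotv (p - c) w.
    by rewrite -dotvDr [g t + w - _]addrAC.
  rewrite E in U.
  have z : 0 <= eps * K * mu ^+ 4 by rewrite mulr_ge0// exprn_ge0// ltW.
  move: U L z; move: (expR _ * _) (v (g t + w)) (v (g t)) => e v1 v2.
  move: (dotv _ _) (dotv _ _) (d * _) (mu ^+ 4) => *; lra.
Qed.

(** The lower and upper bounds hold for all small [w], which forces [p] and [p'] to agree up to
    [2 * A * mu]. Hence [p - c] is a two-sided slope at scale [mu], and [flat_of_scales] removes the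
    dependence on [mu]. *)
Lemma minimizing_flat : exists2 C : R, 0 <= C & forall x g, minimizing eps H c h v x g ->
  forall t, t <= -2 -> exists q, flat v C (g t) q /\ forall mu, 0 < mu -> mu <= 1 ->
    `|(mu ^+ 2)^-1 *: (g t - g (t - mu ^+ 2)) - Hp (g t) (c + q)| <= C * mu /\
    `|(mu ^+ 2)^-1 *: (g (t + mu ^+ 2) - g t) - Hp (g t) (c + q)| <= C * mu.
Proof.
have [A [P [A0 P0 HA]]] := minimizing_one_sided.
have [K K0 HK] := value_lipschitz HH eps0 rep vcont vper.
pose A' := A + N * (2 * A).
have A'0 : 0 <= A' by rewrite addr_ge0// !mulr_ge0.
have [C' C'0 HC'] := flat_of_scales v A'0.
have [KL KL0 HL] := ham_lipschitz HH (P + `|c| + (K + C')).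
exists (C' + KL * (2 * A + C')); first by rewrite addr_ge0// mulr_ge0// addr_ge0// mulr_ge0.
move=> x g gmin t t2.
have /choice[pf Hpf] : forall mu : R, exists pp : 'rV[R]_n * 'rV[R]_n, 0 < mu -> mu <= 1 ->
  [/\ `|pp.1| <= P /\ `|pp.2| <= P,
    Hp (g t) pp.1 = (mu ^+ 2)^-1 *: (g t - g (t - mu ^+ 2)),
    Hp (g t) pp.2 = (mu ^+ 2)^-1 *: (g (t + mu ^+ 2) - g t) &
    forall w, `|w| <= mu ^+ 3 ->
      dotv (pp.2 - c) w - A * mu ^+ 4 <= v (g t + w) - v (g t) <=
      dotv (pp.1 - c) w + A * mu ^+ 4].
  move=> mu; have [m0|m0] := ltP 0 mu; last by exists (0, 0).
  have [m1|m1] := leP mu 1; last by exists (0, 0).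
  by have [p [p' Hpp]] := HA x g gmin t mu t2 m0 m1; exists (p, p').
have pp mu : 0 < mu -> mu <= 1 -> `|(pf mu).2 - (pf mu).1| <= 2 * A * mu.
  move=> m0 m1; have [_ _ _ Hw] := Hpf mu m0 m1.
  have m30 : 0 < mu ^+ 3 by rewrite exprn_gt0.
  apply: (norm_le_dotv m30); first by rewrite !mulr_ge0// ltW.
  move=> w w3; have /andP[h1 h2] := Hw _ w3; have := le_trans h1 h2.
  have -> : 2 * A * mu * mu ^+ 3 = 2 * (A * mu ^+ 4) by ring.
  rewrite !dotvBl; lra.
have [mu w m0 m1 w3|q fl Hq] := HC' (g t) (fun mu => (pf mu).1 - c).
  have [_ _ _ /(_ w w3)/andP[h1 h2]] := Hpf mu m0 m1.
  have := dotv_abs_of (pp mu m0 m1) w3; rewrite ler_norml => /andP[h3 h4].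
  have NA : 0 <= N * (2 * A) by rewrite !mulr_ge0.
  have z : 0 <= N * (2 * A) * mu ^+ 4 by rewrite mulr_ge0// exprn_ge0// ltW.
  have e1 : N * (2 * A * mu) * mu ^+ 3 = N * (2 * A) * mu ^+ 4 by ring.
  rewrite e1 !dotvBl in h3 h4; rewrite /A' ler_norml [_ * mu ^+ 4]mulrDl.
  move: h1 h2 h3 h4 z; rewrite !dotvBl.
  move: (dotv _ _) (dotv _ _) (dotv _ _) (v _) (v _) (N * _ * _) (A * _) => *.
  by apply/andP; split; lra.
have qB : `|q| <= K + C' := flat_slope_le K0 HK C'0 fl.
have z1 : 0 <= KL * (2 * A + C') by rewrite mulr_ge0// addr_ge0// mulr_ge0.
exists q; split; first by apply: flat_le fl; rewrite lerDl.
move=> mu m0 m1; have [[p1P p2P] p1E p2E _] := Hpf mu m0 m1.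
have cq : `|c + q| <= P + `|c| + (K + C').
  by rewrite (le_trans (ler_normD _ _))//; apply: lerD => //; rewrite lerDr.
have KC0 : 0 <= K + C' by rewrite addr_ge0.
have b1 : `|(pf mu).1| <= P + `|c| + (K + C').
  by rewrite (le_trans p1P)// -addrA lerDl addr_ge0.
have b2 : `|(pf mu).2| <= P + `|c| + (K + C').
  by rewrite (le_trans p2P)// -addrA lerDl addr_ge0.
have d1 : `|(pf mu).1 - (c + q)| <= C' * mu by rewrite opprD addrA; exact: Hq.
have d2 : `|(pf mu).2 - (c + q)| <= (2 * A + C') * mu.
  rewrite -(subrKA (pf mu).1) mulrDl (le_trans (ler_normD _ _))//.
  by apply: lerD => //; exact: pp.
have [_ _ h1] := HL (g t) _ (g t) _ cq b1.
have [_ _ h2] := HL (g t) _ (g t) _ cq b2.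
rewrite subrr normr0 add0r in h1; rewrite subrr normr0 add0r in h2.
have C'm : 0 <= C' * mu by rewrite mulr_ge0// ltW.
have A2m : 0 <= 2 * A * mu by rewrite !mulr_ge0// ltW.
rewrite -p1E -p2E mulrDl; split.
- apply: le_trans h1 _; apply: (@le_trans _ _ (KL * (2 * A + C') * mu)); last by rewrite lerDr.
  by rewrite -mulrA; apply: ler_wpM2l => //; rewrite mulrDl (le_trans d1)// lerDr.
- apply: le_trans h2 _; apply: (@le_trans _ _ (KL * (2 * A + C') * mu)); last by rewrite lerDr.
  by rewrite -mulrA; apply: ler_wpM2l.
Qed.

End regularity.

(** * The Hamiltonian system along a minimizer *)

Lemma is_derive_of_bound {R : realType} {V : normedModType R} (f : R -> V) (t : R) (l : V) :
  (forall e, 0 < e -> exists2 d, 0 < d & forall k, k != 0 -> `|k| < d ->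
     `|k^-1 *: (f (t + k) - f t) - l| <= e) ->
  is_derive t (1 : R) f l.
Proof.
move=> Hf; suff L : (k^-1 *: (f (k *: (1 : R) + t) - f t)) @[k --> (0 : R)^'] --> l.
  by apply: DeriveDef; [apply/cvg_ex; eexists; exact: L|exact: (cvg_lim _ L)].
apply/cvgrPdist_le => e e0; have [d d0 Hd] := Hf e e0; near=> k.
rewrite distrC [k *: _]mulr1 [k + t]addrC; apply: Hd.
  by near: k; exact: nbhs_dnbhs_neq.
by near: k; exact: dnbhs0_lt.
Unshelve. all: by end_near. Qed.

(** On a uniform partition of step [d] the errors [C * d^2] add up to [C * (b - a) * d], which
    vanishes with [d]. *)
Lemma le_of_local_increments {R : realType} (f : R -> R) (a b d0 m C : R) :
  a < b -> 0 < d0 -> 0 <= C ->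
  (forall s d, a <= s -> 0 < d -> d <= d0 -> s + d <= b -> f (s + d) - f s <= d * (m + C * d)) ->
  f b - f a <= m * (b - a).
Proof.
move=> ab d00 C0 Hf; have ba : 0 < b - a by rewrite subr_gt0.
suff key k : (b - a) / k.+1%:R <= d0 ->
    f b - f a <= (b - a) * (m + C * ((b - a) / k.+1%:R)).
  apply/ler_addgt0Pr => e e0.
  pose M := Num.bound ((b - a) / d0 + C * (b - a) ^+ 2 / e).
  have x0 : 0 <= (b - a) / d0 by rewrite divr_ge0// ltW.
  have y0 : 0 <= C * (b - a) ^+ 2 / e by rewrite divr_ge0 ?mulr_ge0 ?sqr_ge0// ltW.
  have hM : (b - a) / d0 + C * (b - a) ^+ 2 / e < M.+1%:R.
    by apply: lt_trans (archi_boundP _) _; rewrite ?addr_ge0// ltr_nat.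
  have M0 : 0 < M.+1%:R :> R by [].
  have h1 : (b - a) / M.+1%:R <= d0.
    rewrite ler_pdivrMr// [d0 * _]mulrC -ler_pdivrMr//; apply/ltW; apply: le_lt_trans hM.
    by rewrite lerDl.
  apply: le_trans (key _ h1) _.
  have h2 : C * (b - a) ^+ 2 / M.+1%:R <= e.
    rewrite ler_pdivrMr// [e * _]mulrC -ler_pdivrMr//; apply/ltW; apply: le_lt_trans hM.
    by rewrite lerDr.
  have -> : (b - a) * (m + C * ((b - a) / M.+1%:R)) =
     m * (b - a) + C * (b - a) ^+ 2 / M.+1%:R by rewrite expr2; field; lra.
  by rewrite lerD2l.
set d := (b - a) / _ => dd; have d1 : 0 < d by rewrite divr_gt0.
have dE : d *+ k.+1 = b - a by rewrite /d -mulr_natr divfK// pnatr_eq0.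
have H j : (j <= k.+1)%N -> f (a + d *+ j) - f a <= (d *+ j) * (m + C * d).
  elim: j => [|j IH] jk; first by rewrite mulr0n addr0 subrr mul0r.
  have j1 : a <= a + d *+ j by rewrite lerDl mulrn_wge0// ltW.
  have j2 : a + d *+ j + d <= b.
    by rewrite -addrA -mulrSr -lerBrDl -dE -[leLHS]mulr_natl -[leRHS]mulr_natl ler_wpM2r ?(ltW d1)// ler_nat.
  have := Hf _ _ j1 d1 dd j2; have := IH (ltnW jk).
  rewrite mulrSr addrA [(_ + d) * _]mulrDl; move: (_ * _) (_ * _) => *; lra.
by have := H k.+1 (leqnn _); rewrite dE [a + _]addrC subrK.
Qed.

Lemma expR_dist {R : realType} (x y : R) : x <= 0 -> y <= 0 -> `|expR x - expR y| <= `|x - y|.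
Proof.
wlog xy : x y / x <= y.
  move=> W x0 y0; have [?|?] := leP x y; first exact: W.
  by rewrite distrC [leRHS]distrC; apply: W => //; exact: ltW.
move=> x0 y0; have yx : 0 <= y - x by rewrite subr_ge0.
have /andP[w1 w2] := expR_weight yx.
have -> : expR x = expR y * expR (- (y - x)) by rewrite -expRD; congr expR; ring.
have ey : expR y <= 1 by rewrite -expR0 ler_expR.
have ey0 : 0 <= expR y by exact: expR_ge0.
rewrite distrC [leRHS]distrC [leRHS]ger0_norm// -[X in `|X - _|]mulr1 -mulrBr normrM.
rewrite (ger0_norm ey0) ger0_norm ?subr_ge0//.
have : 0 <= 1 - expR (- (y - x)) by rewrite subr_ge0.
move=> z; apply: (@le_trans _ _ (1 * (1 - expR (- (y - x))))); first exact: ler_wpM2r.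
by rewrite mul1r lerBlDr addrC -lerBlDr.
Qed.

Lemma scaler_telescope {R : pzRingType} {V : lmodType R} (a b : R) (u w : V) :
  a *: u - b *: w = b *: (u - w) + (a - b) *: u.
Proof. by rewrite scalerBr scalerBl [RHS]addrC subrKA. Qed.

Section hamiltonian_flow.
Context {R : realType} {n : nat} (H : 'rV[R]_n -> 'rV[R]_n -> R).
Variables (c : 'rV[R]_n) (h eps : R) (v : 'rV[R]_n -> R).
Hypothesis HH : Hamiltonian_hyp H.
Hypothesis eps0 : 0 < eps.
Hypothesis rep : forall (x : 'rV[R]_n) (T : R), 0 < T ->
  (v x)%:E = ereal_inf [set action eps H c h v g T | g in admissible x T].
Hypotheses (vcont : continuous v) (vper : Zperiodic v).
Notation Hp := (Hp H).
Notation Hx := (Hx H).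
Notation N := (n%:R : R).

(** The competitor is the chord of the minimizer translated by [w]. Subtracting the lower bound for
    the minimizer leaves, to first order, the variation of [H] in [x]. The condition [d <= d0]
    ensures [C1 * mu <= 1] for [mu = sqrt d], as [two_point_upper] requires of the velocity
    deviation. *)
Lemma minimizing_shift_step (C1 : R) : 0 <= C1 -> exists C d0 : R, [/\ 0 <= C, 0 < d0 &
  forall x g, minimizing eps H c h v x g -> forall t q d w, flat v C1 (g t) q ->
  (forall mu : R, 0 < mu -> mu <= 1 ->
    `|(mu ^+ 2)^-1 *: (g (t + mu ^+ 2) - g t) - Hp (g t) (c + q)| <= C1 * mu) ->
  t <= -2 -> 0 < d -> d <= d0 -> `|w| <= 1 ->
  (v (g (t + d) + w) - v (g (t + d))) - expR (- (eps * d)) * (v (g t + w) - v (g t)) <=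
  d * (- dotv (Hx (g t) (c + q)) w + C * (`|w| ^+ 2 + d))].
Proof.
move=> C10.
have [Cg Cg0 HCg] := minimizing_lipschitz HH eps0 rep vcont vper.
have [K K0 HK] := value_lipschitz HH eps0 rep vcont vper.
pose P := `|c| + (K + C1).
have P0 : 0 <= P by rewrite !addr_ge0.
have [CU CU0 HU] := two_point_upper HH eps0 rep P0 Cg0.
have [CL CL0 HL] := minimizing_lower HH eps0 rep vcont vper P0.
have C11 : 0 < C1 + 1 by rewrite ltr_wpDl.
pose d0 := ((C1 + 1) ^+ 2)^-1.
have d00 : 0 < d0 by rewrite invr_gt0 exprn_gt0.
have CC : 0 <= CU * (1 + C1 ^+ 2) by rewrite mulr_ge0// addr_ge0// sqr_ge0.
exists (CU * (1 + C1 ^+ 2) + CL), d0; split => //; first by rewrite addr_ge0.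
move=> x g gmin t q d w fl Hr t2 dp dd w1.
pose mu := Num.sqrt d.
have mu2 : mu ^+ 2 = d by rewrite sqr_sqrtr// ltW.
have mu0 : 0 < mu by rewrite sqrtr_gt0.
have muC : mu * (C1 + 1) <= 1.
  rewrite -ler_pdivlMr// mul1r -(ler_pXn2r (n := 2))// ?nnegrE ?invr_ge0 ?(ltW mu0) ?(ltW C11)//.
  by rewrite mu2 exprVn.
have mC1 : 0 <= mu * C1 by rewrite mulr_ge0// ltW.
have mu1 : mu <= 1 by move: muC mC1; rewrite mulrDr mulr1; lra.
have C1mu : C1 * mu <= 1 by move: muC mC1; rewrite mulrDr mulr1 [C1 * mu]mulrC; move: mu0; lra.
have d1 : d <= 1 by rewrite -mu2 exprn_ile1// ltW.
have qB := flat_slope_le K0 HK C10 fl.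
have pP : `|c + q| <= P by rewrite (le_trans (ler_normD _ _))// lerD2l.
have td0 : t + d < 0 by lra.
have E2 : t + d - t = d by ring.
have gl := HCg x g gmin t (t + d); rewrite E2 in gl.
have tt : t < t + d by rewrite ltrDl.
have {}gl := gl (ltW tt) td0.
have e1 : `|g (t + d) + w - g t - w| <= Cg * d.
  by rewrite [g (t + d) + w - _]addrAC addrK.
have e2 : `|g t + w - g t - w| <= Cg * d.
  by rewrite [g t + w - _]addrAC subrr add0r subrr normr0 mulr_ge0// ltW.
have e3 : `|d^-1 *: (g (t + d) + w - (g t + w)) - Hp (g t) (c + q)| <= C1 * mu.
  rewrite opprD addrACA subrr addr0 -mu2; exact: Hr.
have U := HU _ _ _ _ _ _ _ pP dp d1 w1 e1 e2 C1mu e3.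
have L := HL x g gmin t (t + d) t (c + q) tt td0; rewrite E2 in L.
have {}L := L d1 (lexx _) (ltW tt) pP.
have cq : c + q - c = q by rewrite addrC addKr.
rewrite cq in U L.
have gw : g (t + d) + w - (g t + w) = g (t + d) - g t by rewrite opprD addrACA subrr addr0.
rewrite gw exprMn mu2 in U.
have z : 0 <= CU * C1 ^+ 2 * d * `|w| ^+ 2 + CL * d * `|w| ^+ 2.
  have dd0 := ltW dp.
  by rewrite addr_ge0// !mulr_ge0// ?sqr_ge0.
move: U L z; rewrite expr2.
move: (expR _) (v _) (v _) (v _) (v _) (dotv _ _) (dotv _ _) (H _ _) => e v1 v2 v3 v4 D1 D2 H0.
move: (`|w| ^+ 2) => W *; lra.
Qed.

Section along_minimizer.
Variables (C1 : R) (x : 'rV[R]_n) (g q : R -> 'rV[R]_n).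
Hypotheses (C10 : 0 <= C1) (gmin : minimizing eps H c h v x g).
Hypothesis gq : forall t : R, t <= -2 -> flat v C1 (g t) (q t) /\
   forall mu : R, 0 < mu -> mu <= 1 ->
    `|(mu ^+ 2)^-1 *: (g t - g (t - mu ^+ 2)) - Hp (g t) (c + q t)| <= C1 * mu /\
    `|(mu ^+ 2)^-1 *: (g (t + mu ^+ 2) - g t) - Hp (g t) (c + q t)| <= C1 * mu.
Let X t := Hx (g t) (c + q t).

Lemma minimizing_derive (t : R) : t <= -2 -> is_derive t (1 : R) g (Hp (g t) (c + q t)).
Proof.
have C11 : 0 < C1 + 1 by rewrite ltr_wpDl.
move=> t2; have [fl Hr] := gq t2.
apply: is_derive_of_bound => e e0.
pose m0 := Num.min 1 (e / (C1 + 1)).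
have m00 : 0 < m0 by rewrite lt_min ltr01 divr_gt0.
exists (m0 ^+ 2); first by rewrite exprn_gt0.
move=> k k0 km; pose mu := Num.sqrt `|k|.
have mu2 : mu ^+ 2 = `|k| by rewrite sqr_sqrtr.
have mu0 : 0 < mu by rewrite sqrtr_gt0 normr_gt0.
have mum : mu <= m0.
  by rewrite -(ler_pXn2r (n := 2))// ?nnegrE ?(ltW mu0) ?(ltW m00)// mu2 ltW.
have mu1 : mu <= 1 by rewrite (le_trans mum)// ge_min lexx.
have Cmu : C1 * mu <= e.
  have : mu * (C1 + 1) <= e by rewrite -ler_pdivlMr// (le_trans mum)// ge_min lexx orbT.
  by move: mu0; rewrite mulrDr mulr1 [C1 * mu]mulrC; lra.
have [h1 h2] := Hr mu mu0 mu1; rewrite mu2 in h1 h2.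
have [kp|kn] := leP 0 k; first by rewrite ger0_norm// in h2; exact: le_trans h2 Cmu.
rewrite ltr0_norm// opprK in h1; apply: le_trans Cmu; apply: le_trans h1.
by rewrite invrN scaleNr -scalerN opprB.
Qed.

Lemma slope_bounded : exists2 P : R, 0 <= P & forall t : R, t <= -2 -> `|c + q t| <= P.
Proof.
have [K K0 HK] := value_lipschitz HH eps0 rep vcont vper.
exists (`|c| + (K + C1)); first by rewrite !addr_ge0.
move=> t t2; have [fl _] := gq t2.
by rewrite (le_trans (ler_normD _ _))// lerD2l (flat_slope_le K0 HK C10 fl).
Qed.

(** The slope is continuous along [g] by [flat_dist]; [t < -3] keeps times within distance 1 below
    [-2], where slopes are available. *)
Lemma Hx_along_continuous (t e : R) : t < -3 -> 0 < e -> exists2 d : R, 0 < d &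
  forall s : R, `|s - t| < d -> s <= -2 /\ `|X s - X t| <= e.
Proof.
move=> t3 e0.
have [Cg Cg0 HCg] := minimizing_lipschitz HH eps0 rep vcont vper.
have [P P0 HP] := slope_bounded.
have [KL KL0 HL] := ham_lipschitz HH P.
have a1 : 0 < 2 * (KL * (6 * C1) + 1) by rewrite mulr_gt0// ltr_wpDl// !mulr_ge0.
have a2 : 0 < 2 * (Cg + 1) by rewrite mulr_gt0// ltr_wpDl.
have a3 : 0 < 2 * (KL * Cg + 1) by rewrite mulr_gt0// ltr_wpDl// mulr_ge0.
pose mu := Num.min 1 (e / (2 * (KL * (6 * C1) + 1))).
have mu0 : 0 < mu by rewrite lt_min ltr01 divr_gt0.
have mu1 : mu <= 1 by rewrite ge_min lexx.
have mue : mu * (2 * (KL * (6 * C1) + 1)) <= e.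
  by rewrite -ler_pdivlMr// ge_min lexx orbT.
exists (Num.min 1 (Num.min (mu ^+ 3 / (2 * (Cg + 1))) (e / (2 * (KL * Cg + 1))))).
  by rewrite !lt_min ltr01 !divr_gt0// exprn_gt0.
move=> s; rewrite !lt_min => /andP[s1 /andP[s2 s3]].
have sle : s <= -2 by move: s1; rewrite ltr_norml; lra.
split => //; have t2 : t <= -2 by lra.
have gst : `|g s - g t| <= Cg * `|s - t|.
  have gl := HCg x g gmin; have [st|ts] := leP s t.
    by rewrite distrC [`|s - t|]distrC (ger0_norm (_ : 0 <= t - s)) ?subr_ge0// gl//; lra.
  by rewrite (ger0_norm (_ : 0 <= s - t)) ?subr_ge0 ?(ltW ts)// gl ?(ltW ts)//; lra.
rewrite ltr_pdivlMr// in s2; rewrite ltr_pdivlMr// in s3.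
have st0 := normr_ge0 (s - t).
have gmu : `|g s - g t| <= mu ^+ 3 / 2.
  apply: le_trans gst _; move: s2 st0; move: `|s - t| (mu ^+ 3) => *; lra.
have qst := flat_dist C10 (proj1 (gq t2)) (proj1 (gq sle)) mu0 mu1 gmu.
have [_ h1 _] := HL (g t) _ (g s) _ (HP _ t2) (HP _ sle).
apply: le_trans h1 _; rewrite opprD addrACA subrr add0r -normrN opprB [`|q s - q t|]distrC.
rewrite [`|g t - g s|]distrC mulrDr.
have b1 : KL * `|g s - g t| <= KL * (Cg * `|s - t|) by apply: ler_wpM2l.
have b2 : KL * `|q t - q s| <= KL * (6 * C1 * mu) by apply: ler_wpM2l.
move: b1 b2 mue s3 mu0 st0; move: (KL * `|_|) (KL * `|_|) `|s - t| => *; lra.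
Qed.

(* [q] itself is only known through increments of [v] around [g], to precision [O(mu^4)] at
   distance [mu^3]: the increments of [w |-> exp (eps s) (v (g s + w) - v (g s))] between [a]
   and [b] are first summed over infinitesimal steps for fixed [w], and only then [mu] goes
   to [0]. *)
Lemma slope_increment (t e : R) : t < -3 -> 0 < e -> exists2 d : R, 0 < d &
  forall a b, a < b -> `|a - t| < d -> `|b - t| < d ->
  `|expR (eps * b) *: q b - expR (eps * a) *: q a + (b - a) *: (expR (eps * t) *: X t)|
  <= e * (b - a).
Proof.
move=> t3 e0.
have [P P0 HP] := slope_bounded; have [KX KX0 HKX] := ham_bounds HH P0.
have [C2 [d0 [C20 d00 Hst]]] := minimizing_shift_step C10.
have N1 : 0 < 2 * (N + 1) by rewrite mulr_gt0// ltr_wpDl.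
have eK : 0 < eps * KX + 1 by rewrite ltr_wpDl// mulr_ge0// ltW.
have eN : 0 < e / (2 * (N + 1)) by rewrite divr_gt0.
have [r r0 Hr] := Hx_along_continuous t3 eN.
exists (Num.min r (e / (2 * (N + 1)) / (eps * KX + 1))).
  by rewrite lt_min r0 !divr_gt0.
move=> a b ab; rewrite !lt_min => /andP[ar a2] /andP[br b2].
set rho := _ / (eps * KX + 1) in a2 b2.
have itv s : a <= s -> s <= b -> `|s - t| < r /\ `|s - t| < rho.
  move=> as' sb; move: ar a2 br b2; rewrite !ltr_norml => *.
  by split; apply/andP; split; lra.
have rhoE : rho * (eps * KX + 1) = e / (2 * (N + 1)) by rewrite /rho divfK// gt_eqF.
have t2 : t <= -2 by lra.
have en0 : e / (2 * (N + 1)) * (2 * (N + 1)) = e by rewrite divfK// gt_eqF.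
(* Over [[a, b]] the linear coefficient in the increments stays close to its value at [t]; the
   changes of [X] and of the discount each take half of the error. *)
have ebound s s' : a <= s -> s <= b -> a <= s' -> s' <= b ->
    forall w, expR (eps * s') * - dotv (X s) w <= - (expR (eps * t) * dotv (X t) w) + e * `|w|.
  move=> as' sb as2 s'b w.
  have [sr _] := itv _ as' sb; have [_ s'rho] := itv _ as2 s'b.
  have [s2 HX] := Hr _ sr; have [s'2 _] := Hr _ (itv _ as2 s'b).1.
  have [_ hX _] := HKX (g t) _ (HP _ t2).
  have es'0 : eps * s' <= 0 by rewrite pmulr_rle0//; lra.
  have et0 : eps * t <= 0 by rewrite pmulr_rle0//; lra.
  have ed := expR_dist es'0 et0; rewrite -mulrBr normrM (gtr0_norm eps0) in ed.
  have es1 : expR (eps * s') <= 1 by rewrite -expR0 ler_expR.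
  have V1 : `|expR (eps * t) *: X t - expR (eps * s') *: X s| <= e / (N + 1).
    have -> : expR (eps * t) *: X t - expR (eps * s') *: X s =
      expR (eps * s') *: (X t - X s) + (expR (eps * t) - expR (eps * s')) *: X t.
      exact: scaler_telescope.
    apply: le_trans (ler_normD _ _) _; rewrite [X in X + _]normrZ [X in _ + X]normrZ.
    have -> : e / (N + 1) = e / (2 * (N + 1)) + e / (2 * (N + 1)).
      by field; rewrite gt_eqF// ltr_wpDl.
    apply: lerD.
      rewrite ger0_norm ?expR_ge0// distrC; apply: le_trans HX.
      by rewrite ler_piMl.
    rewrite distrC; apply: (@le_trans _ _ (eps * rho * KX)).
      apply: ler_pM => //; apply: le_trans ed _; rewrite ler_pM2l//; exact: ltW.
    have -> : e / (2 * (N + 1)) = eps * rho * KX + rho by rewrite -rhoE; ring.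
    rewrite lerDl.
    by apply: ltW; exact: le_lt_trans s'rho.
  have V2 := dotv_ub_of V1 (lexx `|w|); rewrite dotvBl !dotvZl in V2.
  have V3 : N * (e / (N + 1)) * `|w| <= e * `|w|.
    apply: ler_wpM2r => //; rewrite mulrA ler_pdivrMr ?ltr_wpDl// mulrC ler_pM2l//.
    by rewrite lerDl.
  move: V2 V3; rewrite mulrN; move: (expR _ * _) (expR _ * _) => *; lra.
have ba : 0 < b - a by rewrite subr_gt0.
(* The shift estimate bounds increments from above only; this suffices because [- w0] is a test
   vector whenever [w0] is. *)
apply: (@norm_le_dotv _ _ _ 1) => //; first by rewrite mulr_ge0 ?ltW.
move=> w0 w01; rewrite mulr1.
have main mu : 0 < mu -> mu <= 1 ->
   dotv (expR (eps * b) *: q b - expR (eps * a) *: q a + (b - a) *: (expR (eps * t) *: X t)) w0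
   <= e * (b - a) + (C2 * (b - a) + 2 * C1) * mu.
  move=> mu0 mu1; pose w := mu ^+ 3 *: w0.
  have m30 : 0 < mu ^+ 3 by rewrite exprn_gt0.
  have w3 : `|w| <= mu ^+ 3 by rewrite normrZ gtr0_norm// ler_piMr// ltW.
  have w1 : `|w| <= 1 by rewrite (le_trans w3)// exprn_ile1// ltW.
  pose f s := expR (eps * s) * (v (g s + w) - v (g s)).
  have inc : f b - f a <=
      (- (expR (eps * t) * dotv (X t) w) + e * `|w| + C2 * `|w| ^+ 2) * (b - a).
    apply: (le_of_local_increments ab d00 C20) => s d as' dp dd sdb.
    have sb : s <= b by apply: le_trans sdb; rewrite lerDl ltW.
    have asd : a <= s + d by rewrite (le_trans as')// lerDl ltW.
    have [s2 _] := Hr _ (itv _ as' sb).1; have [sd2 _] := Hr _ (itv _ asd sdb).1.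
    have [fl Hq] := gq s2.
    have st := Hst x g gmin s (q s) d w fl (fun mu m0 m1 => proj2 (Hq mu m0 m1)) s2 dp dd w1.
    have es1 : expR (eps * (s + d)) <= 1 by rewrite -expR0 ler_expR pmulr_rle0//; lra.
    have -> : f (s + d) - f s = expR (eps * (s + d)) * ((v (g (s + d) + w) - v (g (s + d))) -
        expR (- (eps * d)) * (v (g s + w) - v (g s))).
      rewrite /f [RHS]mulrBr; congr (_ - _); rewrite mulrA -expRD; congr (expR _ * _); ring.
    apply: le_trans (ler_wpM2l (expR_ge0 _) st) _; rewrite mulrCA; apply: ler_wpM2l.
      exact: ltW.
    rewrite mulrDr.
    have h1 := ebound s (s + d) as' sb asd sdb w.
    have h2 : expR (eps * (s + d)) * (C2 * (`|w| ^+ 2 + d)) <= C2 * `|w| ^+ 2 + C2 * d.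
      by rewrite -mulrDr ler_piMl// mulr_ge0// addr_ge0 ?sqr_ge0// ltW.
    by apply: le_trans (lerD h1 h2) _; rewrite !addrA.
  have eb1 : expR (eps * b) <= 1.
    have [b2' _] := Hr _ br; by rewrite -expR0 ler_expR pmulr_rle0//; lra.
  have ea1 : expR (eps * a) <= 1.
    have [a2' _] := Hr _ ar; by rewrite -expR0 ler_expR pmulr_rle0//; lra.
  have C1mu : 0 <= C1 * mu ^+ 4 by rewrite mulr_ge0// exprn_ge0// ltW.
  have fb : expR (eps * b) * dotv (q b) w - C1 * mu ^+ 4 <= f b.
    have [fl _] := gq (Hr _ br).1; have := fl _ _ mu0 mu1 w3; rewrite ler_norml => /andP[h1 _].
    have h2 : expR (eps * b) * (dotv (q b) w - C1 * mu ^+ 4) <= f b.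
      by apply: ler_wpM2l; [exact: expR_ge0|move: h1; lra].
    apply: le_trans h2; rewrite mulrBr lerD2l lerN2; exact: ler_piMl.
  have fa : f a <= expR (eps * a) * dotv (q a) w + C1 * mu ^+ 4.
    have [fl _] := gq (Hr _ ar).1; have := fl _ _ mu0 mu1 w3; rewrite ler_norml => /andP[_ h1].
    have h2 : f a <= expR (eps * a) * (dotv (q a) w + C1 * mu ^+ 4).
      by apply: ler_wpM2l; [exact: expR_ge0|move: h1; lra].
    apply: le_trans h2 _; rewrite mulrDr lerD2l; exact: ler_piMl.
  have ew : e * `|w| <= e * mu ^+ 3 by rewrite ler_pM2l.
  have ww : C2 * `|w| ^+ 2 <= C2 * (mu * mu ^+ 3).
    apply: ler_wpM2l => //; apply: (@le_trans _ _ ((mu ^+ 3) ^+ 2)).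
      by rewrite ler_sqr ?nnegrE// ltW.
    rewrite expr2; apply: ler_wpM2r; first exact: ltW.
    by rewrite exprS ler_piMr ?(ltW mu0)// exprn_ile1// ltW.
  rewrite -(ler_pM2l m30) dotvDl dotvBl !dotvZl.
  have iw : (e * `|w| + C2 * `|w| ^+ 2) * (b - a) <= (e * mu ^+ 3 + C2 * (mu * mu ^+ 3)) * (b - a).
    by apply: ler_wpM2r; [exact: ltW|exact: lerD].
  rewrite /w !dotvZr -/w in fa fb inc.
  have m4 : mu ^+ 4 = mu * mu ^+ 3 by rewrite exprS.
  rewrite m4 in fa fb.
  move: inc fa fb iw; move: (mu ^+ 3) (f a) (f b) => M fa fb.
  move: (e * `|w|) (C2 * _ ^+ 2) => W1 W2.
  move: (expR _) (expR _) (expR _) => E1 E2 E3; move: (dotv _ _) (dotv _ _) (dotv _ _) => *.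
  lra.
have C20' : 0 < C2 * (b - a) + 2 * C1 + 1 by rewrite ltr_wpDl// addr_ge0// mulr_ge0// ltW.
apply/ler_addgt0Pr => e' e'0.
pose mu := Num.min 1 (e' / (C2 * (b - a) + 2 * C1 + 1)).
have mu0 : 0 < mu by rewrite lt_min ltr01 divr_gt0.
have mu1 : mu <= 1 by rewrite ge_min lexx.
apply: le_trans (main mu mu0 mu1) _; rewrite lerD2l.
have : mu * (C2 * (b - a) + 2 * C1 + 1) <= e' by rewrite -ler_pdivlMr// ge_min lexx orbT.
by move: mu0; rewrite mulrDr mulr1 [_ * mu]mulrC; move: (mu * _) => *; lra.
Qed.

(** [slope_increment] differentiates [expR (eps * s) * q s]; multiplying back by [expR (- eps * s)]
    produces the damping term [- eps * q]. *)
Lemma slope_derive (t : R) i : t < -3 ->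
  is_derive t (1 : R) (fun s => q s 0 i) ((- X t - eps *: q t) 0 i).
Proof.
move=> t3; pose f s := expR (eps * s) * q s 0 i.
have fD : is_derive t (1 : R) f (- (expR (eps * t) * X t 0 i)).
  apply: is_derive_of_bound => e e0; have [d d0 Hd] := slope_increment t3 e0.
  exists d => // k k0 kd.
  have bnd a b : a < b -> `|a - t| < d -> `|b - t| < d ->
     `|f b - f a + (b - a) * (expR (eps * t) * X t 0 i)| <= e * (b - a).
    move=> ab ad bd; apply: le_trans (Hd a b ab ad bd).
    by apply: le_trans (coord_le_norm _ i); rewrite !mxE.
  have tt : `|t - t| < d by rewrite subrr normr0.
  have tk : `|t + k - t| < d by rewrite [t + k - t]addrAC subrr add0r.
  rewrite -[_ - - _]/(_ + - - _) opprK /GRing.scale /=.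
  have -> : k^-1 * (f (t + k) - f t) + expR (eps * t) * X t 0 i =
    k^-1 * (f (t + k) - f t + k * (expR (eps * t) * X t 0 i)) by field; exact: k0.
  rewrite normrM normfV ler_pdivrMl ?normr_gt0// [leRHS]mulrC.
  have [kp|kn|/eqP] := ltgtP 0 k; last by rewrite eq_sym (negbTE k0).
    have := bnd t (t + k); rewrite ltrDl => /(_ kp tt tk).
    by rewrite [t + k - t]addrAC subrr add0r (gtr0_norm kp).
  have := bnd (t + k) t; rewrite gtrDl => /(_ kn tk tt).
  rewrite opprD addNKr (ltr0_norm kn) -normrN.
  by congr (`|_| <= _); ring.
have eD : is_derive t (1 : R) (fun s => expR (- eps * s)) (- eps * expR (- eps * t)).
  exact: is_derive_expR_lin.
have := is_deriveM eD fD.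
have -> : ((fun s : R => expR (- eps * s)) * f)%R = (fun s => q s 0 i).
  by apply/funext => s; rewrite -[LHS]/(expR (- eps * s) * (expR (eps * s) * q s 0 i)) mulrA -expRD mulNr addNr expR0 mul1r.
move=> D; apply: (is_derive_eq D); rewrite /f /GRing.scale /=.
have E : expR (- eps * t) * expR (eps * t) = 1 by rewrite -expRD mulNr addNr expR0.
rewrite [RHS]mxE [(- X t) 0 i]mxE [(- (eps *: q t)) 0 i]mxE [(eps *: q t) 0 i]mxE.
transitivity (- (expR (- eps * t) * expR (eps * t)) * X t 0 i -
  eps * (expR (- eps * t) * expR (eps * t)) * q t 0 i); first by ring.
by rewrite E; ring.
Qed.

End along_minimizer.

Lemma minimizing_hamiltonian : exists2 C : R, 0 <= C &
  forall x g, minimizing eps H c h v x g -> exists q : R -> 'rV[R]_n, forall t : R, t < -3 ->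
  [/\ flat v C (g t) (q t),
      is_derive t (1 : R) g (Hp (g t) (c + q t)) &
      forall i, is_derive t (1 : R) (fun s => q s 0 i) ((- Hx (g t) (c + q t) - eps *: q t) 0 i)].
Proof.
have [C1 C10 HC1] := minimizing_flat HH eps0 rep vcont vper.
exists C1 => // x g gmin.
have /choice[q Hq] : forall t : R, exists q, t <= -2 -> flat v C1 (g t) q /\
   forall mu : R, 0 < mu -> mu <= 1 ->
    `|(mu ^+ 2)^-1 *: (g t - g (t - mu ^+ 2)) - Hp (g t) (c + q)| <= C1 * mu /\
    `|(mu ^+ 2)^-1 *: (g (t + mu ^+ 2) - g t) - Hp (g t) (c + q)| <= C1 * mu.
  move=> t; have [t2|t2] := leP t (-2); last by exists 0.
  by have [q Hq] := HC1 x g gmin t t2; exists q.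
exists q => t t3; have t2 : t <= -2 by lra.
split; first by have [] := Hq t t2.
  exact: (minimizing_derive C10 Hq t2).
by move=> i; exact: (slope_derive C10 gmin Hq).
Qed.

End hamiltonian_flow.

(** * Solutions starting in the limit set *)

Lemma is_derive_sqr {R : realType} (f : R -> R) (t df : R) :
  is_derive t (1 : R) f df -> is_derive t (1 : R) (fun s => f s ^+ 2) (2 * f t * df).
Proof.
move=> D; apply: (is_derive_eq (is_deriveM D D)).
by rewrite /GRing.scale /=; ring.
Qed.

Lemma gronwall_right {R : realType} (E dE : R -> R) (S C : R) : 0 <= S ->
  (forall t, 0 <= t -> t <= S -> is_derive t (1 : R) E (dE t) /\ dE t <= C * E t) ->
  E S <= expR (C * S) * E 0.
Proof.
move=> S0 HE.
pose F s := expR (- C * s) * E s; pose dF s := expR (- C * s) * (dE s - C * E s).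
have D t : t \in `[0, S] -> is_derive t (1 : R) F (dF t).
  rewrite in_itv/= => /andP[t0 tS]; have [ED _] := HE t t0 tS.
  apply: (is_derive_eq (is_deriveM (is_derive_expR_lin (- C) t) ED)).
  by rewrite /dF /GRing.scale /=; ring.
have Fc : {within `[0, S], continuous F}.
  by apply: derivable_within_continuous => t tS; have [] := D t tS.
have [t tS] := MVT_segment S0 (fun t tS => D t (subset_itv_oo_cc tS)) Fc.
rewrite /F /dF mulr0 expR0 mul1r subr0 => Eq.
have [_ Et] : is_derive t (1 : R) E (dE t) /\ dE t <= C * E t.
  by move: tS; rewrite in_itv/= => /andP[? ?]; exact: HE.
have h : expR (- C * S) * E S <= E 0.
  by rewrite -subr_le0 Eq mulr_le0_ge0// mulr_ge0_le0 ?expR_ge0 ?subr_le0.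
have := ler_wpM2l (expR_ge0 (C * S)) h.
by rewrite mulrA -expRD mulNr addrN expR0 mul1r.
Qed.

(** Invariance is claimed for all real times, hence both directions; negative times follow by time
    reversal, for which [dE] must be bounded in absolute value. *)
Lemma gronwall {R : realType} (E dE : R -> R) (S C : R) :
  (forall t, `|t| <= S -> is_derive t (1 : R) E (dE t) /\ `|dE t| <= C * E t) ->
  forall t, `|t| <= S -> E t <= expR (C * `|t|) * E 0.
Proof.
move=> HE t tS; have [t0|t0] := leP 0 t.
  rewrite ger0_norm//; apply: (@gronwall_right _ _ dE) => // s s0 st.
  have [|D B] := HE s; first by rewrite ger0_norm// (le_trans st)// -(ger0_norm t0).
  by split => //; exact: le_trans (ler_norm _) B.
have tn : 0 <= - t by rewrite oppr_ge0 ltW.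
have := @gronwall_right _ (fun s => E (- s)) (fun s => - dE (- s)) (- t) C tn.
rewrite oppr0 opprK (ltr0_norm t0); apply=> s s0 st.
have [|D B] := HE (- s); first by rewrite normrN ger0_norm// (le_trans st)// -(ltr0_norm t0).
split; last by rewrite (le_trans (ler_norm _))// normrN.
have ND : is_derive s (1 : R) (fun r : R => - r) (- 1) by exact: is_deriveN.
by apply: (is_derive_eq (is_derive1_comp D ND)); rewrite mulrN1.
Qed.

Lemma is_derive_dotv_self {R : realType} {n : nat} (d : R -> 'rV[R]_n) (t : R) (dd : 'rV[R]_n) :
  (forall i, is_derive t (1 : R) (fun s => d s 0 i) (dd 0 i)) ->
  is_derive t (1 : R) (fun s => dotv (d s) (d s)) (2 * dotv (d t) dd).
Proof.
move=> D; have := is_derive_sum (fun i => is_derive_sqr (D i)).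
have -> : (\sum_(i < n) (fun s => d s 0 i ^+ 2)) = (fun s => dotv (d s) (d s)).
  by apply/funext => s; rewrite fct_sumE; apply: eq_bigr => i _; rewrite expr2.
move=> DD; apply: (is_derive_eq DD); rewrite /dotv mulr_sumr.
by apply: eq_bigr => i _; rewrite mulrA.
Qed.

Lemma energy_bound {R : realFieldType} (N K eps a b : R) : 0 <= N -> 0 <= K -> 0 <= eps ->
  2 * (N * a * (K * (a + b))) + 2 * (N * b * (K * (a + b) + eps * b)) <=
  2 * N * (2 * K + eps) * (a ^+ 2 + b ^+ 2).
Proof.
move=> N0 K0 e0; rewrite -subr_ge0.
have -> : 2 * N * (2 * K + eps) * (a ^+ 2 + b ^+ 2) -
   (2 * (N * a * (K * (a + b))) + 2 * (N * b * (K * (a + b) + eps * b))) =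
   2 * N * (K * (a - b) ^+ 2 + eps * a ^+ 2) by ring.
by apply: mulr_ge0; [rewrite mulr_ge0|rewrite addr_ge0// mulr_ge0// sqr_ge0].
Qed.

(** * Stability of the discounted Hamiltonian flow *)

Section discounted_flow.
Context {R : realType} {n : nat} (H : 'rV[R]_n -> 'rV[R]_n -> R).
Variables (c : 'rV[R]_n) (eps : R).
Hypothesis HH : Hamiltonian_hyp H.
Hypothesis eps0 : 0 < eps.
Notation Hp := (Hp H).
Notation Hx := (Hx H).
Notation N := (n%:R : R).

(** Here [p] stands for [c + q], so the second equation is [q' = - Hx - eps q]. *)
Definition discounted_flow (x p : R -> 'rV[R]_n) (t : R) := forall i,
  is_derive t (1 : R) (fun s => x s 0 i) (Hp (x t) (p t) 0 i) /\
  is_derive t (1 : R) (fun s => p s 0 i) ((- Hx (x t) (p t) - eps *: (p t - c)) 0 i).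

(** Gronwall is applied to the Euclidean energy of the difference, as the sup norm is not
    differentiable. It gives a factor [b] on squares, and [b <= (1 + b)^2 = B^2] spares a square
    root. *)
Lemma discounted_flow_dist (P S : R) : exists2 B : R, 0 <= B & forall x p z r,
  (forall t, `|t| <= S ->
    [/\ `|p t| <= P, `|r t| <= P, discounted_flow x p t & discounted_flow z r t]) ->
  forall t e, `|t| <= S -> `|x 0 - z 0| <= e -> `|p 0 - r 0| <= e ->
  `|x t - z t| <= B * e /\ `|p t - r t| <= B * e.
Proof.
have [K K0 HK] := ham_lipschitz HH P.
pose C := 2 * N * (2 * K + eps).
have C0 : 0 <= C by rewrite !mulr_ge0// addr_ge0 ?mulr_ge0// ltW.
pose B := 1 + expR (C * S) * (2 * N).
have B0 : 0 <= expR (C * S) * (2 * N) by rewrite !mulr_ge0// expR_ge0.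
have B1 : 0 <= B by rewrite addr_ge0.
exists B => // x p z r Hf t e tS x0 p0.
pose X s := x s - z s; pose Y s := p s - r s.
pose A s := Hp (x s) (p s) - Hp (z s) (r s).
pose D s := (- Hx (x s) (p s) - eps *: (p s - c)) - (- Hx (z s) (r s) - eps *: (r s - c)).
pose E s := dotv (X s) (X s) + dotv (Y s) (Y s).
have Elb s : `|X s| ^+ 2 + `|Y s| ^+ 2 <= E s by rewrite lerD// norm_sqr_le_dotv.
have HE s : `|s| <= S -> is_derive s (1 : R) E (2 * dotv (X s) (A s) + 2 * dotv (Y s) (D s)) /\
    `|2 * dotv (X s) (A s) + 2 * dotv (Y s) (D s)| <= C * E s.
  move=> sS; have [pP rP fx fz] := Hf s sS; split.
    apply: is_deriveD; apply: is_derive_dotv_self => i.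
      have [Dx _] := fx i; have [Dz _] := fz i.
      have -> : (fun s => X s 0 i) = (fun s => x s 0 i) - (fun s => z s 0 i).
        by apply/funext => u; rewrite coordB.
      by apply: (is_derive_eq (is_deriveB Dx Dz)); rewrite coordB.
    have [_ Dx] := fx i; have [_ Dz] := fz i.
    have -> : (fun s => Y s 0 i) = (fun s => p s 0 i) - (fun s => r s 0 i).
      by apply/funext => u; rewrite coordB.
    by apply: (is_derive_eq (is_deriveB Dx Dz)); rewrite [RHS]coordB.
  have [_ hX hP] := HK (z s) (r s) (x s) (p s) rP pP.
  rewrite -/(X s) -/(Y s) -/(A s) in hX hP.
  have hD : `|D s| <= K * (`|X s| + `|Y s|) + eps * `|Y s|.
    have -> : D s = - (Hx (x s) (p s) - Hx (z s) (r s)) - eps *: Y s.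
      rewrite /D opprD opprK !opprB; apply/rowP => i; rewrite !mxE; ring.
    apply: le_trans (ler_normB _ _) _; rewrite normrN.
    have -> : `|eps *: Y s| = eps * `|Y s| by rewrite normrZ gtr0_norm.
    rewrite lerD2r; exact: hX.
  apply: (@le_trans _ _ (2 * (N * `|X s| * (K * (`|X s| + `|Y s|))) +
      2 * (N * `|Y s| * (K * (`|X s| + `|Y s|) + eps * `|Y s|)))).
    apply: le_trans (ler_normD _ _) _; rewrite !normrM (ger0_norm (ler0n R 2)).
    by apply: lerD; rewrite ler_pM2l//; apply: le_trans (dotv_le _ _) _;
      apply: ler_wpM2l => //; rewrite mulr_ge0.
  apply: (@le_trans _ _ (C * (`|X s| ^+ 2 + `|Y s| ^+ 2))); last exact: ler_wpM2l.
  exact: (energy_bound _ _ (ler0n R n) K0 (ltW eps0)).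
have G := gronwall HE tS.
have e0 : 0 <= e by apply: le_trans x0.
have E0 : E 0 <= 2 * N * e ^+ 2.
  have -> : 2 * N * e ^+ 2 = N * e ^+ 2 + N * e ^+ 2 by ring.
  by apply: lerD; apply: le_trans (dotv_self_le _) _; rewrite ler_wpM2l// ler_sqr ?nnegrE.
have Et : E t <= (B * e) ^+ 2.
  apply: (le_trans G); apply: (@le_trans _ _ (expR (C * S) * (2 * N * e ^+ 2))).
    apply: ler_pM => //; rewrite ?expR_ge0// ?addr_ge0 ?dotv_ge0//.
    by rewrite ler_expR ler_wpM2l.
  rewrite exprMn mulrA ler_wpM2r ?sqr_ge0// /B; move: B0; move: (_ * (2 * N)) => b b0.
  by rewrite expr2; nra.
have Be : 0 <= B * e by rewrite mulr_ge0.
have H0 := le_trans (Elb t) Et; split.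
  rewrite -ler_sqr ?nnegrE//; apply: le_trans H0; rewrite lerDl; exact: sqr_ge0.
rewrite -ler_sqr ?nnegrE//; apply: le_trans H0; rewrite lerDr; exact: sqr_ge0.
Qed.

End discounted_flow.

Lemma alpha_limit_near {R : realType} {n : nat} (g : R -> 'rV[R]_n) y (e T : R) :
  alpha_limit g y -> 0 < e -> exists t k, [/\ t < T, is_int_vec k & `|g t + k - y| < e].
Proof.
move=> [tau [k [/cvgrNyPlt/(_ T) tauT [kint /cvgrPdist_lt/(_ e) L]]]] e0.
have [j /= [tj gj]] : exists j, tau j < T /\ `|y - (g (tau j) + k j)| < e.
  apply: (@filter_ex _ \oo); near=> j; split; near: j; [exact: tauT|exact: L].
by exists (tau j), (k j); split => //; rewrite distrC.
Unshelve. all: by end_near. Qed.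

Lemma closure_near {R : realType} {V : normedModType R} (A : set V) y (e : R) :
  closure A y -> 0 < e -> exists2 z, A z & `|z - y| < e.
Proof.
move=> Ay e0; have [z [Az]] := Ay _ (nbhsx_ballx y e e0).
by rewrite -ball_normE /= distrC => zy; exists z.
Qed.

Lemma near_closure {R : realType} {V : normedModType R} (A : set V) y :
  (forall e : R, 0 < e -> exists2 z, A z & `|z - y| <= e) -> closure A y.
Proof.
move=> Ay B /nbhs_ballP[e /= e0 eB].
have [z Az zy] := Ay (e / 2) (divr_gt0 e0 (ltr0Sn _ _)).
exists z; split => //; apply: eB; rewrite -ball_normE /= distrC (le_lt_trans zy)//.
by rewrite ltr_pdivrMr// ltr_pMr// ltr1n.
Qed.

Lemma vec_eq_of_dist {R : realType} {V : normedModType R} (x y : V) (C : R) : 0 <= C ->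
  (forall mu : R, 0 < mu -> mu <= 1 -> `|x - y| <= C * mu) -> x = y.
Proof.
move=> C0 Hxy; apply/eqP; rewrite -subr_eq0 -normr_le0; apply/ler_addgt0Pr => e e0.
have C1 : 0 < C + 1 by rewrite ltr_wpDl.
pose mu := Num.min 1 (e / (C + 1)).
have mu0 : 0 < mu by rewrite lt_min ltr01 divr_gt0.
have mu1 : mu <= 1 by rewrite ge_min lexx.
have : mu * (C + 1) <= e by rewrite -ler_pdivlMr// ge_min lexx orbT.
have := Hxy mu mu0 mu1; move: `|_| mu0 => a mu0; lra.
Qed.

Lemma discounted_flow_shift {R : realType} {n : nat} (H : 'rV[R]_n -> 'rV[R]_n -> R)
    (HH : Hamiltonian_hyp H) c eps (g p : R -> 'rV[R]_n) (t s : R) k : is_int_vec k ->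
  discounted_flow H c eps g p (t + s) ->
  discounted_flow H c eps (fun r => g (t + r) + k) (fun r => p (t + r)) s.
Proof.
move=> kint D i; have [Dg Dp] := D i; rewrite (Hp_periodic HH)// (Hx_periodic HH)//.
have T : is_derive s (1 : R) (fun r : R => t + r) 1.
  by apply: (is_derive_eq (is_deriveD (is_derive_cst t s 1) (is_derive_id s 1))); rewrite add0r.
split; last by apply: (is_derive_eq (is_derive1_comp Dp T)); rewrite mulr1.
have -> : (fun r => (g (t + r) + k) 0 i) =
    ((fun r => g r 0 i) \o (fun r => t + r)) + (fun => k 0 i).
  by apply/funext => r; rewrite mxE.
apply: (is_derive_eq (is_deriveD (is_derive1_comp Dg T) (is_derive_cst (k 0 i) s 1))).
by rewrite addr0 mulr1.
Qed.

Lemma is_derive_coord {R : realType} {n : nat} (g : R -> 'rV[R]_n) (s : R) i :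
  derivable g s 1 -> is_derive s (1 : R) (fun t => g t 0 i) ('D_1 g s 0 i).
Proof.
move=> gd; have := is_derive_dotv (evec i) gd; rewrite dotvC dotv_evec.
suff -> : (fun t => dotv (evec i) (g t)) = (fun t => g t 0 i) by [].
by apply/funext => t; rewrite dotvC dotv_evec.
Qed.

(** By surjectivity of the Legendre map the velocity is [Hp (x s) p] for some [p], and there [Lxi]
    is [p] and [Lx] is [- Hx]. *)
Lemma discounted_flow_of_EL {R : realType} {n : nat} (H : 'rV[R]_n -> 'rV[R]_n -> R)
    (HH : Hamiltonian_hyp H) c eps (x : R -> 'rV[R]_n) (s : R) :
  derivable x s 1 ->
  derivable (fun r => Lxi H (x r) ('D_1 x r)) s 1 ->
  'D_1 (fun r => Lxi H (x r) ('D_1 x r)) s =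
    Lx H (x s) ('D_1 x s) - eps *: Lxi H (x s) ('D_1 x s) + eps *: c ->
  discounted_flow H c eps x (fun r => Lxi H (x r) ('D_1 x r)) s.
Proof.
move=> xd pd pE i.
have [P P0 /(_ (x s) _ (lexx _))[p _ pH]] := legendre_surj HH (normr_ge0 ('D_1 x s)).
have -> : Lxi H (x s) ('D_1 x s) = p by rewrite -pH Lxi_Hp.
rewrite pH; split; first exact: is_derive_coord.
apply: (is_derive_eq (is_derive_coord i pd)).
by rewrite pE -pH Lxi_Hp// Lx_Hp// scalerBr opprB addrA addrAC.
Qed.

(** * Regularity and invariance of the limit set *)

Section limit_set.
Context {R : realType} {n : nat} (H : 'rV[R]_n -> 'rV[R]_n -> R).
Variables (c : 'rV[R]_n) (h eps : R) (v : 'rV[R]_n -> R).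
Hypothesis HH : Hamiltonian_hyp H.
Hypothesis eps0 : 0 < eps.
Hypothesis rep : forall (x : 'rV[R]_n) (T : R), 0 < T ->
  (v x)%:E = ereal_inf [set action eps H c h v g T | g in admissible x T].
Hypotheses (vcont : continuous v) (vper : Zperiodic v).
Notation Hp := (Hp H).
Notation Hx := (Hx H).
Notation M := (Malpha eps H c h v).
Variable C : R.
Hypothesis C0 : 0 <= C.
Hypothesis HC : forall x g, minimizing eps H c h v x g ->
  exists q : R -> 'rV[R]_n, forall t : R, t < -3 ->
  [/\ flat v C (g t) (q t),
      is_derive t (1 : R) g (Hp (g t) (c + q t)) &
      forall i, is_derive t (1 : R) (fun s => q s 0 i) ((- Hx (g t) (c + q t) - eps *: q t) 0 i)].

Lemma Malpha_near y e T : M y -> 0 < e -> exists x g y',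
  [/\ minimizing eps H c h v x g, alpha_limit g y', `|y' - y| < e &
      exists t k, [/\ t < T, is_int_vec k & `|g t + k - y'| < e]].
Proof.
move=> My e0; have [y' [x [g [gmin gy']]] yy'] := closure_near My e0.
by exists x, g, y'; split => //; exact: alpha_limit_near.
Qed.

Lemma Malpha_flat y : M y -> exists q, flat v C y q.
Proof.
have [K K0 HK] := value_lipschitz HH eps0 rep vcont vper.
move=> My; apply: (flat_closure K0 HK C0) => e e0.
have [|x [g [y' [gmin _ yy' [t [k [t3 kint gy']]]]]]] := @Malpha_near y (e / 2) (- 3) My.
  by rewrite divr_gt0.
have [q Hq] := HC gmin; have [fl _ _] := Hq t t3.
exists (g t + k), (q t); split; first exact: flat_shift.
rewrite -(subrKA y') (splitr e); apply: le_lt_trans (ler_normD _ _) _; exact: ltrD.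
Qed.


(** By [flat_dist] the slopes at [g (tau j)] converge to the gradient at [y], so the relation
    [g' = Hp (g, c + q)] passes to the limit. *)
Lemma Malpha_velocity x g y xi : minimizing eps H c h v x g ->
  (exists (tau : nat -> R) (k : nat -> 'rV[R]_n),
     tau @ \oo --> -oo /\ (forall j, is_int_vec (k j)) /\
     (forall j, derivable g (tau j) 1) /\
     (fun j => g (tau j) + k j) @ \oo --> y /\
     (fun j => 'D_1 g (tau j)) @ \oo --> xi) ->
  xi = Hp y (c + grad v y).
Proof.
move=> gmin [tau [k [taul [kint [_ [gl Dl]]]]]].
have [K K0 HK] := value_lipschitz HH eps0 rep vcont vper.
have [q fl] : exists q, flat v C y q.
  apply: Malpha_flat; apply: subset_closure; exists x, g; split => //.
  by exists tau, k.
have [_ ->] := flat_differentiable C0 fl.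
have [qg Hq] := HC gmin.
have [KL KL0 HL] := ham_lipschitz HH (`|c| + (K + C)).
have bnd y' q' : flat v C y' q' -> `|c + q'| <= `|c| + (K + C).
  by move=> fl'; rewrite (le_trans (ler_normD _ _))// lerD2l (flat_slope_le K0 HK C0 fl').
apply: (@vec_eq_of_dist _ _ _ _ (1 + KL * (1 + 6 * C))) => [|mu mu0 mu1].
  by rewrite addr_ge0// mulr_ge0// addr_ge0// mulr_ge0.
have m3 : 0 < mu ^+ 3 / 2 by rewrite divr_gt0// exprn_gt0.
have [j [tj gj Dj]] : exists j, [/\ tau j < -3, `|y - (g (tau j) + k j)| < mu ^+ 3 / 2 &
    `|xi - 'D_1 g (tau j)| < mu].
  move/cvgrNyPlt : taul => /(_ (- 3)) T1; move/cvgrPdist_lt : gl => /(_ _ m3) T2.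
  move/cvgrPdist_lt : Dl => /(_ _ mu0) T3.
  apply: (@filter_ex _ \oo); near=> j; split; near: j; [exact: T1|exact: T2|exact: T3].
have [flj [_ DE] _] := Hq _ tj.
have flk := flat_shift vper (kint j) flj.
have gj2 : `|g (tau j) + k j - y| <= mu ^+ 3 / 2 by rewrite distrC ltW.
have qd := flat_dist C0 fl flk mu0 mu1 gj2.
have [_ _ hP] := HL y _ (g (tau j) + k j) _ (bnd _ _ fl) (bnd _ _ flk).
have mu3 : mu ^+ 3 / 2 <= mu.
  rewrite ler_pdivrMr// exprS; apply: ler_wpM2l; first exact: ltW.
  by apply: (@le_trans _ _ 1); [rewrite exprn_ile1// ltW|rewrite ler1n].
rewrite DE -(Hp_periodic HH _ _ (kint j)) in Dj.
rewrite -(subrKA (Hp (g (tau j) + k j) (c + qg (tau j)))).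
apply: le_trans (ler_normD _ _) _; rewrite mulrDl mul1r; apply: lerD; first exact: ltW.
apply: (le_trans hP); rewrite -mulrA; apply: ler_wpM2l => //.
rewrite mulrDl mul1r; apply: lerD; first exact: le_trans gj2 mu3.
by rewrite opprD addrACA subrr add0r distrC.
Unshelve. all: by end_near. Qed.

Definition slope_along (g q : R -> 'rV[R]_n) := forall t : R, t < -3 ->
  [/\ flat v C (g t) (q t),
      is_derive t (1 : R) g (Hp (g t) (c + q t)) &
      forall i, is_derive t (1 : R) (fun s => q s 0 i) ((- Hx (g t) (c + q t) - eps *: q t) 0 i)].

Lemma slope_along_flow g q t : slope_along g q -> t < -3 ->
  discounted_flow H c eps g (fun s => c + q s) t.
Proof.
move=> Hq t3 i; have [_ [gd gE] qd] := Hq t t3; split.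
  by rewrite -gE; exact: is_derive_coord.
rewrite addrAC subrr add0r.
have -> : (fun s => (c + q s) 0 i) = (fun=> c 0 i) + (fun s => q s 0 i).
  by apply/funext => s; rewrite mxE.
by apply: (is_derive_eq (is_deriveD (is_derive_cst (c 0 i) t 1) (qd i))); rewrite add0r.
Qed.

(** Positions within [mu^3 / 2] force momenta within [6 * C * mu] by [flat_dist], so closeness of
    positions alone controls the full initial data of the flow. The condition [t + S < -3] keeps the
    whole time window where the minimizer solves the system. *)
Lemma minimizing_shadow (x p : R -> 'rV[R]_n) (S P : R) : 0 <= S ->
  (forall s, `|s| <= S -> `|p s| <= P /\ discounted_flow H c eps x p s) ->
  flat v C (x 0) (p 0 - c) ->
  exists2 B : R, 0 <= B & forall g q, slope_along g q -> forall t k mu,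
    0 < mu -> mu <= 1 -> t + S < -3 -> is_int_vec k -> `|g t + k - x 0| <= mu ^+ 3 / 2 ->
    forall s, `|s| <= S -> `|g (t + s) + k - x s| <= B * mu /\ `|c + q (t + s) - p s| <= B * mu.
Proof.
move=> S0 xp fl0.
have [K K0 HK] := value_lipschitz HH eps0 rep vcont vper.
have [B B0 HB] := discounted_flow_dist c HH eps0 (Num.max P (`|c| + (K + C))) S.
have CC : 0 <= 1 + 6 * C by rewrite addr_ge0// mulr_ge0.
exists (B * (1 + 6 * C)); first exact: mulr_ge0.
move=> g q Hq t k mu mu0 mu1 tS kint gt s sS.
have t3 r : `|r| <= S -> t + r < -3.
  by move=> rS; apply: le_lt_trans tS; rewrite lerD2l (le_trans (ler_norm _)).
rewrite -mulrA; apply: (HB (fun s => g (t + s) + k) (fun s => c + q (t + s))) => //.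
- move=> r rS; have [pP xr] := xp r rS; have [fl _ _] := Hq _ (t3 r rS); split => //.
  + rewrite le_max (_ : `|c + q (t + r)| <= `|c| + (K + C)) ?orbT//.
    by rewrite (le_trans (ler_normD _ _))// lerD2l (flat_slope_le K0 HK C0 fl).
  + by rewrite le_max pP.
  + exact: (discounted_flow_shift HH kint (slope_along_flow Hq (t3 r rS))).
- have mu3 : mu ^+ 3 / 2 <= mu.
    rewrite ler_pdivrMr// exprS; apply: ler_wpM2l; first exact: ltW.
    by apply: (@le_trans _ _ 1); [rewrite exprn_ile1// ltW|rewrite ler1n].
  rewrite addr0 mulrDl mul1r; apply: (le_trans gt); apply: (le_trans mu3).
  by rewrite lerDl !mulr_ge0// ltW.
- have t30 : t < -3 by have := t3 0; rewrite normr0 addr0; exact.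
  have [flt _ _] := Hq _ t30.
  have qd := flat_dist C0 fl0 (flat_shift vper kint flt) mu0 mu1 gt.
  rewrite addr0 distrC.
  have -> : p 0 - (c + q t) = p 0 - c - q t by rewrite opprD addrA.
  by apply: (le_trans qd); rewrite [leRHS]mulrDl mul1r lerDr ltW.
Qed.

Lemma cvgNy_shift_subseq (tau : nat -> R) (s : R) (J : nat) (j : nat -> nat) :
  tau @ \oo --> -oo -> (forall m, (m <= j m)%N) ->
  (fun m => tau (J + j m)%N + s) @ \oo --> -oo.
Proof.
move=> /cvgrNyPlt Ht jm; apply/cvgrNyPlt => A.
have [N _ HN] := Ht (A - s); exists N => // m /= Nm.
by rewrite -ltrBrDr; apply: HN => /=; rewrite (leq_trans Nm)// (leq_trans (jm m))// leq_addl.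
Qed.

(** Closeness to a single point of [g] says nothing about its limit points. The bound is therefore
    required along all late times [tau j + s], and a cluster point of the translated sequence is an
    alpha-limit point. *)
Lemma alpha_limit_bounded g (tau : nat -> R) (k : nat -> 'rV[R]_n) (s : R) z (r : R) J :
  tau @ \oo --> -oo -> (forall j, is_int_vec (k j)) ->
  (forall j, (J <= j)%N -> `|g (tau j + s) + k j - z| <= r) ->
  exists2 y, alpha_limit g y & `|y - z| <= r.
Proof.
move=> taul kint Hz; pose u j := g (tau (J + j)%N + s) + k (J + j)%N.
have uz j : `|u j - z| <= r by apply: Hz; exact: leq_addr.
have ub j : `|u j| <= r + `|z|.
  by rewrite -[u j](subrK z) (le_trans (ler_normD _ _))// lerD2r.
have [y Hy] := bolzano_weierstrass ub; exists y.
  have /choice[j Hj] : forall m : nat, exists j, (m <= j)%N /\ `|u j - y| < m.+1%:R^-1.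
    by move=> m; have [|j] := Hy m.+1%:R^-1 m; [rewrite invr_gt0|exists j].
  exists (fun m => tau (J + j m)%N + s), (fun m => k (J + j m)%N); split.
    by apply: cvgNy_shift_subseq => // m; have [] := Hj m.
  split=> //; apply/cvgrPdist_lt => e e0; near=> m.
  rewrite distrC; have [_ h1] := Hj m; apply: lt_trans h1 _.
  by near: m; exact: near_infty_natSinv_lt (PosNum e0).
apply/ler_addgt0Pr => e e0; have [j _ uy] := Hy e 0%N e0.
rewrite -(subrKA (u j)) addrC; apply: le_trans (ler_normD _ _) _.
by apply: lerD => //; rewrite distrC ltW.
Unshelve. all: by end_near. Qed.

(** Membership of [x s] uses a whole sequence of late times of one minimizer, to produce an
    alpha-limit point nearby; flatness at [x s] needs only one late time. *)
Lemma Malpha_flow (x p : R -> 'rV[R]_n) (S P : R) : 0 <= S ->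
  (forall s, `|s| <= S -> `|p s| <= P /\ discounted_flow H c eps x p s) ->
  M (x 0) -> flat v C (x 0) (p 0 - c) ->
  forall s, `|s| <= S -> M (x s) /\ flat v C (x s) (p s - c).
Proof.
move=> S0 xp Mx fl0 s sS.
have [K K0 HK] := value_lipschitz HH eps0 rep vcont vper.
have [B B0 HB] := minimizing_shadow S0 xp fl0.
have B1 : 0 < B + 1 by rewrite ltr_wpDl.
have small (e : R) : 0 < e -> exists2 mu : R, 0 < mu <= 1 & B * mu < e.
  move=> e0; have B2 : 0 < 2 * (B + 1) by rewrite mulr_gt0.
  exists (Num.min 1 (e / (2 * (B + 1)))).
    by rewrite lt_min ltr01 divr_gt0//= ge_min lexx.
  have h1 : Num.min 1 (e / (2 * (B + 1))) * (2 * (B + 1)) <= e.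
    by rewrite -ler_pdivlMr// ge_min lexx orbT.
  have h2 : 0 < Num.min 1 (e / (2 * (B + 1))) by rewrite lt_min ltr01 divr_gt0.
  move: h1 h2; move: (Num.min _ _) => mu; have := mulr_ge0 B0 (ltW e0); nra.
split.
  apply: near_closure => e e0; have [mu /andP[mu0 mu1] Bmu] := small e e0.
  (* One quarter for approximating [x 0] by an alpha-limit point, one for approximating that point
     along [g]. *)
  have m3 : 0 < mu ^+ 3 / 4 by rewrite divr_gt0// exprn_gt0.
  have [y' [x0 [g [gmin [tau [k [taul [kint gl]]]]]]] yy'] := closure_near Mx m3.
  have [q Hq] := HC gmin.
  have [J _ HJ] : \forall j \near \oo,
      tau j < - 3 - S /\ `|y' - (g (tau j) + k j)| < mu ^+ 3 / 4.
    move/cvgrNyPlt : taul => /(_ (- 3 - S)) T1; move/cvgrPdist_lt : gl => /(_ _ m3) T2.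
    by near=> j; split; near: j; [exact: T1|exact: T2].
  have [|y ay yd] := @alpha_limit_bounded g tau k s (x s) (B * mu) J taul kint.
    move=> j Jj; have [tj gj] := HJ j Jj.
    have gx : `|g (tau j) + k j - x 0| <= mu ^+ 3 / 2.
      rewrite -(subrKA y'); apply: le_trans (ler_normD _ _) _.
      rewrite distrC in gj; move: gj yy'; move: `|_| `|_| (mu ^+ 3) => *; lra.
    have tS : tau j + S < -3 by lra.
    by have [] := HB g q Hq (tau j) (k j) mu mu0 mu1 tS (kint j) gx s sS.
  by exists y; [exists x0, g|exact: le_trans yd (ltW Bmu)].
apply: (flat_limit K0 HK) => e e0; have [mu /andP[mu0 mu1] Bmu] := small e e0.
have m3 : 0 < mu ^+ 3 / 4 by rewrite divr_gt0// exprn_gt0.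
have [x0 [g [y' [gmin _ yy' [t [k [tS kint gy']]]]]]] := Malpha_near (- 3 - S) Mx m3.
have [q Hq] := HC gmin.
have gx : `|g t + k - x 0| <= mu ^+ 3 / 2.
  rewrite -(subrKA y'); apply: le_trans (ler_normD _ _) _.
  move: gy' yy'; move: `|_| `|_| (mu ^+ 3) => *; lra.
have tS' : t + S < -3 by lra.
have [d1 d2] := HB g q Hq t k mu mu0 mu1 tS' kint gx s sS.
have ts : t + s < -3.
  by apply: le_lt_trans tS'; rewrite lerD2l (le_trans (ler_norm _)).
have [fl _ _] := Hq _ ts.
exists (g (t + s) + k), (q (t + s)); split; first exact: flat_shift.
  exact: le_lt_trans d1 Bmu.
by rewrite opprB addrA [q _ + c]addrC; exact: le_lt_trans d2 Bmu.
Unshelve. all: by end_near. Qed.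

End limit_set.

Theorem theorem3p4 (R : realType) (n : nat)
  (H : 'rV[R]_n -> 'rV[R]_n -> R) (c : 'rV[R]_n) (h : R) (eps : R)
  (v : 'rV[R]_n -> R) :
  Hamiltonian_hyp H ->
  critical_value H c h ->
  0 < eps ->
  visc_sol eps H c h v ->
  (* representation formula for v^eps (valid for every x and T > 0) *)
  (forall (x : 'rV[R]_n) (T : R), 0 < T ->
     (v x)%:E = ereal_inf [set action eps H c h v g T | g in admissible x T]) ->
  let M := Malpha eps H c h v in
  (* (i) *)
  (forall y, M y -> differentiable v y) /\
  (* (ii) *)
  (forall (x0 : 'rV[R]_n) (g : R -> 'rV[R]_n), minimizing eps H c h v x0 g ->
     forall (y xi : 'rV[R]_n),
       (exists (tau : nat -> R) (k : nat -> 'rV[R]_n),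
          tau @ \oo --> -oo /\ (forall j, is_int_vec (k j)) /\
          (forall j, derivable g (tau j) 1) /\
          (fun j => g (tau j) + k j) @ \oo --> y /\
          (fun j => 'D_1 g (tau j)) @ \oo --> xi) ->
       xi = Hp H y (c + grad v y)) /\
  (* (iii) *)
  (forall (y : 'rV[R]_n), M y ->
     forall x : R -> 'rV[R]_n,
       (forall s, derivable x s 1) ->
       (forall s, derivable (fun r => Lxi H (x r) ('D_1 x r)) s 1) ->
       (forall s, 'D_1 (fun r => Lxi H (x r) ('D_1 x r)) s =
                  Lx H (x s) ('D_1 x s) - eps *: Lxi H (x s) ('D_1 x s) + eps *: c) ->
       x 0 = y ->
       'D_1 x 0 = Hp H y (c + grad v y) ->
       forall s : R, M (x s) /\ differentiable v (x s) /\
                     grad v (x s) = Lxi H (x s) ('D_1 x s) - c).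
Proof.
move=> HH _ eps0 [vcont [vper _]] rep M.
have [C C0 HC] := minimizing_hamiltonian HH eps0 rep vcont vper.
have flM := Malpha_flat HH eps0 rep vcont vper C0 HC.
split; first by move=> y My; have [q fl] := flM y My; have [] := flat_differentiable C0 fl.
split.
  move=> x0 g gmin y xi.
  exact: (Malpha_velocity HH eps0 rep vcont vper C0 HC gmin).
move=> y My x xd pd pE x0 vx0 s.
pose p r := Lxi H (x r) ('D_1 x r).
have [q fl] := flM y My; have [_ gq] := flat_differentiable C0 fl.
have p0 : p 0 = c + q by rewrite /p vx0 x0 gq (Lxi_Hp HH).
(* The Lipschitz bounds on [H] hold only on balls of momenta; continuity bounds the momentum of [x]
   on the compact time interval up to [|s|], with a bound depending on [s]. *)
have pc : {within `[- `|s|, `|s|], continuous (fun r => `|p r|)}.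
  apply: continuous_subspaceT => r; apply: continuous_comp; last exact: norm_continuous.
  by apply: differentiable_continuous; apply/derivable1_diffP; exact: pd.
have ss : - `|s| <= `|s| by rewrite ge0_cp.
have [r0 _ Hr0] := EVT_max ss pc.
have xp r : `|r| <= `|s| -> `|p r| <= `|p r0| /\ discounted_flow H c eps x p r.
  move=> rs; split; first by apply: Hr0; rewrite in_itv/= -ler_norml.
  exact: (discounted_flow_of_EL HH (xd r) (pd r) (pE r)).
have Mx : M (x 0) by rewrite x0.
have flx : flat v C (x 0) (p 0 - c) by rewrite x0 p0 addrC addKr.
have [Ms fls] := Malpha_flow HH eps0 rep vcont vper C0 HC (normr_ge0 s) xp Mx flx (lexx _).
by have [] := flat_differentiable C0 fls.
Qed.
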